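(* On the algebra $\mathrm{JS}^\infty=\mathbb C[\wp,\partial_z\wp,\mathrm e_4,\mathrm E_1,\mathrm e_2]$ of singular quasi-Jacobi forms of index zero, let $d=\partial_\tau+\frac14\mathrm E_1\partial_z$ and let $([\![\cdot,\cdot]\!]_n)_{n\ge0}$ be the sequence of maps defined by bilinear extension of $$[\![f,g]\!]_n=\sum_{r=0}^n(-1)^r\binom{k+n-1}{n-r}\binom{\ell+n-1}{r}d^r(f)\,d^{n-r}(g)\qquad(f\in\mathrm{JS}^\infty_k,\ g\in\mathrm{JS}^\infty_\ell).$$ The subalgebra $\mathrm{JS}=\mathbb C[\wp,\partial_z\wp,\mathrm e_4]$ of singular Jacobi forms of index zero is stable under this sequence: $[\![f,g]\!]_n\in\mathrm{JS}$ for all $f,g\in\mathrm{JS}$ and all $n\ge0$.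
   Context: $\mathcal H$ is the upper half-plane. All functions are functions of $(\tau,z)\in\mathcal H\times\mathbb C$, possibly with poles in $z$ at $\mathbb Z\oplus\tau\mathbb Z$; functions of $\tau$ alone are viewed as functions of $(\tau,z)$. $\partial_z=\partial/\partial z$ and $\partial_\tau=\frac{\pi}{2i}\frac{\partial}{\partial\tau}$. $\wp(\tau,z)=\frac1{z^2}+\sum_{w\in(\mathbb Z\oplus\tau\mathbb Z)\setminus\{0\}}\left(\frac1{(z-w)^2}-\frac1{w^2}\right)$; $\mathrm e_4(\tau)=\sum_{w\in(\mathbb Z\oplus\tau\mathbb Z)\setminus\{0\}}w^{-4}$; $\mathrm e_2(\tau)=\frac{\pi^2}3\left(1-24\sum_{n\ge1}\sigma_1(n)e^{2i\pi n\tau}\right)$ with $\sigma_1(n)=\sum_{d\mid n}d$; $\mathrm E_1(\tau,z)=\lim_{N\to\infty}\sum_{n=-N}^N\left(\lim_{M\to\infty}\sum_{m=-M}^M\frac1{z+m+n\tau}\right)$. The five functions $\wp,\partial_z\wp,\mathrm e_4,\mathrm E_1,\mathrm e_2$ are algebraically independent and $\mathrm{JS}^\infty$ is graded by weight, with these generators of weights $2,3,4,1,2$ respectively; $\mathrm{JS}^\infty_k$ is the weight-$k$ component. $\mathrm{JS}^\infty$ is stable under $\partial_\tau$ and $\partial_z$. *)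

(* Defs.v *)
(* Stdlib world: Stdlib reals, Coquelicot's complex numbers; binomial
   coefficients and divisors of natural numbers are those of MathComp. *)
From Stdlib Require Import Reals ZArith List.
From Coquelicot Require Import Coquelicot.
From mathcomp Require seq prime binomial.

Open Scope C_scope.

(** * Limits and sums of complex numbers *)

(* The unique complex number satisfying [P], when there is one. *)
Definition C_iota (P : C -> Prop) : C := @iota C_CompleteNormedModule P.

Definition Cexp (z : C) : C :=
  (exp (Re z) * cos (Im z), exp (Re z) * sin (Im z))%R.

Definition C_Series (a : nat -> C) : C :=
  C_iota (fun s => @is_series C_AbsRing C_NormedModule a s).

(* [sym_lim f] is the limit, as N tends to infinity, of the sum of the [f n]
   for -N <= n <= N. *)
Definition sym_sum (f : Z -> C) (N : nat) : C :=
  sum_n (fun k => f (Z.of_nat k - Z.of_nat N)%Z) (2 * N).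

Definition sym_lim (f : Z -> C) : C :=
  C_iota (fun l => filterlim (sym_sum f) eventually (locally l)).

(* Unordered (unconditional) summation over a set [L] of complex numbers:
   limit of the sums over the finite subsets of [L], directed by inclusion. *)
Definition is_sum_over (L : C -> Prop) (F : C -> C) (s : C) : Prop :=
  forall eps : posreal,
  exists A : list C, List.Forall L A /\
    forall B : list C, List.Forall L B -> List.NoDup B -> List.incl A B ->
      (Cmod (List.fold_right Cplus 0 (List.map F B) - s) < eps)%R.

Definition sum_over (L : C -> Prop) (F : C -> C) : C :=
  C_iota (is_sum_over L F).

(** * The functions *)

Definition lattice (tau w : C) : Prop :=
  exists m n : Z, w = IZR m + IZR n * tau.

Definition lattice' (tau w : C) : Prop := lattice tau w /\ w <> 0.

(* Functions of (tau, z) are total functions which are only meaningful on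
   [dom]; [feq] is equality of such functions. *)
Definition jfun : Type := C -> C -> C.

Definition dom (tau z : C) : Prop := (0 < Im tau)%R /\ ~ lattice tau z.

Definition feq (f g : jfun) : Prop :=
  forall tau z : C, dom tau z -> f tau z = g tau z.

Definition fconst (c : C) : jfun := fun _ _ => c.
Definition fadd (f g : jfun) : jfun := fun tau z => f tau z + g tau z.
Definition fmul (f g : jfun) : jfun := fun tau z => f tau z * g tau z.
Definition fscal (c : C) (f : jfun) : jfun := fun tau z => c * f tau z.

(* [C_derive f z] is the complex derivative of f at z whenever f is complex
   differentiable at z; elements of JS^infinity are holomorphic on [dom]. *)
Definition dz (f : jfun) : jfun := fun tau z => C_derive (f tau) z.

Definition dtau (f : jfun) : jfun :=
  fun tau z => PI / (2 * Ci) * C_derive (fun t => f t z) tau.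

Definition wp : jfun := fun tau z =>
  1 / z ^ 2 + sum_over (lattice' tau) (fun w => 1 / (z - w) ^ 2 - 1 / w ^ 2).

Definition e4 : jfun := fun tau _ =>
  sum_over (lattice' tau) (fun w => 1 / w ^ 4).

Definition sigma1 (n : nat) : nat := seq.sumn (prime.divisors n).

(* The sum starts at 1, hence the shift of the index. *)
Definition e2 : jfun := fun tau _ =>
  PI ^ 2 / 3 *
  (1 - 24 * C_Series (fun n =>
              INR (sigma1 (S n)) * Cexp (2 * Ci * PI * INR (S n) * tau))).

Definition Eis1 : jfun := fun tau z =>
  sym_lim (fun n => sym_lim (fun m => 1 / (z + IZR m + IZR n * tau))).

(** * The algebras *)

Inductive JS_gen : jfun -> Prop :=
| JS_gen_wp : JS_gen wp
| JS_gen_dwp : JS_gen (dz wp)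
| JS_gen_e4 : JS_gen e4.

(* The generators of JS^infinity, with their weights. *)
Inductive JSinf_gen : nat -> jfun -> Prop :=
| JSinf_gen_wp : JSinf_gen 2 wp
| JSinf_gen_dwp : JSinf_gen 3 (dz wp)
| JSinf_gen_e4 : JSinf_gen 4 e4
| JSinf_gen_Eis1 : JSinf_gen 1 Eis1
| JSinf_gen_e2 : JSinf_gen 2 e2.

Inductive subalg (G : jfun -> Prop) : jfun -> Prop :=
| subalg_gen f : G f -> subalg G f
| subalg_const c : subalg G (fconst c)
| subalg_add f g : subalg G f -> subalg G g -> subalg G (fadd f g)
| subalg_mul f g : subalg G f -> subalg G g -> subalg G (fmul f g)
| subalg_feq f g : feq f g -> subalg G f -> subalg G g.

Definition JS : jfun -> Prop := subalg JS_gen.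

Definition JSinf : jfun -> Prop :=
  subalg (fun f => exists k, JSinf_gen k f).

(* [JSinf_wt k] is the weight-k component: the span of the monomials of
   weight k in the generators. *)
Inductive JSinf_wt : nat -> jfun -> Prop :=
| wt_gen k f : JSinf_gen k f -> JSinf_wt k f
| wt_const c : JSinf_wt 0 (fconst c)
| wt_add k f g : JSinf_wt k f -> JSinf_wt k g -> JSinf_wt k (fadd f g)
| wt_mul k l f g : JSinf_wt k f -> JSinf_wt l g -> JSinf_wt (k + l) (fmul f g)
| wt_feq k f g : feq f g -> JSinf_wt k f -> JSinf_wt k g.

(** * The brackets *)

Definition dJ (f : jfun) : jfun :=
  fadd (dtau f) (fscal (1 / 4) (fmul Eis1 (dz f))).

(* Truncation in [k + n - 1] only occurs for k = n = 0, and then the lower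
   entry of the binomial coefficient is 0, so that its value is 1 as it should
   be; similarly for [l + n - 1]. *)
Definition RC (n k l : nat) (f g : jfun) : jfun := fun tau z =>
  sum_n (fun r : nat =>
           (- (1)) ^ r *
           INR (binomial.binomial (k + n - 1) (n - r)) *
           INR (binomial.binomial (l + n - 1) r) *
           (Nat.iter r dJ f tau z * Nat.iter (n - r) dJ g tau z)) n.

(* [br] is the sequence of maps on JS^infinity obtained from [RC] by bilinear
   extension. As JS^infinity is the direct sum of its weight components, these
   conditions determine [br n f g] on [dom]. *)
Record is_bilinear_extension (br : nat -> jfun -> jfun -> jfun) : Prop := {
  br_feq : forall n f f' g g', JSinf f -> JSinf g ->
    feq f f' -> feq g g' -> feq (br n f g) (br n f' g');
  br_addl : forall n f f' g, JSinf f -> JSinf f' -> JSinf g ->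
    feq (br n (fadd f f') g) (fadd (br n f g) (br n f' g));
  br_scall : forall n c f g, JSinf f -> JSinf g ->
    feq (br n (fscal c f) g) (fscal c (br n f g));
  br_addr : forall n f g g', JSinf f -> JSinf g -> JSinf g' ->
    feq (br n f (fadd g g')) (fadd (br n f g) (br n f g'));
  br_scalr : forall n c f g, JSinf f -> JSinf g ->
    feq (br n f (fscal c g)) (fscal c (br n f g));
  br_homog : forall n k l f g, JSinf_wt k f -> JSinf_wt l g ->
    feq (br n f g) (RC n k l f g)
}.

(* Main.v *)
Require Import Defs.
From Stdlib Require Import Reals ZArith List Lra Lia Permutation ClassicalEpsilon.
From Coquelicot Require Import Coquelicot.
From mathcomp Require seq prime binomial.

Open Scope C_scope.

(* Write c(a) = pi cot(pi a), s = -c', and let E1, E2 be the sums of c(z + n tau)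
   and s(z + n tau) over n; the partial fractions of c and s give E2 = wp + e2.
   The addition theorem of the cotangent expresses s(a) s(b) and c(a) s'(b)
   through functions of a - b times functions of a or of b alone. Summed over
   a = z + (m + k) tau and b = z + m tau, where the sum over m telescopes, it
   yields E2^2 and E1 E2' in terms of the tau-derivatives of e2 and E2; the same
   computation at z = 0 gives the tau-derivative of e2. Hence
   wp'' = 6 wp^2 - 30 e4, d e2 = (e2^2 - 5 e4)/4, and d f - (k/4) e2 f is in JS
   for f in JS of weight k. In the ring of formal polynomials over JS in the
   variable T = e2, the derivation d/dT then satisfies
   (d/dT) d^r f = (r (k + r - 1)/4) d^(r-1) f, so that the T-derivative of the
   bracket telescopes to 0 and the bracket does not involve e2. *)

(** * Unconditional sums *)

(** Every double sum is taken unconditionally, over finite sets of indices, so that it may be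
    reindexed and summed in either order. The one series that resists is that of the cotangents:
    [cotp] tends to -pi i and to pi i at the two ends of the strip, and only the terms corrected by
    pi i sgn(n) are summable. This correction is the source of the derivatives in tau: moving the
    cotangent sum by k steps changes it by 2 pi i k, and a factor k in front of s'(k tau) is what
    d/dtau of s(k tau) produces. In the resulting formulas E1 enters the tau-derivative of wp, wp'
    and wp'' only as E1 times the z-derivative of the same function, with the coefficient that the
    term E1/4 of d cancels. Hence d preserves the polynomials in wp, wp', e4, e2. The derivation
    d/dT is defined on expressions, as a function does not come with a polynomial representing it;
    the identities between expressions hold for all values of four free variables and are evaluated
    at the actual functions only at the end. *)

Definition csum {T : Type} (F : T -> C) (B : list T) : C :=
  fold_right Cplus 0 (map F B).

Definition rsum {T : Type} (f : T -> R) (B : list T) : R :=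
  fold_right Rplus 0%R (map f B).

(** The counterpart of [is_sum_over] for a family indexed by a whole type, the form in which sums
    can be moved between the integers, pairs of integers and the lattice. *)
Definition is_usum {T : Type} (F : T -> C) (s : C) : Prop :=
  forall eps : posreal, exists A : list T, forall B : list T,
    NoDup B -> incl A B -> (Cmod (csum F B - s) < eps)%R.

Definition summable {T : Type} (g : T -> R) : Prop :=
  (forall t, (0 <= g t)%R) /\
  exists M : R, forall B : list T, NoDup B -> (rsum g B <= M)%R.

Definition undup {T : Type} (A : list T) : list T :=
  nodup (fun x y => excluded_middle_informative (x = y)) A.

Definition memb {T : Type} (A : list T) (t : T) : bool :=
  if excluded_middle_informative (In t A) then true else false.

Lemma undup_NoDup {T : Type} (A : list T) : NoDup (undup A).
Proof. apply NoDup_nodup. Qed.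

Lemma In_undup {T : Type} (A : list T) (t : T) : In t (undup A) <-> In t A.
Proof. apply nodup_In. Qed.

Lemma membP {T : Type} (A : list T) (t : T) : memb A t = true <-> In t A.
Proof.
  unfold memb. destruct (excluded_middle_informative (In t A));
    split; auto; try discriminate; tauto.
Qed.

(** [B ++ missing A B] is how a duplicate-free list B is enlarged to contain A without
    repetition. *)
Definition missing {T : Type} (A B : list T) : list T :=
  filter (fun t => negb (memb B t)) (undup A).

Lemma In_missing {T : Type} (A B : list T) (t : T) :
  In t (missing A B) <-> In t A /\ ~ In t B.
Proof.
  unfold missing. rewrite filter_In, In_undup, <- (membP B).
  destruct (memb B t); simpl; intuition discriminate.
Qed.

Lemma NoDup_app_missing {T : Type} (A B : list T) :
  NoDup B -> NoDup (B ++ missing A B).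
Proof.
  intros HB. apply NoDup_app; auto.
  - apply NoDup_filter, undup_NoDup.
  - intros t H1 H2. apply In_missing in H2. tauto.
Qed.

Lemma incl_app_missing {T : Type} (A B : list T) : incl A (B ++ missing A B).
Proof.
  intros t Ht. apply in_or_app. destruct (classic (In t B)); auto.
  right. apply In_missing. auto.
Qed.

Lemma csum_app {T : Type} (F : T -> C) (A B : list T) :
  csum F (A ++ B) = csum F A + csum F B.
Proof.
  unfold csum. induction A as [|a A IH]; simpl.
  - ring.
  - rewrite IH. ring.
Qed.

Lemma rsum_app {T : Type} (f : T -> R) (A B : list T) :
  rsum f (A ++ B) = (rsum f A + rsum f B)%R.
Proof.
  unfold rsum. induction A as [|a A IH]; simpl.
  - ring.
  - rewrite IH. ring.
Qed.

Lemma csum_Permutation {T : Type} (F : T -> C) (A B : list T) :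
  Permutation A B -> csum F A = csum F B.
Proof.
  intros H. unfold csum. induction H; simpl; try congruence. ring.
Qed.

Lemma rsum_Permutation {T : Type} (f : T -> R) (A B : list T) :
  Permutation A B -> rsum f A = rsum f B.
Proof.
  intros H. unfold rsum. induction H; simpl; try congruence. ring.
Qed.

Lemma csum_ext {T : Type} (F G : T -> C) (B : list T) :
  (forall t, In t B -> F t = G t) -> csum F B = csum G B.
Proof. intros H. unfold csum. f_equal. apply map_ext_in. auto. Qed.

Lemma csum_0 {T : Type} (F : T -> C) (B : list T) :
  (forall t, In t B -> F t = 0) -> csum F B = 0.
Proof.
  unfold csum. induction B as [|b B IH]; simpl; intros H; auto.
  rewrite H, IH; auto. ring.
Qed.

Lemma rsum_le {T : Type} (f g : T -> R) (B : list T) :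
  (forall t, In t B -> (f t <= g t)%R) -> (rsum f B <= rsum g B)%R.
Proof.
  unfold rsum. induction B as [|b B IH]; simpl; intros H; try lra.
  apply Rplus_le_compat; auto.
Qed.

Lemma rsum_ge_0 {T : Type} (f : T -> R) (B : list T) :
  (forall t, In t B -> (0 <= f t)%R) -> (0 <= rsum f B)%R.
Proof.
  unfold rsum. induction B as [|b B IH]; simpl; intros H; try lra.
  apply Rplus_le_le_0_compat; auto.
Qed.

Lemma Cmod_csum_le {T : Type} (F : T -> C) (g : T -> R) (B : list T) :
  (forall t, In t B -> (Cmod (F t) <= g t)%R) -> (Cmod (csum F B) <= rsum g B)%R.
Proof.
  unfold csum, rsum. induction B as [|b B IH]; simpl; intros H.
  - rewrite Cmod_0. lra.
  - eapply Rle_trans; [apply Cmod_triangle|]. apply Rplus_le_compat; auto.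
Qed.

Lemma csum_plus {T : Type} (F G : T -> C) (B : list T) :
  csum (fun t => F t + G t) B = csum F B + csum G B.
Proof.
  unfold csum. induction B as [|b B IH]; simpl; [ring | rewrite IH; ring].
Qed.

Lemma csum_scal {T : Type} (c : C) (F : T -> C) (B : list T) :
  csum (fun t => c * F t) B = c * csum F B.
Proof.
  unfold csum. induction B as [|b B IH]; simpl; [ring | rewrite IH; ring].
Qed.

Lemma rsum_scal {T : Type} (c : R) (f : T -> R) (B : list T) :
  rsum (fun t => c * f t)%R B = (c * rsum f B)%R.
Proof.
  unfold rsum. induction B as [|b B IH]; simpl; [ring | rewrite IH; ring].
Qed.

Lemma rsum_plus {T : Type} (f g : T -> R) (B : list T) :
  rsum (fun t => f t + g t)%R B = (rsum f B + rsum g B)%R.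
Proof.
  unfold rsum. induction B as [|b B IH]; simpl; [ring | rewrite IH; ring].
Qed.

Lemma csum_map {T U : Type} (phi : U -> T) (F : T -> C) (B : list U) :
  csum F (map phi B) = csum (fun u => F (phi u)) B.
Proof. unfold csum. rewrite map_map. reflexivity. Qed.

Lemma rsum_map {T U : Type} (phi : U -> T) (f : T -> R) (B : list U) :
  rsum f (map phi B) = rsum (fun u => f (phi u)) B.
Proof. unfold rsum. rewrite map_map. reflexivity. Qed.

Lemma csum_RtoC {T : Type} (f : T -> R) (B : list T) :
  csum (fun t => RtoC (f t)) B = RtoC (rsum f B).
Proof.
  unfold csum, rsum. induction B as [|b B IH]; simpl; auto.
  rewrite IH, RtoC_plus. reflexivity.
Qed.

Lemma NoDup_incl_Permutation {T : Type} (A B : list T) :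
  NoDup A -> NoDup B -> incl A B -> Permutation B (A ++ missing B A).
Proof.
  intros HA HB HAB. apply NoDup_Permutation; auto using NoDup_app_missing.
  intros t. rewrite in_app_iff, In_missing. specialize (HAB t).
  destruct (classic (In t A)); tauto.
Qed.

Lemma rsum_incl {T : Type} (f : T -> R) (A B : list T) :
  (forall t, (0 <= f t)%R) -> NoDup A -> NoDup B -> incl A B ->
  (rsum f A <= rsum f B)%R.
Proof.
  intros Hf HA HB HAB.
  rewrite (rsum_Permutation f _ _ (NoDup_incl_Permutation A B HA HB HAB)), rsum_app.
  assert (0 <= rsum f (missing B A))%R by (apply rsum_ge_0; auto). lra.
Qed.

Lemma half_pos (eps : posreal) : (0 < eps / 2)%R.
Proof. destruct eps as [e He]; simpl; lra. Qed.

Lemma Cmod_sub_self (x : C) (r : posreal) : (Cmod (x - x) < r)%R.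
Proof. replace (x - x) with (RtoC 0) by ring. rewrite Cmod_0. apply cond_pos. Qed.

Lemma common_radius (r r' : posreal) : exists d : posreal, (d <= r)%R /\ (d <= r')%R.
Proof.
  assert (H : (0 < Rmin r r')%R) by (apply Rmin_pos; apply cond_pos).
  exists (mkposreal _ H). split; [apply Rmin_l | apply Rmin_r].
Qed.

Lemma Cmod_sub_sym (x y : C) : Cmod (x - y) = Cmod (y - x).
Proof. rewrite <- Cmod_opp. f_equal. ring. Qed.

Lemma Cmod_sub_triangle (x y z : C) : (Cmod (x - z) <= Cmod (x - y) + Cmod (y - z))%R.
Proof. replace (x - z) with ((x - y) + (y - z)) by ring. apply Cmod_triangle. Qed.

Lemma Cmod_eq_of_small (x y : C) :
  (forall eps : posreal, (Cmod (x - y) < eps)%R) -> x = y.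
Proof.
  intros H. apply Ceq_minus, Cmod_eq_0.
  apply Rle_antisym; [|apply Cmod_ge_0].
  apply le_epsilon. intros e He. specialize (H (mkposreal e He)). simpl in H. lra.
Qed.

Lemma is_usum_unique {T : Type} (F : T -> C) (s t : C) :
  is_usum F s -> is_usum F t -> s = t.
Proof.
  intros Hs Ht. apply Cmod_eq_of_small. intros eps.
  destruct (Hs (mkposreal _ (half_pos eps))) as [A1 H1].
  destruct (Ht (mkposreal _ (half_pos eps))) as [A2 H2]. simpl in *.
  set (B := undup (A1 ++ A2)).
  assert (HB : NoDup B) by apply undup_NoDup.
  specialize (H1 B HB). specialize (H2 B HB).
  assert (Hi : forall x, In x A1 \/ In x A2 -> In x B).
  { intros x Hx. apply In_undup, in_or_app. auto. }
  specialize (H1 (fun x h => Hi x (or_introl h))).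
  specialize (H2 (fun x h => Hi x (or_intror h))).
  pose proof (Cmod_sub_triangle s (csum F B) t) as H.
  rewrite (Cmod_sub_sym s (csum F B)) in H. lra.
Qed.

Lemma is_usum_ext {T : Type} (F G : T -> C) (s : C) :
  (forall t, F t = G t) -> is_usum F s -> is_usum G s.
Proof.
  intros H HF eps. destruct (HF eps) as [A HA]. exists A. intros B HB HAB.
  rewrite <- (csum_ext F G); auto.
Qed.

Lemma is_usum_eq {T : Type} (F : T -> C) (s t : C) :
  is_usum F s -> s = t -> is_usum F t.
Proof. intros H <-. exact H. Qed.

Lemma is_usum_plus {T : Type} (F G : T -> C) (s t : C) :
  is_usum F s -> is_usum G t -> is_usum (fun x => F x + G x) (s + t).
Proof.
  intros Hs Ht eps.
  destruct (Hs (mkposreal _ (half_pos eps))) as [A1 H1].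
  destruct (Ht (mkposreal _ (half_pos eps))) as [A2 H2]. simpl in *.
  exists (A1 ++ A2). intros B HB HAB. apply incl_app_inv in HAB. destruct HAB.
  specialize (H1 B). specialize (H2 B). rewrite csum_plus.
  replace (csum F B + csum G B - (s + t)) with ((csum F B - s) + (csum G B - t)) by ring.
  eapply Rle_lt_trans; [apply Cmod_triangle|].
  specialize (H1 HB H). specialize (H2 HB H0). lra.
Qed.

Lemma is_usum_scal {T : Type} (c : C) (F : T -> C) (s : C) :
  is_usum F s -> is_usum (fun x => c * F x) (c * s).
Proof.
  intros Hs eps.
  assert (Hc : (0 < Cmod c + 1)%R) by (pose proof (Cmod_ge_0 c); lra).
  assert (He : (0 < eps / (Cmod c + 1))%R) by (apply Rdiv_lt_0_compat; [apply cond_pos | auto]).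
  destruct (Hs (mkposreal _ He)) as [A HA]. exists A. intros B HB HAB.
  specialize (HA B HB HAB). simpl in HA.
  rewrite csum_scal. replace (c * csum F B - c * s) with (c * (csum F B - s)) by ring.
  rewrite Cmod_mult.
  apply Rle_lt_trans with ((Cmod c + 1) * Cmod (csum F B - s))%R.
  - apply Rmult_le_compat_r; [apply Cmod_ge_0 | lra].
  - apply (Rmult_lt_compat_l (Cmod c + 1)) in HA; auto.
    replace ((Cmod c + 1) * (eps / (Cmod c + 1)))%R with (pos eps) in HA by (field; lra).
    exact HA.
Qed.

Lemma is_usum_minus {T : Type} (F G : T -> C) (s t : C) :
  is_usum F s -> is_usum G t -> is_usum (fun x => F x - G x) (s - t).
Proof.
  intros Hs Ht. replace (s - t) with (s + (- (1)) * t) by ring.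
  apply (is_usum_ext (fun x => F x + (- (1)) * G x)); [intros; ring|].
  apply is_usum_plus; auto. apply is_usum_scal. auto.
Qed.

Lemma is_usum_finite {T : Type} (F : T -> C) (A : list T) :
  NoDup A -> (forall t, ~ In t A -> F t = 0) -> is_usum F (csum F A).
Proof.
  intros HA H eps. exists A. intros B HB HAB.
  rewrite (csum_Permutation F _ _ (NoDup_incl_Permutation A B HA HB HAB)), csum_app.
  rewrite (csum_0 F (missing B A)).
  - replace (csum F A + 0 - csum F A) with (RtoC 0) by ring. rewrite Cmod_0. apply cond_pos.
  - intros t Ht. apply In_missing in Ht. apply H. tauto.
Qed.

Lemma is_usum_single {T : Type} (F : T -> C) (t : T) :
  (forall x, x <> t -> F x = 0) -> is_usum F (F t).
Proof.
  intros H. apply is_usum_eq with (csum F (t :: nil)).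
  - apply is_usum_finite.
    + constructor; auto. constructor.
    + intros x Hx. apply H. intros ->. apply Hx. simpl. auto.
  - unfold csum. simpl. ring.
Qed.

(** * Summable families of nonnegative reals *)

Lemma summable_le {T : Type} (f g : T -> R) :
  (forall t, (0 <= f t <= g t)%R) -> summable g -> summable f.
Proof.
  intros H [_ [M HM]]. split; [intros t; apply H|]. exists M. intros B HB.
  apply Rle_trans with (rsum g B); auto. apply rsum_le. intros t _. apply H.
Qed.

Lemma summable_plus {T : Type} (f g : T -> R) :
  summable f -> summable g -> summable (fun t => f t + g t)%R.
Proof.
  intros [Hf [M HM]] [Hg [N HN]]. split.
  - intros t. specialize (Hf t). specialize (Hg t). lra.
  - exists (M + N)%R. intros B HB. rewrite rsum_plus.
    specialize (HM B HB). specialize (HN B HB). lra.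
Qed.

Lemma summable_scal {T : Type} (c : R) (f : T -> R) :
  (0 <= c)%R -> summable f -> summable (fun t => c * f t)%R.
Proof.
  intros Hc [Hf [M HM]]. split.
  - intros t. apply Rmult_le_pos; auto.
  - exists (c * M)%R. intros B HB. rewrite rsum_scal. apply Rmult_le_compat_l; auto.
Qed.

Lemma summable_finite {T : Type} (f : T -> R) (A : list T) :
  (forall t, (0 <= f t)%R) -> (forall t, ~ In t A -> f t = 0%R) -> summable f.
Proof.
  intros Hf H. split; auto. exists (rsum f (undup A)). intros B HB.
  assert (E : rsum f B = rsum f (filter (memb A) B)).
  { clear HB. unfold rsum. induction B as [|b B IH]; simpl; auto.
    rewrite IH. unfold memb at 2. destruct (excluded_middle_informative (In b A)); simpl; auto.
    rewrite H; auto. apply Rplus_0_l. }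
  rewrite E. apply rsum_incl; auto.
  - apply NoDup_filter. auto.
  - apply undup_NoDup.
  - intros t Ht. apply filter_In in Ht. apply In_undup, membP. tauto.
Qed.

Lemma summable_le_except {T : Type} (f g : T -> R) (A : list T) :
  (forall t, (0 <= f t)%R) -> (forall t, ~ In t A -> (f t <= g t)%R) ->
  summable g -> summable f.
Proof.
  intros Hf H Hg.
  apply (summable_le f (fun t => g t + (if memb A t then f t else 0))%R).
  - intros t. split; auto. pose proof (proj1 Hg t). pose proof (membP A t) as H1.
    destruct (memb A t).
    + lra.
    + specialize (H t). rewrite Rplus_0_r. apply H. rewrite <- H1. discriminate.
  - apply summable_plus; auto. apply (summable_finite _ A).
    + intros t. destruct (memb A t); auto. lra.
    + intros t Ht. pose proof (membP A t). destruct (memb A t); auto. tauto.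
Qed.

Lemma summable_comp_inj {T U : Type} (phi : U -> T) (f : T -> R) :
  (forall u v, phi u = phi v -> u = v) -> summable f ->
  summable (fun u => f (phi u)).
Proof.
  intros Hphi [Hf [M HM]]. split; auto. exists M. intros B HB.
  rewrite <- rsum_map. apply HM. apply FinFun.Injective_map_NoDup; auto.
Qed.

Lemma NoDup_list_prod {T U : Type} (A : list T) (B : list U) :
  NoDup A -> NoDup B -> NoDup (list_prod A B).
Proof.
  intros HA HB. induction HA as [|a A Ha HA IH]; simpl; [constructor|].
  apply NoDup_app; auto.
  - apply FinFun.Injective_map_NoDup; auto. intros x y H. congruence.
  - intros [x y] H1 H2. apply in_map_iff in H1. destruct H1 as [z [Hz _]].
    apply in_prod_iff in H2. inversion Hz; subst. tauto.
Qed.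

Lemma summable_prod {T U : Type} (f : T -> R) (g : U -> R) :
  summable f -> summable g -> summable (fun p => f (fst p) * g (snd p))%R.
Proof.
  intros [Hf [M HM]] [Hg [N HN]]. split.
  - intros p. apply Rmult_le_pos; auto.
  - exists (M * N)%R. intros B HB.
    set (B1 := undup (map fst B)). set (B2 := undup (map snd B)).
    assert (E : forall l, rsum (fun p => f (fst p) * g (snd p))%R (list_prod l B2)
                = (rsum f l * rsum g B2)%R).
    { induction l as [|b l IH]; simpl.
      - unfold rsum. simpl. ring.
      - rewrite rsum_app, IH, rsum_map. simpl. rewrite rsum_scal.
        unfold rsum at 4. simpl. fold (rsum f l). ring. }
    apply Rle_trans with (rsum (fun p => f (fst p) * g (snd p))%R (list_prod B1 B2)).
    + apply rsum_incl; auto.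
      * intros p. apply Rmult_le_pos; auto.
      * apply NoDup_list_prod; apply undup_NoDup.
      * intros [t u] Ht. apply in_prod; apply In_undup.
        -- apply (in_map fst) in Ht. auto.
        -- apply (in_map snd) in Ht. auto.
    + rewrite E.
      assert (0 <= rsum f B1)%R by (apply rsum_ge_0; auto).
      assert (0 <= rsum g B2)%R by (apply rsum_ge_0; auto).
      apply Rmult_le_compat; auto; [apply HM | apply HN]; apply undup_NoDup.
Qed.

Lemma summable_sup {T : Type} (g : T -> R) : summable g -> exists s : R,
  (forall B, NoDup B -> (rsum g B <= s)%R) /\
  forall eps : posreal, exists A, NoDup A /\ (s - eps < rsum g A)%R.
Proof.
  intros [Hg [M HM]].
  set (E := fun x => exists B, NoDup B /\ x = rsum g B).
  destruct (completeness E) as [s [Hs1 Hs2]].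
  { exists M. intros x [B [HB ->]]. auto. }
  { exists (rsum g nil). exists nil. split; auto. constructor. }
  exists s. split; [intros B HB; apply Hs1; exists B; auto|].
  intros eps. apply NNPP. intros HN.
  assert (s <= s - eps)%R.
  { apply Hs2. intros x [B [HB ->]]. apply Rnot_lt_le. intros Hlt. apply HN. eauto. }
  pose proof (cond_pos eps). lra.
Qed.

Lemma summable_tail {T : Type} (g : T -> R) (eps : posreal) :
  summable g -> exists A, NoDup A /\ forall B, NoDup B ->
    (forall t, In t B -> ~ In t A) -> (rsum g B <= eps)%R.
Proof.
  intros Hg. destruct (summable_sup g Hg) as [s [Hs1 Hs2]].
  destruct (Hs2 eps) as [A [HA1 HA2]].
  exists A. split; auto. intros B HB HBA.
  assert (HAB : NoDup (A ++ B)).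
  { apply NoDup_app; auto. intros t Ht1 Ht2. apply (HBA t); auto. }
  apply Hs1 in HAB. rewrite rsum_app in HAB. lra.
Qed.

Lemma is_usum_of_summable_real {T : Type} (f : T -> R) :
  summable f -> exists s, is_usum (fun t => RtoC (f t)) s.
Proof.
  intros Hf. destruct (summable_sup f Hf) as [s [Hs1 Hs2]]. exists (RtoC s). intros eps.
  destruct (Hs2 eps) as [A [HA1 HA2]]. exists A. intros B HB HAB.
  rewrite csum_RtoC, <- RtoC_minus, Cmod_R.
  pose proof (rsum_incl f A B (proj1 Hf) HA1 HB HAB). pose proof (Hs1 B HB).
  rewrite Rabs_left1; lra.
Qed.

Lemma im_le_Cmod (c : C) : (Rabs (Im c) <= Cmod c)%R.
Proof. eapply Rle_trans; [apply Rmax_r | apply Rmax_Cmod]. Qed.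

(** Reduction to nonnegative real families: |F|, |F| + Re F and |F| + Im F are all bounded by 2 |F|,
    and F is recovered from them by differences. *)
Lemma is_usum_exists {T : Type} (F : T -> C) :
  summable (fun t => Cmod (F t)) -> exists s, is_usum F s.
Proof.
  intros H.
  destruct (is_usum_of_summable_real _ H) as [s0 H0].
  destruct (is_usum_of_summable_real (fun t => Cmod (F t) + Re (F t))%R) as [s1 H1].
  { apply (summable_le _ (fun t => Cmod (F t) + Cmod (F t))%R).
    - intros t. pose proof (re_le_Cmod (F t)) as Hr. apply Rabs_le_between in Hr. lra.
    - apply summable_plus; auto. }
  destruct (is_usum_of_summable_real (fun t => Cmod (F t) + Im (F t))%R) as [s2 H2].
  { apply (summable_le _ (fun t => Cmod (F t) + Cmod (F t))%R).
    - intros t. pose proof (im_le_Cmod (F t)) as Hr. apply Rabs_le_between in Hr. lra.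
    - apply summable_plus; auto. }
  exists ((s1 - s0) + Ci * (s2 - s0)).
  apply (is_usum_ext (fun t => (RtoC (Cmod (F t) + Re (F t)) - RtoC (Cmod (F t))) +
    Ci * (RtoC (Cmod (F t) + Im (F t)) - RtoC (Cmod (F t))))).
  - intros t. rewrite !RtoC_plus. destruct (F t) as [x y] eqn:E.
    unfold Re, Im, fst, snd. apply injective_projections; simpl; ring.
  - apply is_usum_plus; [|apply is_usum_scal]; apply is_usum_minus; auto.
Qed.

(** The bound g is asked for only outside A, because in the applications finitely many terms may be
    too close to a pole to obey it. *)
Lemma is_usum_tail_le {T : Type} (F : T -> C) (s : C) (g : T -> R) (A : list T) (e : R) :
  is_usum F s -> NoDup A ->
  (forall t, ~ In t A -> (Cmod (F t) <= g t)%R) ->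
  (forall B, NoDup B -> (forall t, In t B -> ~ In t A) -> (rsum g B <= e)%R) ->
  (Cmod (s - csum F A) <= e)%R.
Proof.
  intros HF HA Hg He. apply le_epsilon. intros d Hd.
  destruct (HF (mkposreal d Hd)) as [A1 H1]. simpl in H1.
  specialize (H1 (A ++ missing A1 A) (NoDup_app_missing A1 A HA) (incl_app_missing A1 A)).
  rewrite csum_app in H1.
  assert (H2 : (Cmod (csum F (missing A1 A)) <= e)%R).
  { eapply Rle_trans; [apply (Cmod_csum_le F g)|].
    - intros t Ht. apply In_missing in Ht. apply Hg. tauto.
    - apply He.
      + apply NoDup_filter, undup_NoDup.
      + intros t Ht. apply In_missing in Ht. tauto. }
  replace (s - csum F A) with
    (csum F (missing A1 A) + - (csum F A + csum F (missing A1 A) - s)) by ring.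
  eapply Rle_trans; [apply Cmod_triangle|]. rewrite Cmod_opp. lra.
Qed.

Lemma is_usum_Cmod_le {T : Type} (F : T -> C) (s : C) (g : T -> R) (M : R) :
  is_usum F s -> (forall t, (Cmod (F t) <= g t)%R) ->
  (forall B, NoDup B -> (rsum g B <= M)%R) -> (Cmod s <= M)%R.
Proof.
  intros HF Hg HM. replace s with (s - csum F nil) by (unfold csum; simpl; ring).
  apply (is_usum_tail_le F s g); auto. constructor.
Qed.

(** Each row in B contributes a finite piece that is close to the sum of the row and contains the
    entries of A in it. As B contains all the rows met by A, the union of the pieces contains A, so
    that its sum is close to s. *)
Lemma is_usum_Fubini {T U : Type} (F : T * U -> C) (s : C) (g : T -> C) :
  is_usum F s -> (forall t, is_usum (fun u => F (t, u)) (g t)) -> is_usum g s.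
Proof.
  intros HF Hg eps.
  destruct (HF (mkposreal _ (half_pos eps))) as [A HA]. simpl in HA.
  exists (map fst A). intros B HB HAB.
  (* The error eps/2 is shared among the rows of B; adding 1 keeps the denominator positive when B
     is empty. *)
  assert (He : (0 < eps / 2 / (INR (length B) + 1))%R).
  { apply Rdiv_lt_0_compat; [apply half_pos|]. pose proof (pos_INR (length B)). lra. }
  set (e := mkposreal _ He).
  assert (HP : forall B0, NoDup B0 -> exists P, NoDup P /\
    (forall p, In p P -> In (fst p) B0) /\
    (forall p, In p A -> In (fst p) B0 -> In p P) /\
    (Cmod (csum F P - csum g B0) <= INR (length B0) * e)%R).
  { induction B0 as [|b B0 IH]; intros HB0.
    - exists nil. split; [constructor|]. split; [simpl; tauto|]. split; [simpl; tauto|].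
      unfold csum. simpl. replace (0 - 0) with (RtoC 0) by ring. rewrite Cmod_0, Rmult_0_l. apply Rle_refl.
    - inversion HB0 as [|? ? Hb HB0']; subst. destruct (IH HB0') as [P [P1 [P2 [P3 P4]]]].
      destruct (Hg b e) as [L HL].
      set (L' := undup (L ++ map snd A)).
      assert (HL' : (Cmod (csum (fun u => F (b, u)) L' - g b) < e)%R).
      { apply HL; [apply undup_NoDup|]. intros x Hx. apply In_undup, in_or_app. auto. }
      exists (map (pair b) L' ++ P). repeat split.
      + apply NoDup_app; auto.
        * apply FinFun.Injective_map_NoDup; [|apply undup_NoDup].
          intros x y Hxy. congruence.
        * intros [x y] Hx Hy. apply in_map_iff in Hx. destruct Hx as [z [Hz _]].
          apply P2 in Hy. inversion Hz; subst. simpl in Hy. tauto.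
      + intros [x y] Hp. simpl. apply in_app_or in Hp. destruct Hp as [Hp|Hp].
        * apply in_map_iff in Hp. destruct Hp as [z [Hz _]]. inversion Hz. auto.
        * right. apply (P2 _ Hp).
      + intros [x y] Hp Hx. simpl in Hx. apply in_or_app. destruct Hx as [<-|Hx].
        * left. apply in_map. apply In_undup, in_or_app. right.
          apply (in_map snd) in Hp. auto.
        * right. apply P3; auto.
      + rewrite csum_app, csum_map.
        unfold csum at 3. simpl map. simpl fold_right. fold (csum g B0).
        replace (csum (fun u => F (b, u)) L' + csum F P - (g b + csum g B0))
          with ((csum (fun u => F (b, u)) L' - g b) + (csum F P - csum g B0)) by ring.
        eapply Rle_trans; [apply Cmod_triangle|].
        change (length (b :: B0)) with (S (length B0)). rewrite S_INR. lra. }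
  destruct (HP B HB) as [P [P1 [P2 [P3 P4]]]].
  assert (H1 : (Cmod (csum F P - s) < eps / 2)%R).
  { apply HA; auto. intros p Hp. apply P3; auto. apply HAB. apply in_map. auto. }
  pose proof (Cmod_sub_triangle (csum g B) (csum F P) s) as H2.
  rewrite (Cmod_sub_sym (csum g B) (csum F P)) in H2.
  assert (H3 : (INR (length B) * e <= eps / 2)%R).
  { simpl. pose proof (pos_INR (length B)) as Hn. pose proof (half_pos eps).
    apply Rle_trans with ((INR (length B) + 1) * (eps / 2 / (INR (length B) + 1)))%R.
    - apply Rmult_le_compat_r; [apply Rlt_le; exact He | lra].
    - right. field. lra. }
  lra.
Qed.

Lemma preimage_list {T U : Type} (phi : U -> T) (F : T -> C) (B : list T) :
  (forall u v, phi u = phi v -> u = v) ->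
  (forall t, (forall u, t <> phi u) -> F t = 0) -> NoDup B ->
  exists B', NoDup B' /\ (forall u, In u B' <-> In (phi u) B) /\
    csum F B = csum (fun u => F (phi u)) B'.
Proof.
  intros Hphi HF. induction B as [|b B IH]; intros HB.
  - exists nil. repeat split; simpl; try tauto. constructor.
  - inversion HB as [|? ? Hb HB1]; subst. destruct (IH HB1) as [B' [H1 [H2 H3]]].
    change (csum F (b :: B)) with (F b + csum F B).
    destruct (classic (exists u, b = phi u)) as [[u ->]|HN].
    + exists (u :: B'). repeat split.
      * constructor; auto. rewrite H2. auto.
      * simpl. rewrite H2. intros [->|]; auto.
      * simpl. rewrite H2. intros [H|]; auto.
      * rewrite H3. reflexivity.
    + exists B'. repeat split; auto.
      * intros H. right. apply H2. auto.
      * rewrite H2. intros [H|]; auto. exfalso. eauto.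
      * rewrite HF, H3; [ring|]. intros u Hu. eauto.
Qed.

Lemma is_usum_inj {T U : Type} (phi : U -> T) (F : T -> C) (s : C) :
  (forall u v, phi u = phi v -> u = v) ->
  (forall t, (forall u, t <> phi u) -> F t = 0) ->
  is_usum (fun u => F (phi u)) s <-> is_usum F s.
Proof.
  intros Hphi H0. split; intros HF eps; destruct (HF eps) as [A HA].
  - exists (map phi A). intros B HB HAB.
    destruct (preimage_list phi F B Hphi H0 HB) as [B' [H1 [H2 H3]]].
    rewrite H3. apply HA; auto. intros u Hu. apply H2, HAB, in_map, Hu.
  - destruct (preimage_list phi F (undup A) Hphi H0 (undup_NoDup A)) as [A' [H1 [H2 H3]]].
    exists A'. intros B HB HAB.
    assert (HB' : NoDup (map phi B)) by (apply FinFun.Injective_map_NoDup; auto).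
    specialize (HA _ (NoDup_app_missing A _ HB') (incl_app_missing A (map phi B))).
    rewrite csum_app, csum_map, (csum_0 F (missing A (map phi B))), Cplus_0_r in HA; auto.
    intros t Ht. apply In_missing in Ht. apply H0. intros u ->. apply (proj2 Ht).
    apply in_map, HAB, H2, In_undup. tauto.
Qed.

Lemma is_usum_bij {T U : Type} (phi : U -> T) (psi : T -> U) (F : T -> C) (s : C) :
  (forall u, psi (phi u) = u) -> (forall t, phi (psi t) = t) ->
  is_usum (fun u => F (phi u)) s <-> is_usum F s.
Proof.
  intros H1 H2. apply is_usum_inj.
  - intros u v H. rewrite <- (H1 u), <- (H1 v), H. reflexivity.
  - intros t H. exfalso. apply (H (psi t)). auto.
Qed.

Lemma is_usum_Fubini_swap {T U : Type} (F : T * U -> C) (s : C) (g : U -> C) :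
  is_usum F s -> (forall u, is_usum (fun t => F (t, u)) (g u)) -> is_usum g s.
Proof.
  intros HF Hg. apply (is_usum_Fubini (fun p => F (snd p, fst p))); auto.
  apply (is_usum_bij (fun p : U * T => (snd p, fst p)) (fun p => (snd p, fst p)) F);
    auto; intros []; auto.
Qed.

(** Absolute convergence gives the existence of the double sum; its value then comes from Fubini,
    row by row. *)
Lemma is_usum_prod {T U : Type} (F : T -> C) (G : U -> C) (s t : C) :
  summable (fun x => Cmod (F x)) -> summable (fun y => Cmod (G y)) ->
  is_usum F s -> is_usum G t -> is_usum (fun p => F (fst p) * G (snd p)) (s * t).
Proof.
  intros HF HG Hs Ht.
  destruct (is_usum_exists (fun p : T * U => F (fst p) * G (snd p))) as [r Hr].
  - apply (summable_le _ (fun p => Cmod (F (fst p)) * Cmod (G (snd p)))%R).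
    + intros p. rewrite Cmod_mult. split; [|lra]. apply Rmult_le_pos; apply Cmod_ge_0.
    + apply (summable_prod (fun x => Cmod (F x)) (fun y => Cmod (G y))); auto.
  - apply (is_usum_eq _ r); auto.
    assert (H1 : is_usum (fun x => F x * t) r).
    { apply (is_usum_Fubini (fun p => F (fst p) * G (snd p))); auto.
      intros x. apply (is_usum_scal (F x)). auto. }
    apply (is_usum_unique _ _ _ H1).
    replace (s * t) with (t * s) by ring.
    apply (is_usum_ext (fun x => t * F x)); [intros; ring|]. apply is_usum_scal. auto.
Qed.

Lemma is_usum_slices {T U : Type} (F : T * U -> C) :
  summable (fun p => Cmod (F p)) -> forall t, exists s, is_usum (fun u => F (t, u)) s.
Proof.
  intros H t. apply is_usum_exists.
  apply (summable_comp_inj (fun u => (t, u)) (fun p => Cmod (F p))); auto. congruence.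
Qed.

(** * Sums over lattices, series and symmetric sums *)

Lemma is_sum_over_unique (L : C -> Prop) (F : C -> C) (s t : C) :
  is_sum_over L F s -> is_sum_over L F t -> s = t.
Proof.
  intros Hs Ht. apply Cmod_eq_of_small. intros eps.
  destruct (Hs (mkposreal _ (half_pos eps))) as [A1 [K1 H1]].
  destruct (Ht (mkposreal _ (half_pos eps))) as [A2 [K2 H2]]. simpl in *.
  set (B := undup (A1 ++ A2)).
  assert (HB : NoDup B) by apply undup_NoDup.
  assert (KB : List.Forall L B).
  { apply Forall_forall. intros x Hx. apply In_undup, in_app_or in Hx.
    rewrite Forall_forall in K1, K2. destruct Hx; auto. }
  specialize (H1 B KB HB). specialize (H2 B KB HB).
  assert (Hi : forall x, In x A1 \/ In x A2 -> In x B).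
  { intros x Hx. apply In_undup, in_or_app. auto. }
  specialize (H1 (fun x h => Hi x (or_introl h))).
  specialize (H2 (fun x h => Hi x (or_intror h))).
  pose proof (Cmod_sub_triangle s (csum F B) t) as H.
  rewrite (Cmod_sub_sym s (csum F B)) in H. unfold csum in H. lra.
Qed.

(** The bridge from the lattice sums of the definitions to indexed sums: F, cut off to 0 outside L,
    is carried to the index type by phi. Indices outside Q, such as the origin of the lattice, must
    carry the value 0. *)
Lemma sum_over_usum {U : Type} (phi : U -> C) (Q : U -> Prop) (L : C -> Prop)
    (F : C -> C) (G : U -> C) (s : C) :
  (forall u v, phi u = phi v -> u = v) ->
  (forall w, L w <-> exists u, Q u /\ w = phi u) ->
  (forall u, ~ Q u -> G u = 0) -> (forall u, Q u -> G u = F (phi u)) ->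
  is_usum G s -> sum_over L F = s.
Proof.
  intros Hphi HL G0 G1 HG.
  set (F' := fun w => if excluded_middle_informative (L w) then F w else 0).
  assert (HF' : is_usum F' s).
  { apply (is_usum_inj phi); auto.
    - intros t Ht. unfold F'. destruct (excluded_middle_informative (L t)) as [l|]; auto.
      exfalso. apply HL in l. destruct l as [u [_ Hu]]. apply (Ht u). auto.
    - apply (is_usum_ext G); auto. intros u. unfold F'.
      destruct (excluded_middle_informative (L (phi u))) as [l|n].
      + apply HL in l. destruct l as [v [Hv E]]. apply Hphi in E. subst. auto.
      + apply G0. intros Hu. apply n. apply HL. eauto. }
  assert (HS : is_sum_over L F s).
  { intros eps. destruct (HF' eps) as [A HA].
    set (l := fun w => if excluded_middle_informative (L w) then true else false).
    exists (filter l A). split.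
    - apply Forall_forall. intros x Hx. apply filter_In in Hx. destruct Hx as [_ Hx].
      unfold l in Hx. destruct (excluded_middle_informative (L x)); auto. discriminate.
    - intros B HB1 HB2 HAB.
      specialize (HA _ (NoDup_app_missing A B HB2) (incl_app_missing A B)).
      rewrite csum_app, (csum_0 F' (missing A B)), Cplus_0_r in HA.
      + rewrite (csum_ext F' F) in HA; auto. intros t Ht. unfold F'.
        rewrite Forall_forall in HB1.
        destruct (excluded_middle_informative (L t)) as [|n]; auto. exfalso. auto.
      + intros t Ht. apply In_missing in Ht. unfold F'.
        destruct (excluded_middle_informative (L t)) as [k|]; auto. exfalso.
        apply (proj2 Ht), HAB, filter_In. split; [tauto|]. unfold l.
        destruct (excluded_middle_informative (L t)); auto. }
  apply (@iota_unique C_AbsRing C_CompleteNormedModule); auto.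
  intros y Hy. apply (is_sum_over_unique L F); auto.
Qed.

Lemma filterlim_C_eventually (f : nat -> C) (l : C) :
  (forall eps : posreal, eventually (fun n => (Cmod (f n - l) < eps)%R)) ->
  filterlim f eventually (@locally C_UniformSpace l).
Proof.
  intros H P [eps HP]. unfold filtermap.
  apply (filter_imp (fun n => (Cmod (f n - l) < eps)%R)); [|apply H].
  intros n Hn. apply HP. apply C_NormedModule_mixin_compat1. exact Hn.
Qed.

Lemma sum_n_csum (F : nat -> C) (n : nat) : sum_n F n = csum F (seq 0 (S n)).
Proof.
  induction n as [|n IH].
  - rewrite sum_O. unfold csum. simpl. ring.
  - rewrite sum_Sn, IH, (seq_S (S n)), csum_app. simpl. unfold csum at 3. simpl.
    change plus with Cplus. ring.
Qed.

Lemma C_Series_usum (a : nat -> C) (s : C) : is_usum a s -> C_Series a = s.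
Proof.
  intros H.
  assert (Hs : @is_series C_AbsRing C_NormedModule a s).
  { apply filterlim_C_eventually. intros eps. destruct (H eps) as [A HA].
    exists (list_max A). intros n Hn. rewrite sum_n_csum. apply HA.
    - apply seq_NoDup.
    - intros k Hk. apply in_seq. pose proof (proj1 (List.list_max_le A (list_max A)) (le_n _)) as Hm.
      rewrite Forall_forall in Hm. specialize (Hm k Hk). lia. }
  apply (@iota_filterlim_locally C_AbsRing C_CompleteNormedModule nat eventually
    (Proper_StrongProper _ eventually_filter) (sum_n a) s). exact Hs.
Qed.

Lemma sym_lim_unique (f : Z -> C) (s : C) :
  (forall eps : posreal, eventually (fun n => (Cmod (sym_sum f n - s) < eps)%R)) ->
  sym_lim f = s.
Proof.
  intros H.
  apply (@iota_filterlim_locally C_AbsRing C_CompleteNormedModule nat eventually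
    (Proper_StrongProper _ eventually_filter) (sym_sum f) s).
  apply filterlim_C_eventually, H.
Qed.

Definition zseg (N : nat) : list Z :=
  map (fun k => Z.of_nat k - Z.of_nat N)%Z (seq 0 (S (2 * N))).

Lemma zseg_NoDup (N : nat) : NoDup (zseg N).
Proof.
  apply FinFun.Injective_map_NoDup; [|apply seq_NoDup]. intros x y. lia.
Qed.

Lemma In_zseg (N : nat) (n : Z) : In n (zseg N) <-> (Z.abs n <= Z.of_nat N)%Z.
Proof.
  unfold zseg. rewrite in_map_iff. split.
  - intros [k [<- Hk]]. apply in_seq in Hk. lia.
  - intros H. exists (Z.to_nat (n + Z.of_nat N)). rewrite in_seq. lia.
Qed.

Lemma sym_sum_csum (f : Z -> C) (N : nat) : sym_sum f N = csum f (zseg N).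
Proof. unfold sym_sum, zseg. rewrite sum_n_csum, csum_map. reflexivity. Qed.

Lemma zseg_exhausts (A : list Z) : exists N0, forall N, (N0 <= N)%nat -> incl A (zseg N).
Proof.
  exists (list_max (map Z.abs_nat A)). intros N HN n Hn. apply In_zseg.
  pose proof (proj1 (List.list_max_le (map Z.abs_nat A) _) (le_n _)) as Hm.
  rewrite Forall_forall in Hm. specialize (Hm (Z.abs_nat n) (in_map _ _ _ Hn)). lia.
Qed.

(* The odd part [g] takes care of the counterterms that make the sum
   unconditional. *)
Lemma sym_lim_usum (f g : Z -> C) (s : C) :
  (forall n, g (- n)%Z = - g n) -> is_usum (fun n => f n + g n) s -> sym_lim f = s.
Proof.
  intros Hg H. apply sym_lim_unique. intros eps. destruct (H eps) as [A HA].
  destruct (zseg_exhausts A) as [N0 HN0]. exists N0. intros N HN.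
  specialize (HA (zseg N) (zseg_NoDup N) (HN0 N HN)).
  rewrite csum_plus in HA. rewrite sym_sum_csum.
  replace (csum g (zseg N)) with (RtoC 0) in HA.
  - rewrite Cplus_0_r in HA. auto.
  - assert (P : Permutation (zseg N) (map Z.opp (zseg N))).
    { apply NoDup_Permutation.
      - apply zseg_NoDup.
      - apply FinFun.Injective_map_NoDup; [intros x y; lia | apply zseg_NoDup].
      - intros n. rewrite in_map_iff, In_zseg. split.
        + intros Hn. exists (- n)%Z. rewrite In_zseg. lia.
        + intros [m [<- Hm]]. apply In_zseg in Hm. lia. }
    assert (E : csum g (zseg N) = - csum g (zseg N)).
    { rewrite (csum_Permutation g _ _ P) at 1. rewrite csum_map.
      rewrite (csum_ext _ (fun n => (- (1)) * g n)); [rewrite csum_scal; ring|].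
      intros n _. rewrite Hg. ring. }
    assert (E2 : csum g (zseg N) = (csum g (zseg N) + csum g (zseg N)) / 2).
    { field. }
    rewrite E2. rewrite E at 2. field.
Qed.

(** * Complex derivatives *)

Definition ccont (f : C -> C) (x : C) : Prop :=
  forall eps : posreal, exists delta : posreal, forall y : C,
    (Cmod (y - x) < delta)%R -> (Cmod (f y - f x) < eps)%R.

Definition cquot (f : C -> C) (x l : C) : C -> C := fun y =>
  if excluded_middle_informative (y = x) then l else (f y - f x) / (y - x).

(* Caratheodory's form of the derivative. *)
Definition is_cder (f : C -> C) (x l : C) : Prop := ccont (cquot f x l) x.

Lemma cquot_eq (f : C -> C) (x l y : C) : f y - f x = cquot f x l y * (y - x).
Proof.
  unfold cquot. destruct (excluded_middle_informative (y = x)) as [->|n].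
  - ring.
  - field. apply Cminus_eq_contra. auto.
Qed.

Lemma cquot_at (f : C -> C) (x l : C) : cquot f x l x = l.
Proof.
  unfold cquot. destruct (excluded_middle_informative (x = x)); congruence.
Qed.

Lemma ccont_ext_loc (f g : C -> C) (x : C) (r : posreal) :
  (forall y, (Cmod (y - x) < r)%R -> f y = g y) -> ccont f x -> ccont g x.
Proof.
  intros H Hf eps. destruct (Hf eps) as [d Hd].
  destruct (common_radius d r) as [m [Hm1 Hm2]]. exists m. intros y Hy.
  rewrite <- !H; [apply Hd| |]; try lra. apply Cmod_sub_self.
Qed.

Lemma ccont_const (c x : C) : ccont (fun _ => c) x.
Proof.
  intros eps. exists eps. intros y _. apply Cmod_sub_self.
Qed.

Lemma ccont_id (x : C) : ccont (fun y => y) x.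
Proof. intros eps. exists eps. auto. Qed.

Lemma ccont_plus (f g : C -> C) (x : C) :
  ccont f x -> ccont g x -> ccont (fun y => f y + g y) x.
Proof.
  intros Hf Hg eps.
  destruct (Hf (mkposreal _ (half_pos eps))) as [d1 H1].
  destruct (Hg (mkposreal _ (half_pos eps))) as [d2 H2].
  destruct (common_radius d1 d2) as [m [Hm1 Hm2]]. exists m. simpl in *. intros y Hy.
  specialize (H1 y ltac:(lra)). specialize (H2 y ltac:(lra)).
  replace (f y + g y - (f x + g x)) with ((f y - f x) + (g y - g x)) by ring.
  eapply Rle_lt_trans; [apply Cmod_triangle|]. lra.
Qed.

Lemma ccont_mult (f g : C -> C) (x : C) :
  ccont f x -> ccont g x -> ccont (fun y => f y * g y) x.
Proof.
  intros Hf Hg eps.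
  set (K := (Cmod (f x) + Cmod (g x) + 1)%R).
  assert (HK : (1 <= K)%R)
    by (unfold K; pose proof (Cmod_ge_0 (f x)); pose proof (Cmod_ge_0 (g x)); lra).
  assert (He : (0 < Rmin 1 (eps / (2 * K)))%R).
  { apply Rmin_pos; [lra|]. apply Rdiv_lt_0_compat; [apply cond_pos | lra]. }
  destruct (Hf (mkposreal _ He)) as [d1 H1]. destruct (Hg (mkposreal _ He)) as [d2 H2].
  destruct (common_radius d1 d2) as [m [Hm1 Hm2]]. exists m. simpl in *. intros y Hy.
  specialize (H1 y ltac:(lra)). specialize (H2 y ltac:(lra)).
  pose proof (Rmin_l 1 (eps / (2 * K))). pose proof (Rmin_r 1 (eps / (2 * K))).
  replace (f y * g y - f x * g x)
    with ((f y - f x) * (g y - g x) + (f x * (g y - g x) + g x * (f y - f x))) by ring.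
  eapply Rle_lt_trans; [apply Cmod_triangle|].
  apply Rle_lt_trans with (Cmod (f y - f x) * Cmod (g y - g x) +
    (Cmod (f x) * Cmod (g y - g x) + Cmod (g x) * Cmod (f y - f x)))%R.
  { rewrite Cmod_mult. apply Rplus_le_compat_l.
    eapply Rle_trans; [apply Cmod_triangle|]. rewrite !Cmod_mult. lra. }
  set (e := (eps / (2 * K))%R) in *.
  assert (E : (e * (2 * K))%R = eps) by (unfold e; field; lra).
  set (p := Cmod (f y - f x)) in *. set (q := Cmod (g y - g x)) in *.
  assert (0 <= p)%R by apply Cmod_ge_0. assert (0 <= q)%R by apply Cmod_ge_0.
  pose proof (Cmod_ge_0 (f x)). pose proof (Cmod_ge_0 (g x)).
  assert (Hm : (p * q <= q)%R) by nra.
  assert (Hp : (p < e)%R) by lra. assert (Hq : (q < e)%R) by lra.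
  assert (0 < e)%R by lra.
  assert (Cmod (f x) * q <= Cmod (f x) * e)%R by (apply Rmult_le_compat_l; lra).
  assert (Cmod (g x) * p <= Cmod (g x) * e)%R by (apply Rmult_le_compat_l; lra).
  rewrite <- E. unfold K in *. nra.
Qed.

Lemma ccont_comp (f g : C -> C) (x : C) :
  ccont g x -> ccont f (g x) -> ccont (fun y => f (g y)) x.
Proof.
  intros Hg Hf eps. destruct (Hf eps) as [d Hd]. destruct (Hg d) as [r Hr].
  exists r. auto.
Qed.

Lemma ccont_inv (x : C) : x <> 0 -> ccont Cinv x.
Proof.
  intros Hx eps. assert (H0 : (0 < Cmod x)%R) by (apply Cmod_gt_0; auto).
  set (m := Cmod x) in *.
  assert (Hr : (0 < Rmin (m / 2) (eps * (m * m / 2)))%R).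
  { apply Rmin_pos; [lra|]. apply Rmult_lt_0_compat; [apply cond_pos | nra]. }
  exists (mkposreal _ Hr). simpl. intros y Hy.
  pose proof (Rmin_l (m / 2) (eps * (m * m / 2))).
  pose proof (Rmin_r (m / 2) (eps * (m * m / 2))).
  assert (Hm : (m / 2 < Cmod y)%R).
  { pose proof (Cmod_sub_triangle x y 0) as Ht.
    replace (x - 0) with x in Ht by ring. replace (y - 0) with y in Ht by ring.
    rewrite (Cmod_sub_sym x y) in Ht. fold m in Ht. lra. }
  assert (Hy0 : y <> 0) by (apply Cmod_gt_0; lra).
  replace (/ y - / x) with ((x - y) / (y * x)) by (field; auto).
  rewrite Cmod_div by (apply Cmult_neq_0; auto).
  rewrite Cmod_mult, Cmod_sub_sym. fold m.
  apply Rlt_div_l; [nra|].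
  apply Rlt_le_trans with (eps * (m * m / 2))%R; [lra|].
  apply Rmult_le_compat_l; [apply Rlt_le, cond_pos | nra].
Qed.

Lemma is_cder_intro (f phi : C -> C) (x l : C) (r : posreal) :
  ccont phi x -> phi x = l ->
  (forall y, (Cmod (y - x) < r)%R -> f y - f x = phi y * (y - x)) -> is_cder f x l.
Proof.
  intros Hphi Hl H. apply (ccont_ext_loc phi _ x r); auto.
  intros y Hy. unfold cquot. destruct (excluded_middle_informative (y = x)) as [->|n]; auto.
  rewrite H; auto. field. apply Cminus_eq_contra. auto.
Qed.

Lemma is_cder_intro' (f phi : C -> C) (x l : C) :
  ccont phi x -> phi x = l ->
  (forall y, f y - f x = phi y * (y - x)) -> is_cder f x l.
Proof. intros H1 H2 H3. apply (is_cder_intro f phi x l (mkposreal 1 Rlt_0_1)); auto. Qed.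

Lemma is_cder_ext_loc (f g : C -> C) (x l : C) (r : posreal) :
  (forall y, (Cmod (y - x) < r)%R -> f y = g y) -> is_cder f x l -> is_cder g x l.
Proof.
  intros H Hf. apply (is_cder_intro g (cquot f x l) x l r); auto using cquot_at.
  intros y Hy. rewrite <- !H; auto using cquot_eq, Cmod_sub_self.
Qed.

Lemma is_cder_ext (f g : C -> C) (x l : C) :
  (forall y, f y = g y) -> is_cder f x l -> is_cder g x l.
Proof. intros H. apply (is_cder_ext_loc f g x l (mkposreal 1 Rlt_0_1)). auto. Qed.

Lemma is_cder_eq (f : C -> C) (x l k : C) : is_cder f x l -> l = k -> is_cder f x k.
Proof. intros H <-. exact H. Qed.

Lemma is_cder_const (c x : C) : is_cder (fun _ => c) x 0.
Proof.
  apply (is_cder_intro' _ (fun _ => 0)); auto using ccont_const. intros; ring.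
Qed.

Lemma is_cder_id (x : C) : is_cder (fun y => y) x 1.
Proof.
  apply (is_cder_intro' _ (fun _ => 1)); auto using ccont_const. intros; ring.
Qed.

Lemma is_cder_plus (f g : C -> C) (x l k : C) :
  is_cder f x l -> is_cder g x k -> is_cder (fun y => f y + g y) x (l + k).
Proof.
  intros Hf Hg. apply (is_cder_intro' _ (fun y => cquot f x l y + cquot g x k y)).
  - apply ccont_plus; auto.
  - rewrite !cquot_at. auto.
  - intros y. replace (f y + g y - (f x + g x)) with ((f y - f x) + (g y - g x)) by ring.
    rewrite (cquot_eq f x l), (cquot_eq g x k). ring.
Qed.

Lemma is_cder_ccont (f : C -> C) (x l : C) : is_cder f x l -> ccont f x.
Proof.
  intros H. apply (ccont_ext_loc (fun y => f x + cquot f x l y * (y + - x)) f x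
    (mkposreal 1 Rlt_0_1)).
  - intros y _. replace (y + - x) with (y - x) by ring. rewrite <- cquot_eq. ring.
  - apply ccont_plus; [apply ccont_const|]. apply ccont_mult; auto.
    apply ccont_plus; [apply ccont_id | apply ccont_const].
Qed.

Lemma is_cder_mult (f g : C -> C) (x l k : C) :
  is_cder f x l -> is_cder g x k ->
  is_cder (fun y => f y * g y) x (l * g x + f x * k).
Proof.
  intros Hf Hg.
  apply (is_cder_intro' _ (fun y => cquot f x l y * g y + f x * cquot g x k y)).
  - apply ccont_plus; apply ccont_mult; auto using ccont_const.
    apply (is_cder_ccont g x k). auto.
  - rewrite !cquot_at. auto.
  - intros y. replace (f y * g y - f x * g x)
      with ((f y - f x) * g y + f x * (g y - g x)) by ring.
    rewrite (cquot_eq f x l), (cquot_eq g x k). ring.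
Qed.

Lemma is_cder_scal (c : C) (f : C -> C) (x l : C) :
  is_cder f x l -> is_cder (fun y => c * f y) x (c * l).
Proof.
  intros H. apply (is_cder_eq _ _ (0 * f x + c * l)); [|ring].
  apply (is_cder_mult (fun _ => c)); auto using is_cder_const.
Qed.

Lemma is_cder_minus (f g : C -> C) (x l k : C) :
  is_cder f x l -> is_cder g x k -> is_cder (fun y => f y - g y) x (l - k).
Proof.
  intros Hf Hg. apply (is_cder_eq _ _ (l + (- (1)) * k)); [|ring].
  apply (is_cder_ext (fun y => f y + (- (1)) * g y)); [intros; ring|].
  apply is_cder_plus; auto. apply is_cder_scal. auto.
Qed.

Lemma is_cder_comp (f g : C -> C) (x l k : C) :
  is_cder f (g x) l -> is_cder g x k -> is_cder (fun y => f (g y)) x (l * k).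
Proof.
  intros Hf Hg.
  apply (is_cder_intro' _ (fun y => cquot f (g x) l (g y) * cquot g x k y)).
  - apply ccont_mult; auto. apply (ccont_comp (cquot f (g x) l)); auto.
    apply (is_cder_ccont g x k). auto.
  - rewrite !cquot_at. auto.
  - intros y. rewrite (cquot_eq f (g x) l), (cquot_eq g x k). ring.
Qed.

Lemma is_cder_inv (x : C) : x <> 0 -> is_cder Cinv x (- / (x * x)).
Proof.
  intros Hx. assert (H0 : (0 < Cmod x)%R) by (apply Cmod_gt_0; auto).
  apply (is_cder_intro _ (fun y => - / x * / y) x _ (mkposreal _ H0)).
  - apply ccont_mult; [apply ccont_const | apply ccont_inv; auto].
  - field. auto.
  - simpl. intros y Hy. assert (y <> 0).
    { intros ->. replace (0 - x) with (- x) in Hy by ring. rewrite Cmod_opp in Hy. lra. }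
    field. auto.
Qed.

Lemma is_cder_C_derive (f : C -> C) (x l : C) : is_cder f x l -> C_derive f x = l.
Proof.
  intros H. apply is_C_derive_unique. split; [apply is_linear_scal_l|].
  intros x0 Hx0. apply (is_filter_lim_locally_unique (K := C_AbsRing) (V := AbsRing_NormedModule C_AbsRing)) in Hx0. subst x0.
  intros eps. destruct (H eps) as [d Hd]. exists d. intros y Hy.
  change (Cmod ((f y - f x) - (y - x) * l) <= eps * Cmod (y - x))%R.
  rewrite (cquot_eq f x l).
  replace (cquot f x l y * (y - x) - (y - x) * l)
    with ((cquot f x l y - cquot f x l x) * (y - x)) by (rewrite cquot_at; ring).
  rewrite Cmod_mult. apply Rmult_le_compat_r; [apply Cmod_ge_0|].
  apply Rlt_le, Hd. exact Hy.
Qed.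

Lemma is_cder_unique (f : C -> C) (x l k : C) : is_cder f x l -> is_cder f x k -> l = k.
Proof.
  intros H1 H2. rewrite <- (is_cder_C_derive f x l), <- (is_cder_C_derive f x k); auto.
Qed.

(** The real mean value theorem is applied to t -> Re (conj w * f(a + t (b - a))) with w = f b - f
    a: its increment over [0, 1] is |w|^2, and its derivative is at most |w| M |b - a|. *)
Lemma is_cder_mean_value (f f' : C -> C) (a b : C) (M : R) :
  (forall t : R, (0 <= t <= 1)%R ->
     is_cder f (a + t * (b - a)) (f' (a + t * (b - a))) /\
     (Cmod (f' (a + t * (b - a))%C) <= M)%R) ->
  (Cmod (f b - f a) <= M * Cmod (b - a))%R.
Proof.
  intros H. set (w := f b - f a). set (p := fun t : R => a + t * (b - a)) in *.
  set (g := fun t : R => Re (Cconj w * f (p t))).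
  set (g' := fun t : R => Re (Cconj w * f' (p t) * (b - a))).
  assert (Hg : forall t, (0 <= t <= 1)%R -> derivable_pt_lim g t (g' t)).
  { intros t Ht eps Heps. destruct (H t Ht) as [Hd _]. fold (p t) in Hd.
    set (K := (Cmod w * Cmod (b - a) + 1)%R).
    assert (HK : (1 <= K)%R).
    { unfold K. pose proof (Cmod_ge_0 w). pose proof (Cmod_ge_0 (b - a)). nra. }
    assert (He : (0 < eps / K)%R) by (apply Rdiv_lt_0_compat; lra).
    destruct (Hd (mkposreal _ He)) as [d Hd']. simpl in Hd'.
    assert (Hr : (0 < d / (Cmod (b - a) + 1))%R).
    { apply Rdiv_lt_0_compat; [apply cond_pos|]. pose proof (Cmod_ge_0 (b - a)). lra. }
    exists (mkposreal _ Hr). simpl. intros h Hh0 Hh.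
    assert (E : p (t + h)%R - p t = h * (b - a)).
    { unfold p. rewrite RtoC_plus. ring. }
    assert (Hp : (Cmod (p (t + h)%R - p t) < d)%R).
    { rewrite E, Cmod_mult, Cmod_R. pose proof (Cmod_ge_0 (b - a)).
      apply Rle_lt_trans with (Rabs h * (Cmod (b - a) + 1))%R.
      - apply Rmult_le_compat_l; [apply Rabs_pos | lra].
      - apply Rlt_div_r in Hh; lra. }
    specialize (Hd' _ Hp). rewrite cquot_at in Hd'.
    set (q := cquot f (p t) (f' (p t)) (p (t + h)%R)) in *.
    assert (E2 : ((g (t + h)%R - g t) / h - g' t)%R = Re (Cconj w * (b - a) * (q - f' (p t)))).
    { assert (Ef : f (p (t + h)%R) = f (p t) + q * (h * (b - a))).
      { rewrite <- E. unfold q. rewrite <- cquot_eq. ring. }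
      unfold g, g'. rewrite Ef.
      replace (Cconj w * (f (p t) + q * (h * (b - a))))
        with (Cconj w * f (p t) + h * (Cconj w * q * (b - a))) by ring.
      replace (Cconj w * (b - a) * (q - f' (p t)))
        with (Cconj w * q * (b - a) - Cconj w * f' (p t) * (b - a)) by ring.
      generalize (Cconj w * f (p t)) (Cconj w * q * (b - a)) (Cconj w * f' (p t) * (b - a)).
      intros [x1 y1] [x2 y2] [x3 y3]. unfold Re. simpl. field. auto. }
    rewrite E2. eapply Rle_lt_trans; [apply re_le_Cmod|].
    rewrite !Cmod_mult, Cmod_conj.
    apply Rle_lt_trans with (K * Cmod (q - f' (p t)))%R.
    - apply Rmult_le_compat_r; [apply Cmod_ge_0|]. unfold K. lra.
    - apply (Rmult_lt_compat_l K) in Hd'; [|lra].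
      replace (K * (eps / K))%R with eps in Hd' by (field; lra). exact Hd'. }
  destruct (MVT_gen g 0 1 g') as [c [Hc E]].
  - intros x. rewrite Rmin_left, Rmax_right by lra. intros Hx.
    apply is_derive_Reals. apply Hg. lra.
  - intros x. rewrite Rmin_left, Rmax_right by lra. intros Hx.
    apply derivable_continuous_pt. exists (g' x). apply Hg. lra.
  - rewrite Rmin_left, Rmax_right in Hc by lra.
    assert (E1 : (g 1 - g 0 = Cmod w ^ 2)%R).
    { unfold g, p. replace (a + 1 * (b - a)) with b by ring.
      replace (a + 0 * (b - a)) with a by ring.
      transitivity (Re (Cconj w * w)).
      - unfold w at 4. generalize (Cconj w) (f b) (f a).
        intros [x1 y1] [x2 y2] [x3 y3]. unfold Re. simpl. ring.
      - rewrite Cmult_comm, <- Cmod2_conj. apply re_RtoC. }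
    rewrite E1 in E.
    assert (Hle : (Cmod w ^ 2 <= Cmod w * (M * Cmod (b - a)))%R).
    { rewrite E. replace (g' c * (1 - 0))%R with (g' c) by ring.
      eapply Rle_trans; [apply Rle_abs|]. eapply Rle_trans; [apply re_le_Cmod|].
      rewrite !Cmod_mult, Cmod_conj, Rmult_assoc.
      apply Rmult_le_compat_l; [apply Cmod_ge_0|].
      apply Rmult_le_compat_r; [apply Cmod_ge_0|]. apply H. auto. }
    destruct (Cmod_ge_0 w) as [Hw|Hw].
    + apply (Rmult_le_reg_l (Cmod w)); auto. lra.
    + rewrite <- Hw. apply Rmult_le_pos; [|apply Cmod_ge_0].
      eapply Rle_trans; [apply Cmod_ge_0 | apply (H 0%R); lra].
Qed.

(** * Continuity and differentiation of sums term by term *)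

Lemma csum_ccont {T : Type} (Phi : T -> C -> C) (A : list T) (x : C) :
  (forall t, ccont (Phi t) x) -> ccont (fun y => csum (fun t => Phi t y) A) x.
Proof.
  intros H. induction A as [|a A IH].
  - exact (ccont_const 0 x).
  - apply (ccont_plus (Phi a) (fun y => csum (fun t => Phi t y) A)); auto.
Qed.

Lemma is_usum_ccont {T : Type} (Phi : T -> C -> C) (S : C -> C) (x : C)
    (r : posreal) (A : list T) (g : T -> R) :
  (forall t, ccont (Phi t) x) ->
  (forall t y, ~ In t A -> (Cmod (y - x) < r)%R -> (Cmod (Phi t y) <= g t)%R) ->
  summable g ->
  (forall y, (Cmod (y - x) < r)%R -> is_usum (fun t => Phi t y) (S y)) ->
  ccont S x.
Proof.
  intros Hc Hg Hs HS eps.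
  assert (He : (0 < eps / 4)%R) by (pose proof (cond_pos eps); lra).
  destruct (summable_tail g (mkposreal _ He) Hs) as [A0 [_ HA0]]. simpl in HA0.
  set (A1 := undup (A ++ A0)).
  assert (Ht : forall y, (Cmod (y - x) < r)%R ->
    (Cmod (S y - csum (fun t => Phi t y) A1) <= eps / 4)%R).
  { intros y Hy. apply (is_usum_tail_le _ _ g); auto.
    - apply undup_NoDup.
    - intros t Hn. apply Hg; auto. intros Hi. apply Hn, In_undup, in_or_app. auto.
    - intros B HB Hd. apply HA0; auto. intros t Hi Hi0. apply (Hd t Hi).
      apply In_undup, in_or_app. auto. }
  destruct (csum_ccont Phi A1 x Hc (mkposreal _ He)) as [d Hd]. simpl in Hd.
  destruct (common_radius d r) as [m [Hm1 Hm2]]. exists m. intros y Hy.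
  assert (H1 := Ht y ltac:(lra)). specialize (Hd y ltac:(lra)).
  pose proof (Cmod_sub_self x r) as H2.
  apply Ht in H2. rewrite Cmod_sub_sym in H2.
  eapply Rle_lt_trans; [apply (Cmod_sub_triangle _ (csum (fun t => Phi t y) A1))|].
  pose proof (Cmod_sub_triangle (csum (fun t => Phi t y) A1)
    (csum (fun t => Phi t x) A1) (S x)) as H3.
  pose proof (cond_pos eps). lra.
Qed.

Lemma Cmod_segment_lt (x y : C) (t r : R) :
  (0 <= t <= 1)%R -> (Cmod (y - x) < r)%R -> (Cmod (x + t * (y - x) - x) < r)%R.
Proof.
  intros Ht H. replace (x + t * (y - x) - x) with (t * (y - x)) by ring.
  rewrite Cmod_mult, Cmod_R, Rabs_right by lra.
  pose proof (Cmod_ge_0 (y - x)). nra.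
Qed.

(** By the mean value inequality the difference quotients are dominated by the same g as the
    derivatives, so that the sum of the quotients is continuous at x. The finitely many terms in A
    need only be differentiable at x itself. *)
Lemma is_usum_is_cder {T : Type} (F F' : T -> C -> C) (S : C -> C) (S' x : C)
    (r : posreal) (A : list T) (g : T -> R) :
  (forall t, is_cder (F t) x (F' t x)) ->
  (forall t y, ~ In t A -> (Cmod (y - x) < r)%R ->
     is_cder (F t) y (F' t y) /\ (Cmod (F' t y) <= g t)%R) ->
  summable g ->
  (forall y, (Cmod (y - x) < r)%R -> is_usum (fun t => F t y) (S y)) ->
  is_usum (fun t => F' t x) S' ->
  is_cder S x S'.
Proof.
  intros Hd Hg Hs HS HS'.
  pose proof (Cmod_sub_self x r) as Hxx.
  apply (is_usum_ccont (fun t => cquot (F t) x (F' t x)) _ x r A g); auto.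
  - intros t y Ht Hy. unfold cquot.
    destruct (excluded_middle_informative (y = x)) as [->|n].
    + apply Hg; auto.
    + assert (Hn : y - x <> 0) by (apply Cminus_eq_contra; auto).
      rewrite Cmod_div; auto. apply Cmod_gt_0 in Hn. apply Rle_div_l; auto.
      apply (is_cder_mean_value (F t) (F' t)). intros u Hu.
      apply Hg; auto. apply Cmod_segment_lt; auto.
  - intros y Hy. unfold cquot.
    destruct (excluded_middle_informative (y = x)) as [->|n]; auto.
    apply (is_usum_ext (fun t => / (y - x) * (F t y - F t x))).
    + intros t. unfold Cdiv. ring.
    + unfold Cdiv. rewrite Cmult_comm. apply is_usum_scal, is_usum_minus; auto.
Qed.

(** * The exponential *)

Lemma Cexp_plus (x y : C) : Cexp (x + y) = Cexp x * Cexp y.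
Proof.
  destruct x as [a b], y as [c d]. unfold Cexp, Re, Im. simpl.
  rewrite exp_plus, cos_plus, sin_plus. apply injective_projections; simpl; ring.
Qed.

Lemma Cexp_0 : Cexp 0 = 1.
Proof.
  unfold Cexp. simpl. rewrite exp_0, cos_0, sin_0. apply injective_projections; simpl; ring.
Qed.

Lemma Cexp_neq_0 (x : C) : Cexp x <> 0.
Proof.
  intros H. apply C1_nz. rewrite <- Cexp_0. replace (RtoC 0) with (x + - x) by ring.
  rewrite Cexp_plus, H. ring.
Qed.

Lemma Cexp_opp (x : C) : Cexp (- x) = / Cexp x.
Proof.
  pose proof (Cexp_neq_0 x) as H.
  replace (Cexp (- x)) with (Cexp (x + - x) * / Cexp x).
  - replace (x + - x) with (RtoC 0) by ring. rewrite Cexp_0. ring.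
  - rewrite Cexp_plus. field. auto.
Qed.

Lemma Cmod_Cexp (x : C) : Cmod (Cexp x) = exp (Re x).
Proof.
  apply Rsqr_inj; [apply Cmod_ge_0 | apply Rlt_le, exp_pos |].
  rewrite !Rsqr_pow2, Cmod2_alt. destruct x as [a b]. unfold Cexp, Re, Im. simpl fst. simpl snd.
  pose proof (sin2_cos2 b) as H. unfold Rsqr in H.
  transitivity (exp a ^ 2 * (sin b * sin b + cos b * cos b))%R; [ring|].
  rewrite H. ring.
Qed.

Lemma exp_second_order (x : R) : (Rabs x <= / 2)%R -> (Rabs (exp x - 1 - x) <= 2 * x ^ 2)%R.
Proof.
  intros H. apply Rabs_le_between in H.
  pose proof (exp_ineq1_le x). pose proof (exp_ineq1_le (- x)) as H1.
  rewrite exp_Ropp in H1. pose proof (exp_pos x) as H2.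
  assert (H3 : (exp x * (1 - x) <= 1)%R).
  { apply (Rmult_le_compat_l (exp x)) in H1; [|lra]. rewrite Rinv_r in H1 by lra. lra. }
  rewrite Rabs_right by lra. nra.
Qed.

Lemma cos_second_order (y : R) : (Rabs (cos y - 1) <= y ^ 2)%R.
Proof.
  pose proof (bounded_variation cos (fun t => - sin t)%R (Rabs y) 0 y) as H.
  rewrite cos_0, Rminus_0_r in H. replace (y ^ 2)%R with (Rabs y * Rabs y)%R.
  - apply H. intros t Ht. rewrite Rminus_0_r in Ht. split.
    + auto_derive; auto. ring.
    + rewrite Rabs_Ropp. eapply Rle_trans; [|exact Ht].
      pose proof (bounded_variation sin cos 1 0 t) as Hs.
      rewrite sin_0, !Rminus_0_r, Rmult_1_l in Hs. apply Hs. intros u _. split.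
      * auto_derive; auto. ring.
      * apply Rabs_le. apply COS_bound.
  - rewrite <- Rabs_mult, Rabs_right; [ring|]. apply Rle_ge, Rle_0_sqr.
Qed.

Lemma Rabs_sin_le (y : R) : (Rabs (sin y) <= Rabs y)%R.
Proof.
  pose proof (bounded_variation sin cos 1 0 y) as Hs.
  rewrite sin_0, !Rminus_0_r, Rmult_1_l in Hs. apply Hs. intros u _. split.
  - auto_derive; auto. ring.
  - apply Rabs_le. apply COS_bound.
Qed.

Lemma sin_second_order (y : R) : (Rabs y <= 1)%R -> (Rabs (sin y - y) <= y ^ 2)%R.
Proof.
  intros Hy.
  pose proof (bounded_variation (fun t => sin t - t)%R (fun t => cos t - 1)%R (Rabs y) 0 y) as H.
  simpl in H. rewrite sin_0, !Rminus_0_r in H. replace (y ^ 2)%R with (Rabs y * Rabs y)%R.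
  - apply H. intros t Ht. rewrite Rminus_0_r in Ht. split.
    + auto_derive; auto. ring.
    + eapply Rle_trans; [apply cos_second_order|].
      rewrite <- pow2_abs. pose proof (Rabs_pos t). nra.
  - rewrite <- Rabs_mult, Rabs_right; [ring|]. apply Rle_ge, Rle_0_sqr.
Qed.

Lemma Cmod_le_abs (x y : R) : (Cmod (x, y) <= Rabs x + Rabs y)%R.
Proof.
  replace (x, y) with (RtoC x + Ci * RtoC y).
  - eapply Rle_trans; [apply Cmod_triangle|]. rewrite Cmod_mult, Cmod_Ci, !Cmod_R. lra.
  - apply injective_projections; simpl; ring.
Qed.

Lemma Cexp_second_order (h : C) :
  (Cmod h <= / 2)%R -> (Cmod (Cexp h - 1 - h) <= 10 * Cmod h ^ 2)%R.
Proof.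
  intros Hh. pose proof (re_le_Cmod h) as Hx. pose proof (im_le_Cmod h) as Hy.
  pose proof (Cmod2_alt h) as Hm.
  destruct h as [x y]. unfold Re, Im in *. simpl fst in *; simpl snd in *.
  replace (Cexp (x, y) - 1 - (x, y)) with
    (((exp x - 1 - x) * cos y + (1 + x) * (cos y - 1))%R,
     ((exp x - 1) * sin y + (sin y - y))%R)
    by (unfold Cexp, Re, Im; apply injective_projections; simpl; ring).
  rewrite Hm. eapply Rle_trans; [apply Cmod_le_abs|].
  pose proof (exp_second_order x ltac:(lra)) as H1.
  pose proof (cos_second_order y) as H2. pose proof (sin_second_order y ltac:(lra)) as H3.
  pose proof (Rabs_sin_le y) as H4.
  assert (H5 : (Rabs (cos y) <= 1)%R) by (apply Rabs_le; apply COS_bound).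
  assert (H6 : (Rabs (exp x - 1) <= 2 * Rabs x)%R).
  { replace (exp x - 1)%R with ((exp x - 1 - x) + x)%R by ring.
    eapply Rle_trans; [apply Rabs_triang|]. rewrite <- pow2_abs in H1.
    pose proof (Rabs_pos x). nra. }
  assert (H7 : (Rabs (1 + x) <= 2)%R).
  { eapply Rle_trans; [apply Rabs_triang|]. rewrite Rabs_R1. lra. }
  assert (H8 : (Rabs ((exp x - 1 - x) * cos y + (1 + x) * (cos y - 1)) <= 2 * x ^ 2 + 2 * y ^ 2)%R).
  { eapply Rle_trans; [apply Rabs_triang|]. rewrite !Rabs_mult.
    pose proof (Rabs_pos (exp x - 1 - x)). pose proof (Rabs_pos (cos y)).
    pose proof (Rabs_pos (cos y - 1)). pose proof (Rabs_pos (1 + x)).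
    apply Rplus_le_compat; nra. }
  assert (H9 : (Rabs ((exp x - 1) * sin y + (sin y - y)) <= x ^ 2 + 2 * y ^ 2)%R).
  { eapply Rle_trans; [apply Rabs_triang|]. rewrite !Rabs_mult.
    assert (Rabs (exp x - 1) * Rabs (sin y) <= 2 * Rabs x * Rabs y)%R.
    { apply Rmult_le_compat; auto using Rabs_pos. }
    pose proof (pow2_ge_0 (Rabs x - Rabs y)) as Hs.
    pose proof (pow2_abs x). pose proof (pow2_abs y).
    replace ((Rabs x - Rabs y) ^ 2)%R
      with (Rabs x ^ 2 + Rabs y ^ 2 - 2 * Rabs x * Rabs y)%R in Hs by ring. lra. }
  nra.
Qed.

Lemma is_cder_Cexp (x : C) : is_cder Cexp x (Cexp x).
Proof.
  assert (H0 : is_cder Cexp 0 1).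
  { intros eps.
    assert (Hr : (0 < Rmin (/ 2) (eps / 20))%R).
    { apply Rmin_pos; [lra|]. pose proof (cond_pos eps). lra. }
    exists (mkposreal _ Hr). simpl. intros y Hy. rewrite cquot_at. unfold cquot.
    replace (y - 0) with y in * by ring.
    pose proof (Rmin_l (/ 2) (eps / 20)). pose proof (Rmin_r (/ 2) (eps / 20)).
    destruct (excluded_middle_informative (y = 0)) as [->|n].
    - apply Cmod_sub_self.
    - rewrite Cexp_0. replace ((Cexp y - 1) / y - 1) with ((Cexp y - 1 - y) / y) by (field; auto).
      rewrite Cmod_div; auto. pose proof n as n'. apply Cmod_gt_0 in n'.
      apply Rlt_div_l; auto. pose proof (Cexp_second_order y ltac:(lra)).
      pose proof (cond_pos eps). nra. }
  apply (is_cder_ext (fun y => Cexp x * Cexp (y - x))).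
  { intros y. rewrite <- Cexp_plus. f_equal. ring. }
  apply (is_cder_eq _ _ (Cexp x * (1 * (1 - 0)))); [|ring].
  apply is_cder_scal, (is_cder_comp Cexp (fun y => y - x)).
  - replace (x - x) with (RtoC 0) by ring. auto.
  - apply is_cder_minus; auto using is_cder_id, is_cder_const.
Qed.

(** * A summable weight on the integers *)

(** The exponent 3/2 makes one weight serve all the sums: it is summable over the integers, it
    dominates the inverse squares, and a product of two weights dominates the inverse cubes on pairs
    of integers. *)
Definition wt (n : Z) : R := (/ ((1 + IZR (Z.abs n)) * sqrt (1 + IZR (Z.abs n))))%R.

Lemma wt_base (n : Z) : (1 <= 1 + IZR (Z.abs n))%R.
Proof. assert (0 <= IZR (Z.abs n))%R by (apply IZR_le; lia). lra. Qed.

Lemma summable_wt_nat : summable (fun n : nat => / ((1 + INR n) * sqrt (1 + INR n)))%R.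
Proof.
  assert (Hp : forall n, (0 < 1 + INR n)%R) by (intros n; pose proof (pos_INR n); lra).
  assert (H0 : forall n : nat, (0 < / ((1 + INR n) * sqrt (1 + INR n)))%R).
  { intros n. apply Rinv_0_lt_compat, Rmult_lt_0_compat; auto using sqrt_lt_R0. }
  split; [intros n; apply Rlt_le; auto|]. exists 3%R. intros B HB.
  apply Rle_trans with
    (rsum (fun n : nat => / ((1 + INR n) * sqrt (1 + INR n)))%R (seq 0 (S (list_max B)))).
  - apply rsum_incl; auto using seq_NoDup.
    + intros n. apply Rlt_le; auto.
    + intros k Hk. apply in_seq.
      pose proof (proj1 (List.list_max_le B (list_max B)) (le_n _)) as Hm.
      rewrite Forall_forall in Hm. specialize (Hm k Hk). lia.
  (* The partial sums of n^(-3/2) are compared with the primitive -2 n^(-1/2); the induction step is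
     1/b^3 <= 2/a - 2/b for b^2 = a^2 + 1. *)
  - apply Rle_trans with (3 - 2 / sqrt (1 + INR (list_max B)))%R.
    + induction (list_max B) as [|n IH].
      * unfold rsum. simpl. rewrite !Rplus_0_r, sqrt_1. lra.
      * rewrite seq_S, rsum_app. unfold rsum at 2. cbn [map fold_right Nat.add].
        rewrite Rplus_0_r.
        set (a := sqrt (1 + INR n)) in *. set (b := sqrt (1 + INR (S n))).
        assert (Ha : (0 < a)%R) by (apply sqrt_lt_R0; auto).
        assert (Hb : (0 < b)%R) by (apply sqrt_lt_R0; auto).
        assert (Ea : (a * a = 1 + INR n)%R) by (apply sqrt_sqrt, Rlt_le; auto).
        assert (Eb : (b * b = 1 + INR (S n))%R) by (apply sqrt_sqrt, Rlt_le; auto).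
        rewrite <- Eb. rewrite S_INR in Eb.
        assert (E1 : (b * b = a * a + 1)%R) by lra.
        assert (Hab : (a <= b)%R) by nra.
        assert (Hk : (/ (b * b * b) <= 2 / a - 2 / b)%R).
        { apply Rmult_le_reg_r with (a * (b * b * b))%R; [repeat apply Rmult_lt_0_compat; auto|].
          replace (/ (b * b * b) * (a * (b * b * b)))%R with a by (field; lra).
          replace ((2 / a - 2 / b) * (a * (b * b * b)))%R with (2 * (b * b) * (b - a))%R
            by (field; lra).
          assert ((b - a) * (b + a) = 1)%R by lra.
          assert ((b - a) * (2 * b) >= 1)%R by nra. nra. }
        lra.
    + assert (0 < 2 / sqrt (1 + INR (list_max B)))%R.
      { apply Rdiv_lt_0_compat; [lra | apply sqrt_lt_R0; auto]. }
      lra.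
Qed.

Lemma summable_bool (f : bool -> R) : (forall b, (0 <= f b)%R) -> summable f.
Proof.
  intros H. apply (summable_finite f (true :: false :: nil)); auto.
  intros [|] Hb; exfalso; apply Hb; simpl; auto.
Qed.

Lemma summable_wt : summable wt.
Proof.
  apply (summable_le _ (fun n : Z => 1 * (/ ((1 + INR (Z.abs_nat n)) * sqrt (1 + INR (Z.abs_nat n)))))%R).
  - intros n. unfold wt. rewrite INR_IZR_INZ, Zabs2Nat.id_abs, Rmult_1_l. split; [|lra].
    apply Rlt_le, Rinv_0_lt_compat. pose proof (wt_base n).
    apply Rmult_lt_0_compat; [lra|]. apply sqrt_lt_R0. lra.
  - apply (summable_comp_inj (fun n : Z => (Z.ltb n 0, Z.abs_nat n))
      (fun p => 1 * / ((1 + INR (snd p)) * sqrt (1 + INR (snd p))))%R).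
    + intros u v H. inversion H as [[H1 H2]].
      destruct (Z.ltb_spec u 0), (Z.ltb_spec v 0); try discriminate; lia.
    + apply (summable_prod (fun _ : bool => 1%R)
        (fun k : nat => / ((1 + INR k) * sqrt (1 + INR k)))%R).
      * apply summable_bool. intros; lra.
      * apply summable_wt_nat.
Qed.

Lemma wt_ge_sqr (n : Z) : (/ (1 + IZR (Z.abs n)) ^ 2 <= wt n)%R.
Proof.
  pose proof (wt_base n) as H. unfold wt. set (x := (1 + IZR (Z.abs n))%R) in *.
  assert (Hs : (0 < sqrt x)%R) by (apply sqrt_lt_R0; lra).
  assert (E : (sqrt x * sqrt x = x)%R) by (apply sqrt_sqrt; lra).
  apply Rinv_le_contravar; [nra|].
  assert (1 <= sqrt x)%R by (rewrite <- sqrt_1; apply sqrt_le_1_alt; lra). nra.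
Qed.

(** From x y <= (x + y - 1)^2 for x, y >= 1, raised to the power 3/2. *)
Lemma wt_prod (m n : Z) :
  (/ (1 + IZR (Z.abs m) + IZR (Z.abs n)) ^ 3 <= wt m * wt n)%R.
Proof.
  pose proof (wt_base m) as Hm. pose proof (wt_base n) as Hn. unfold wt.
  set (x := (1 + IZR (Z.abs m))%R) in *. set (y := (1 + IZR (Z.abs n))%R) in *.
  replace (x + IZR (Z.abs n))%R with (x + y - 1)%R by (unfold y; ring).
  set (X := (x + y - 1)%R).
  rewrite <- Rinv_mult.
  replace (x * sqrt x * (y * sqrt y))%R with (x * y * sqrt (x * y))%R
    by (rewrite sqrt_mult by lra; ring).
  assert (Hxy : (1 <= x * y)%R) by nra.
  assert (Hs : (0 < sqrt (x * y))%R) by (apply sqrt_lt_R0; lra).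
  assert (HX : (x * y <= X * X)%R) by (unfold X; nra).
  assert (HX1 : (1 <= X)%R) by (unfold X; lra).
  assert (HsX : (sqrt (x * y) <= X)%R).
  { rewrite <- (sqrt_square X) by lra. apply sqrt_le_1_alt. auto. }
  apply Rinv_le_contravar; [nra|].
  replace (X ^ 3)%R with (X * X * X)%R by ring.
  apply Rmult_le_compat; lra.
Qed.

(** * The cotangent and its derivatives *)

Definition qexp (a : C) : C := Cexp (2 * Ci * PI * a).

Definition is_int (a : C) : Prop := exists n : Z, a = IZR n.

(* [cotp a] is [PI * cot (PI * a)], and [csc2] to [csc2''] are the opposite
   of its derivative and the next ones. As [/ 0 = 0], all of them vanish at
   the integers. *)
Definition cotp (a : C) : C := PI * Ci * (qexp a + 1) / (qexp a - 1).
Definition csc2 (a : C) : C := - (4) * PI ^ 2 * qexp a / (qexp a - 1) ^ 2.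
Definition csc2' (a : C) : C := - (2) * cotp a * csc2 a.
Definition csc2'' (a : C) : C := 6 * csc2 a ^ 2 - 4 * PI ^ 2 * csc2 a.
Definition csc2''' (a : C) : C := (12 * csc2 a - 4 * PI ^ 2) * csc2' a.

Lemma Cinv_0 : / 0 = 0.
Proof. unfold Cinv. apply injective_projections; simpl; unfold Rdiv; ring. Qed.

Lemma Cinv_pow (x : C) (k : nat) : / x ^ k = (/ x) ^ k.
Proof.
  destruct (classic (x = 0)) as [->|Hx].
  - rewrite Cinv_0. destruct k; simpl; [field|]. rewrite Cmult_0_l. apply Cinv_0.
  - symmetry. apply Cpow_inv. auto.
Qed.

Lemma PI_C_neq_0 : RtoC PI <> 0.
Proof. intros H. apply RtoC_inj in H. apply PI_neq0. auto. Qed.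

Lemma Ci_sqr : Ci ^ 2 = - (1).
Proof. simpl. apply injective_projections; simpl; ring. Qed.

Lemma qexp_plus (a b : C) : qexp (a + b) = qexp a * qexp b.
Proof. unfold qexp. rewrite <- Cexp_plus. f_equal. ring. Qed.

Lemma qexp_opp (a : C) : qexp (- a) = / qexp a.
Proof. unfold qexp. rewrite <- Cexp_opp. f_equal. ring. Qed.

Lemma qexp_neq_0 (a : C) : qexp a <> 0.
Proof. apply Cexp_neq_0. Qed.

Lemma qexp_arg (a : C) : 2 * Ci * PI * a = (- (2 * PI * Im a), 2 * PI * Re a)%R.
Proof. destruct a as [x y]. apply injective_projections; simpl; ring. Qed.

Lemma Cmod_qexp (a : C) : Cmod (qexp a) = exp (- (2 * PI * Im a)).
Proof. unfold qexp. rewrite Cmod_Cexp, qexp_arg. reflexivity. Qed.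

Lemma qexp_int (n : Z) : qexp (IZR n) = 1.
Proof.
  unfold qexp. rewrite qexp_arg. unfold Cexp, Re, Im. simpl fst. simpl snd.
  replace (- (2 * PI * 0))%R with 0%R by ring. rewrite exp_0.
  replace (2 * PI * IZR n)%R with (2 * (IZR n * PI))%R by ring.
  assert (H : sin (IZR n * PI) = 0%R) by (apply sin_eq_0_1; eauto).
  rewrite cos_2a_sin, sin_2a, H. apply injective_projections; simpl; ring.
Qed.

Lemma qexp_eq_1 (a : C) : qexp a = 1 -> is_int a.
Proof.
  intros H. assert (H1 : Cmod (qexp a) = 1%R) by (rewrite H; apply Cmod_1).
  rewrite Cmod_qexp, <- exp_0 in H1. apply exp_inv in H1.
  pose proof PI_RGT_0 as Hpi.
  assert (H2 : Im a = 0%R) by nra.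
  unfold qexp in H. rewrite qexp_arg in H. unfold Cexp, Re, Im in H. simpl fst in H. simpl snd in H.
  apply (f_equal fst) in H. simpl in H. unfold Im in H2. rewrite H2 in H.
  replace (- (2 * PI * 0))%R with 0%R in H by ring. rewrite exp_0, Rmult_1_l in H.
  replace (2 * PI * fst a)%R with (2 * (PI * fst a))%R in H by ring.
  rewrite cos_2a_sin in H.
  assert (H3 : sin (PI * fst a) = 0%R) by nra.
  apply sin_eq_0_0 in H3. destruct H3 as [k Hk]. exists k.
  destruct a as [x y]. simpl in *. subst y. apply injective_projections; simpl; auto.
  nra.
Qed.

Lemma qexp_sub_1_neq_0 (a : C) : ~ is_int a -> qexp a - 1 <> 0.
Proof. intros H. apply Cminus_eq_contra. intros E. apply H, qexp_eq_1, E. Qed.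

Lemma cotp_int (a : C) : is_int a -> cotp a = 0.
Proof.
  intros [n ->]. unfold cotp. rewrite qexp_int. replace (1 - 1) with (RtoC 0) by ring.
  unfold Cdiv. rewrite Cinv_0. ring.
Qed.

Lemma csc2_int (a : C) : is_int a -> csc2 a = 0.
Proof.
  intros [n ->]. unfold csc2. rewrite qexp_int. replace ((1 - 1) ^ 2) with (RtoC 0) by ring.
  unfold Cdiv. rewrite Cinv_0. ring.
Qed.

Lemma csc2'_int (a : C) : is_int a -> csc2' a = 0.
Proof. intros H. unfold csc2'. rewrite csc2_int; auto. ring. Qed.

Lemma cotp_sqr (a : C) : ~ is_int a -> cotp a ^ 2 = csc2 a - PI ^ 2.
Proof.
  intros H. apply qexp_sub_1_neq_0 in H. unfold cotp, csc2.
  replace ((PI * Ci * (qexp a + 1) / (qexp a - 1)) ^ 2)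
    with (PI ^ 2 * Ci ^ 2 * (qexp a + 1) ^ 2 / (qexp a - 1) ^ 2) by (field; auto).
  rewrite Ci_sqr. field. auto.
Qed.

Lemma is_int_opp (a : C) : is_int (- a) <-> is_int a.
Proof.
  split; intros [n Hn]; exists (- n)%Z; rewrite opp_IZR, RtoC_opp, <- Hn; ring.
Qed.

Lemma is_int_plus (a : C) (n : Z) : is_int (a + IZR n) <-> is_int a.
Proof.
  split; intros [m Hm].
  - exists (m - n)%Z. rewrite minus_IZR, RtoC_minus, <- Hm. ring.
  - exists (m + n)%Z. rewrite plus_IZR, RtoC_plus, <- Hm. ring.
Qed.

Lemma qexp_shift (a : C) (n : Z) : qexp (a + IZR n) = qexp a.
Proof. rewrite qexp_plus, qexp_int. ring. Qed.

Lemma csc2_shift (a : C) (n : Z) : csc2 (a + IZR n) = csc2 a.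
Proof. unfold csc2. rewrite qexp_shift. reflexivity. Qed.

Lemma cotp_opp (a : C) : cotp (- a) = - cotp a.
Proof.
  destruct (classic (is_int a)) as [H|H].
  - rewrite !cotp_int; auto; [ring|]. apply is_int_opp. auto.
  - apply qexp_sub_1_neq_0 in H. pose proof (qexp_neq_0 a).
    unfold cotp. rewrite qexp_opp. field. split; auto. split; auto.
    replace (1 - qexp a) with (- (qexp a - 1)) by ring. intros E. apply H.
    replace (qexp a - 1) with (- - (qexp a - 1)) by ring. rewrite E. ring.
Qed.

Lemma csc2_opp (a : C) : csc2 (- a) = csc2 a.
Proof.
  destruct (classic (is_int a)) as [H|H].
  - rewrite !csc2_int; auto. apply is_int_opp. auto.
  - apply qexp_sub_1_neq_0 in H. pose proof (qexp_neq_0 a).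
    unfold csc2. rewrite qexp_opp. field. split; auto. split; auto.
    replace (1 - qexp a) with (- (qexp a - 1)) by ring. intros E. apply H.
    replace (qexp a - 1) with (- - (qexp a - 1)) by ring. rewrite E. ring.
Qed.

Section Addition.

Variables a b : C.
Hypotheses (Ha : ~ is_int a) (Hb : ~ is_int b) (Hab : ~ is_int (a - b)).

Lemma qexp_sub_neq_0 : qexp a - qexp b <> 0.
Proof.
  intros E. apply Hab, qexp_eq_1. unfold Cminus. rewrite qexp_plus, qexp_opp.
  apply (proj2 (Ceq_minus _ _)) in E. rewrite E. apply Cinv_r, qexp_neq_0.
Qed.

Lemma qexp_sub : qexp (a - b) = qexp a / qexp b.
Proof. unfold Cminus. rewrite qexp_plus, qexp_opp. reflexivity. Qed.

Let cot0 (x : C) : C := (qexp x + 1) / (qexp x - 1).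

Let cotp_cot0 (x : C) : cotp x = PI * Ci * cot0 x.
Proof. unfold cotp, cot0, Cdiv. ring. Qed.

(** The mixed derivative in a and b of the addition theorem c(a) c(b) = c(a - b) (c(b) - c(a)) -
    pi^2, verified here as a rational identity in [qexp a] and [qexp b]. *)
Lemma csc2_mult :
  csc2 a * csc2 b = csc2' (a - b) * (cotp b - cotp a) + csc2 (a - b) * (csc2 a + csc2 b).
Proof.
  pose proof qexp_sub_neq_0. pose proof (qexp_sub_1_neq_0 a Ha).
  pose proof (qexp_sub_1_neq_0 b Hb). pose proof (qexp_neq_0 a). pose proof (qexp_neq_0 b).
  (* [field] does not know that the square of [Ci] is -1, so the two factors [Ci] of the cotangents
     are collected before it is called. *)
  replace (csc2' (a - b) * (cotp b - cotp a))
    with (Ci ^ 2 * (- (2) * PI ^ 2 * cot0 (a - b) * csc2 (a - b) * (cot0 b - cot0 a)))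
    by (unfold csc2'; rewrite !cotp_cot0; ring).
  rewrite Ci_sqr. unfold cot0, csc2. rewrite qexp_sub. field. auto.
Qed.

(** The opposite of the second derivative in b of the same addition theorem. *)
Lemma cotp_mult_csc2' :
  cotp a * csc2' b = csc2' (a - b) * (cotp b - cotp a) + 2 * csc2 (a - b) * csc2 b
    + cotp (a - b) * csc2' b.
Proof.
  pose proof qexp_sub_neq_0. pose proof (qexp_sub_1_neq_0 a Ha).
  pose proof (qexp_sub_1_neq_0 b Hb). pose proof (qexp_neq_0 a). pose proof (qexp_neq_0 b).
  replace (csc2' (a - b) * (cotp b - cotp a) + 2 * csc2 (a - b) * csc2 b
    + cotp (a - b) * csc2' b)
    with (Ci ^ 2 * (- (2) * PI ^ 2 * cot0 (a - b) * csc2 (a - b) * (cot0 b - cot0 a)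
       - 2 * PI ^ 2 * cot0 (a - b) * cot0 b * csc2 b) + 2 * csc2 (a - b) * csc2 b)
    by (unfold csc2'; rewrite !cotp_cot0; ring).
  replace (cotp a * csc2' b) with (Ci ^ 2 * (- (2) * PI ^ 2 * cot0 a * cot0 b * csc2 b))
    by (unfold csc2'; rewrite !cotp_cot0; ring).
  rewrite Ci_sqr. unfold cot0, csc2. rewrite qexp_sub. field. auto.
Qed.

End Addition.

Lemma is_cder_qexp (a : C) : is_cder qexp a (2 * Ci * PI * qexp a).
Proof.
  apply (is_cder_eq _ _ (qexp a * (2 * Ci * PI * 1))); [|ring].
  apply (is_cder_comp Cexp (fun y => 2 * Ci * PI * y)); [apply is_cder_Cexp|].
  apply is_cder_scal, is_cder_id.
Qed.

Lemma is_cder_qexp_inv (a : C) : ~ is_int a ->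
  is_cder (fun y => / (qexp y - 1)) a (- (2) * Ci * PI * qexp a / (qexp a - 1) ^ 2).
Proof.
  intros H. apply qexp_sub_1_neq_0 in H.
  apply (is_cder_eq _ _ (- / ((qexp a - 1) * (qexp a - 1)) * (2 * Ci * PI * qexp a - 0)));
    [|field; auto].
  apply (is_cder_comp Cinv (fun y => qexp y - 1)).
  - apply is_cder_inv. auto.
  - apply is_cder_minus; [apply is_cder_qexp | apply is_cder_const].
Qed.

Lemma is_cder_cotp (a : C) : ~ is_int a -> is_cder cotp a (- csc2 a).
Proof.
  intros H. pose proof (qexp_sub_1_neq_0 a H) as H1.
  apply (is_cder_eq _ _ (PI * Ci * ((2 * Ci * PI * qexp a + 0) * / (qexp a - 1) +
    (qexp a + 1) * (- (2) * Ci * PI * qexp a / (qexp a - 1) ^ 2)))).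
  - apply (is_cder_ext (fun y => PI * Ci * ((qexp y + 1) * / (qexp y - 1)))).
    { intros y. unfold cotp, Cdiv. ring. }
    apply is_cder_scal, (is_cder_mult (fun y => qexp y + 1) (fun y => / (qexp y - 1)));
      [|apply is_cder_qexp_inv; auto].
    apply is_cder_plus; [apply is_cder_qexp | apply is_cder_const].
  - transitivity (Ci ^ 2 * (- (4) * PI ^ 2 * qexp a / (qexp a - 1) ^ 2)); [field; auto|].
    rewrite Ci_sqr. unfold csc2. field. auto.
Qed.

Lemma is_cder_csc2 (a : C) : ~ is_int a -> is_cder csc2 a (csc2' a).
Proof.
  intros H. pose proof (qexp_sub_1_neq_0 a H) as H1.
  set (d := - (2) * Ci * PI * qexp a / (qexp a - 1) ^ 2).
  apply (is_cder_eq _ _ (- (4) * PI ^ 2 * (2 * Ci * PI * qexp a * (/ (qexp a - 1) * / (qexp a - 1))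
    + qexp a * (d * / (qexp a - 1) + / (qexp a - 1) * d)))).
  - apply (is_cder_ext_loc
      (fun y => - (4) * PI ^ 2 * (qexp y * (/ (qexp y - 1) * / (qexp y - 1)))) _ _ _
      (mkposreal 1 Rlt_0_1)).
    { intros y _. unfold csc2, Cdiv. rewrite Cinv_pow. ring. }
    apply is_cder_scal.
    apply (is_cder_mult qexp (fun y => / (qexp y - 1) * / (qexp y - 1)));
      [apply is_cder_qexp|].
    apply (is_cder_mult (fun y => / (qexp y - 1)) (fun y => / (qexp y - 1)));
      apply is_cder_qexp_inv; auto.
  - unfold csc2', cotp, csc2, d. field. auto.
Qed.

Lemma is_cder_csc2' (a : C) : ~ is_int a -> is_cder csc2' a (csc2'' a).
Proof.
  intros H. apply (is_cder_eq _ _ (- (2) * (- csc2 a * csc2 a + cotp a * csc2' a))).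
  - apply (is_cder_ext (fun y => - (2) * (cotp y * csc2 y))); [intros; unfold csc2'; ring|].
    apply is_cder_scal, is_cder_mult; [apply is_cder_cotp | apply is_cder_csc2]; auto.
  - unfold csc2', csc2''.
    transitivity (2 * csc2 a ^ 2 + 4 * cotp a ^ 2 * csc2 a); [ring|].
    rewrite cotp_sqr; auto. ring.
Qed.

Lemma is_cder_csc2'' (a : C) : ~ is_int a -> is_cder csc2'' a (csc2''' a).
Proof.
  intros H. apply (is_cder_eq _ _ (6 * (csc2' a * csc2 a + csc2 a * csc2' a)
    - 4 * PI ^ 2 * csc2' a)); [|unfold csc2'''; ring].
  apply (is_cder_ext (fun y => 6 * (csc2 y * csc2 y) - 4 * PI ^ 2 * csc2 y)).
  { intros; unfold csc2''; ring. }
  pose proof (is_cder_csc2 a H).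
  apply is_cder_minus; apply is_cder_scal; auto. apply is_cder_mult; auto.
Qed.

(** * Partial fractions *)

Definition usum {T : Type} (F : T -> C) : C := epsilon (inhabits (RtoC 0)) (is_usum F).

Lemma usum_correct {T : Type} (F : T -> C) :
  summable (fun t => Cmod (F t)) -> is_usum F (usum F).
Proof. intros H. exact (epsilon_spec _ (is_usum F) (is_usum_exists F H)). Qed.

Lemma usum_unique {T : Type} (F : T -> C) (s : C) : is_usum F s -> usum F = s.
Proof.
  intros H. apply (is_usum_unique F); auto.
  exact (epsilon_spec _ (is_usum F) (ex_intro _ s H)).
Qed.

Lemma Z_bounded_list (K : R) : exists A : list Z, forall m, ~ In m A -> (K <= IZR (Z.abs m))%R.
Proof.
  exists (zseg (Z.to_nat (up (Rmax K 0)))). intros m Hm. rewrite In_zseg in Hm.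
  destruct (archimed (Rmax K 0)) as [Hu _]. pose proof (Rmax_l K 0). pose proof (Rmax_r K 0).
  assert (0 <= up (Rmax K 0))%Z by (apply le_IZR; lra).
  rewrite Z2Nat.id in Hm by auto.
  assert (IZR (up (Rmax K 0)) < IZR (Z.abs m))%R by (apply IZR_lt; lia). lra.
Qed.

Lemma Cmod_IZR (n : Z) : Cmod (IZR n) = IZR (Z.abs n).
Proof. rewrite Cmod_R, abs_IZR. reflexivity. Qed.

Lemma Cmod_add_int_ge (a : C) (m : Z) :
  (2 * Cmod a + 1 <= IZR (Z.abs m))%R -> ((1 + IZR (Z.abs m)) / 2 <= Cmod (a + IZR m))%R.
Proof.
  intros H. pose proof (Cmod_triangle (a + IZR m) (- a)) as Ht.
  rewrite Cmod_opp in Ht. replace (a + IZR m + - a) with (RtoC (IZR m)) in Ht by ring.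
  rewrite Cmod_IZR in Ht. lra.
Qed.

Lemma Cmod_neq_0 (x : C) : (0 < Cmod x)%R -> x <> 0.
Proof. apply Cmod_gt_0. Qed.

Lemma Cmod_inv_le (x : C) (b : R) : (0 < b)%R -> (b <= Cmod x)%R -> (Cmod (/ x) <= / b)%R.
Proof.
  intros Hb H. rewrite Cmod_inv by (apply Cmod_neq_0; lra).
  apply Rinv_le_contravar; auto.
Qed.

Lemma Cmod_pow_inv_le (x : C) (b : R) (k : nat) : (0 < b)%R -> (b <= Cmod x)%R ->
  (Cmod (/ x ^ k) <= / b ^ k)%R.
Proof.
  intros Hb H. apply Cmod_inv_le; [apply pow_lt; auto|].
  rewrite Cmod_pow. apply pow_incr. lra.
Qed.

Lemma inv_pow_wt (m : Z) (k : nat) : (2 <= k)%nat ->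
  (/ ((1 + IZR (Z.abs m)) / 2) ^ k <= 2 ^ k * wt m)%R.
Proof.
  intros Hk. pose proof (wt_base m) as Hm. pose proof (wt_ge_sqr m) as Hw.
  set (x := (1 + IZR (Z.abs m))%R) in *.
  assert (H2 : (0 < 2 ^ k)%R) by (apply pow_lt; lra).
  assert (Hx : (0 < x ^ k)%R) by (apply pow_lt; lra).
  replace (/ (x / 2) ^ k)%R with (2 ^ k * / x ^ k)%R.
  - apply Rmult_le_compat_l; [lra|]. eapply Rle_trans; [|exact Hw].
    apply Rinv_le_contravar; [apply pow_lt; lra|]. apply Rle_pow; auto.
  - unfold Rdiv. rewrite Rpow_mult_distr, pow_inv. field. lra.
Qed.

Lemma summable_inv_pow (a : C) (k : nat) : (2 <= k)%nat ->
  summable (fun m : Z => Cmod (/ (a + IZR m) ^ k)).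
Proof.
  intros Hk. destruct (Z_bounded_list (2 * Cmod a + 1)) as [A HA].
  apply (summable_le_except _ (fun m => 2 ^ k * wt m)%R A).
  - intros m. apply Cmod_ge_0.
  - intros m Hm. apply HA, Cmod_add_int_ge in Hm.
    eapply Rle_trans; [|apply inv_pow_wt; auto].
    apply Cmod_pow_inv_le; auto. pose proof (wt_base m). lra.
  - apply summable_scal; [apply pow_le; lra | apply summable_wt].
Qed.

Definition psum (k : nat) (a : C) : C := usum (fun m : Z => / (a + IZR m) ^ k).

Lemma is_usum_psum (k : nat) (a : C) : (2 <= k)%nat ->
  is_usum (fun m : Z => / (a + IZR m) ^ k) (psum k a).
Proof. intros Hk. apply usum_correct, summable_inv_pow. auto. Qed.

Lemma is_usum_Z_shift (F : Z -> C) (n : Z) (s : C) :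
  is_usum (fun m => F (m + n)%Z) s <-> is_usum F s.
Proof. apply (is_usum_bij (fun m => m + n)%Z (fun m => m - n)%Z); intros; lia. Qed.

Lemma psum_shift (k : nat) (a : C) (n : Z) : (2 <= k)%nat ->
  psum k (a + IZR n) = psum k a.
Proof.
  intros Hk. apply usum_unique.
  apply (is_usum_ext (fun m => / (a + IZR (m + n)) ^ k)).
  - intros m. rewrite plus_IZR, RtoC_plus. f_equal. f_equal. ring.
  - apply (is_usum_Z_shift (fun m => / (a + IZR m) ^ k)). apply is_usum_psum. auto.
Qed.

Lemma is_usum_bool (g : bool -> C) (s : C) : is_usum g s -> s = g true + g false.
Proof.
  intros H. apply (is_usum_unique g); auto.
  apply (is_usum_eq _ (csum g (true :: false :: nil))); [|unfold csum; simpl; ring].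
  apply is_usum_finite.
  - repeat constructor; simpl; intuition discriminate.
  - intros [|] Hb; exfalso; apply Hb; simpl; auto.
Qed.

Lemma is_usum_even_odd (F : Z -> C) (s s0 s1 : C) :
  is_usum F s -> is_usum (fun m => F (2 * m)%Z) s0 -> is_usum (fun m => F (2 * m + 1)%Z) s1 ->
  s = s0 + s1.
Proof.
  intros H H0 H1.
  assert (HB : is_usum (fun p : bool * Z => F (2 * snd p + if fst p then 1 else 0)%Z) s).
  { apply (is_usum_bij (fun p : bool * Z => (2 * snd p + if fst p then 1 else 0)%Z)
      (fun m => (Z.odd m, Z.div2 m))); auto.
    - intros [[|] m]; simpl fst; simpl snd; f_equal.
      + rewrite Z.odd_add_mul_2 || (rewrite Z.add_comm, Z.odd_add_mul_2; auto).
      + rewrite Z.div2_div. symmetry. apply (Z.div_unique _ _ _ 1); lia.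
      + rewrite Z.add_comm, Z.odd_add_mul_2; auto.
      + rewrite Z.div2_div. symmetry. apply (Z.div_unique _ _ _ 0); lia.
    - intros m. simpl fst. simpl snd. pose proof (Z.div2_odd m) as E.
      destruct (Z.odd m); simpl in *; lia. }
  apply (is_usum_Fubini _ _ (fun b : bool => if b then s1 else s0)) in HB.
  - apply is_usum_bool in HB. rewrite HB. ring.
  - intros [|]; simpl fst; simpl snd; auto.
    apply (is_usum_ext (fun m => F (2 * m)%Z)); auto. intros m. f_equal. lia.
Qed.

(** The integers are split into even and odd ones. As [/ 0 = 0], the relation also holds when a
    denominator vanishes; at a = 0 it becomes an equation for the sum over the nonzero integers. *)
Lemma psum_double (k : nat) (a : C) : (2 <= k)%nat ->
  2 ^ k * psum k (2 * a) = psum k a + psum k (a + / 2).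
Proof.
  intros Hk.
  assert (H2 : RtoC 2 <> 0) by (intros E; apply RtoC_inj in E; lra).
  assert (H2k : 2 ^ k <> 0) by (apply Cpow_nz; auto).
  assert (Hsc : forall x y : C, x = 2 * y -> 2 ^ k * / x ^ k = / y ^ k).
  { intros x y ->.
    destruct (classic (y = 0)) as [->|Hy].
    - rewrite !Cinv_pow, Cmult_0_r, Cinv_0. destruct k; [lia|]. simpl. ring.
    - rewrite Cpow_mult_l. pose proof (Cpow_nz y k Hy). field. auto. }
  apply (is_usum_even_odd (fun m => 2 ^ k * / (2 * a + IZR m) ^ k)).
  - apply is_usum_scal, is_usum_psum. auto.
  - apply (is_usum_ext (fun m => / (a + IZR m) ^ k)); [|apply is_usum_psum; auto].
    intros m. symmetry. apply Hsc. rewrite mult_IZR, RtoC_mult. ring.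
  - apply (is_usum_ext (fun m => / (a + / 2 + IZR m) ^ k)); [|apply is_usum_psum; auto].
    intros m. symmetry. apply Hsc. rewrite plus_IZR, mult_IZR, RtoC_plus, RtoC_mult. field.
Qed.

Lemma csc2_double (a : C) : ~ is_int a -> ~ is_int (a + / 2) ->
  4 * csc2 (2 * a) = csc2 a + csc2 (a + / 2).
Proof.
  intros H1 H2. apply qexp_sub_1_neq_0 in H1. apply qexp_sub_1_neq_0 in H2.
  assert (E1 : qexp (2 * a) = qexp a ^ 2).
  { replace (2 * a) with (a + a) by ring. rewrite qexp_plus. ring. }
  assert (E2 : qexp (/ 2) = - (1)).
  { unfold qexp. replace (2 * Ci * PI * / 2) with (0, PI).
    - unfold Cexp, Re, Im. simpl. rewrite exp_0, cos_PI, sin_PI.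
      apply injective_projections; simpl; ring.
    - apply injective_projections; simpl; field. }
  rewrite qexp_plus, E2 in H2.
  unfold csc2. rewrite E1, qexp_plus, E2.
  set (u := qexp a) in *.
  assert (H3 : u + 1 <> 0).
  { intros E. apply H2. replace (u * - (1) - 1) with (- (u + 1)) by ring. rewrite E. ring. }
  assert (H4 : u ^ 2 - 1 <> 0).
  { replace (u ^ 2 - 1) with ((u - 1) * (u + 1)) by ring. apply Cmult_neq_0; auto. }
  field. repeat split; auto.
  intros E. apply H2. rewrite <- E. cbv beta. ring.
Qed.

(** Twice the hyperbolic sine; with v = pi i a it turns [csc2] into an inverse square. *)
Definition Csh (v : C) : C := Cexp v - Cexp (- v).

Lemma csc2_Csh (a : C) : ~ is_int a -> csc2 a = - (4) * PI ^ 2 / Csh (Ci * PI * a) ^ 2.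
Proof.
  intros H. apply qexp_sub_1_neq_0 in H. unfold csc2, Csh.
  assert (E : qexp a = Cexp (Ci * PI * a) ^ 2).
  { unfold qexp. simpl. rewrite Cmult_1_r, <- Cexp_plus. f_equal. ring. }
  rewrite Cexp_opp. rewrite E in *. pose proof (Cexp_neq_0 (Ci * PI * a)).
  set (e := Cexp (Ci * PI * a)) in *.
  assert (E1 : e - / e = (e ^ 2 - 1) / e) by (field; auto).
  rewrite E1. field. auto.
Qed.

Lemma is_cder_Cexp_opp (v : C) : is_cder (fun v => Cexp (- v)) v (- Cexp (- v)).
Proof.
  apply (is_cder_eq _ _ (Cexp (- v) * (- (1) * 1))); [|ring].
  apply (is_cder_comp Cexp (fun y => - y)); [apply is_cder_Cexp|].
  apply (is_cder_ext (fun y => - (1) * y)); [intros; ring|].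
  apply is_cder_scal, is_cder_id.
Qed.

Lemma Cmod_Cexp_le (v : C) : (Cmod v <= 1)%R -> (Cmod (Cexp v) <= 3)%R.
Proof.
  intros H. rewrite Cmod_Cexp. apply Rle_trans with (exp 1); [|apply exp_le_3].
  pose proof (re_le_Cmod v) as Hr. apply Rabs_le_between in Hr.
  destruct (Rle_lt_or_eq_dec (Re v) 1 ltac:(lra)) as [Hl|Hl].
  - apply Rlt_le, exp_increasing. auto.
  - rewrite Hl. lra.
Qed.

Lemma Cmod_ray (v : C) (t : R) : (0 <= t <= 1)%R ->
  (Cmod (0 + t * (v - 0)) <= Cmod v)%R.
Proof.
  intros Ht. replace (0 + t * (v - 0)) with (t * v) by ring.
  rewrite Cmod_mult, Cmod_R, Rabs_right by lra. pose proof (Cmod_ge_0 v). nra.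
Qed.

(** Three uses of the mean value inequality: the bound 6 for the derivative of [Csh] on the unit
    disc gives 6 |v| for [Csh], then 6 |v|^2 for its derivative minus 2, then the claim. *)
Lemma Csh_third_order (v : C) : (Cmod v <= 1)%R ->
  (Cmod (Csh v - 2 * v) <= 6 * Cmod v ^ 3)%R.
Proof.
  intros Hv.
  set (ch := fun v => Cexp v + Cexp (- v)).
  assert (Dsh : forall v, is_cder Csh v (ch v)).
  { intros x. apply (is_cder_eq _ _ (Cexp x - - Cexp (- x))); [|unfold ch; ring].
    apply is_cder_minus; [apply is_cder_Cexp | apply is_cder_Cexp_opp]. }
  assert (Dch : forall v, is_cder ch v (Csh v)).
  { intros x. apply (is_cder_eq _ _ (Cexp x + - Cexp (- x))); [|unfold Csh; ring].
    apply is_cder_plus; [apply is_cder_Cexp | apply is_cder_Cexp_opp]. }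
  assert (H1 : forall x, (Cmod x <= 1)%R -> (Cmod (Csh x) <= 6 * Cmod x)%R).
  { intros x Hx. pose proof (is_cder_mean_value Csh ch 0 x 6) as M.
    replace (Csh x - Csh 0) with (Csh x) in M
      by (unfold Csh; replace (- (0)) with (RtoC 0) by ring; ring).
    replace (x - 0) with x in M by ring. apply M. intros t Ht. split; auto.
    pose proof (Cmod_ray x t Ht) as Hr. replace (x - 0) with x in Hr by ring.
    unfold ch. eapply Rle_trans; [apply Cmod_triangle|].
    pose proof (Cmod_Cexp_le (0 + t * x) ltac:(lra)).
    pose proof (Cmod_Cexp_le (- (0 + t * x)) ltac:(rewrite Cmod_opp; lra)). lra. }
  assert (H2 : forall x, (Cmod x <= 1)%R -> (Cmod (ch x - 2) <= 6 * Cmod x * Cmod x)%R).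
  { intros x Hx. pose proof (is_cder_mean_value ch Csh 0 x (6 * Cmod x)) as M.
    replace (ch 0) with (RtoC 2) in M
      by (unfold ch; replace (- (0)) with (RtoC 0) by ring; rewrite Cexp_0;
          apply injective_projections; simpl; ring).
    replace (x - 0) with x in M by ring. apply M. intros t Ht. split; auto.
    pose proof (Cmod_ray x t Ht) as Hr. replace (x - 0) with x in Hr by ring.
    eapply Rle_trans; [apply H1; lra|]. lra. }
  pose proof (is_cder_mean_value (fun x => Csh x - 2 * x) (fun x => ch x - 2) 0 v
    (6 * Cmod v * Cmod v)) as M.
  simpl in M.
  replace (Csh v - 2 * v - (Csh 0 - 2 * 0)) with (Csh v - 2 * v) in M
    by (unfold Csh; replace (- (0)) with (RtoC 0) by ring; ring).
  replace (6 * Cmod v ^ 3)%R with (6 * Cmod v * Cmod v * Cmod v)%R by ring.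
  replace (Cmod v) with (Cmod (v - 0)) at 3 by (f_equal; ring).
  apply M. intros t Ht. split.
  - apply is_cder_minus; auto. apply (is_cder_eq _ _ (2 * 1)); [|ring].
    apply is_cder_scal, is_cder_id.
  - pose proof (Cmod_ray v t Ht) as Hr. eapply Rle_trans; [apply H2; lra|].
    pose proof (Cmod_ge_0 (0 + t * (v - 0))). nra.
Qed.

Lemma sin_lower_bound (y : R) : (0 <= y <= PI / 2)%R -> (y / 3 <= sin y)%R.
Proof.
  intros Hy. pose proof PI_4. pose proof PI_RGT_0.
  pose proof (proj1 (pre_sin_bound y 0 ltac:(lra) ltac:(lra))) as Hs.
  unfold sin_approx, sin_term in Hs. simpl in Hs. nra.
Qed.

Lemma Rsqr_exp_sub_ge (x : R) : (x ^ 2 <= (exp x - exp (- x)) ^ 2)%R.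
Proof.
  assert (P : forall x, (0 <= x)%R -> (x ^ 2 <= (exp x - exp (- x)) ^ 2)%R).
  { clear x. intros x Hx. pose proof (exp_ineq1_le x).
    assert (exp (- x) <= 1)%R.
    { rewrite <- exp_0. destruct Hx as [Hx| <-].
      - apply Rlt_le, exp_increasing. lra.
      - rewrite Ropp_0. lra. }
    apply pow_incr. lra. }
  destruct (Rle_dec 0 x) as [Hx|Hx]; auto.
  specialize (P (- x)%R ltac:(lra)). rewrite Ropp_involutive in P.
  replace ((- x) ^ 2)%R with (x ^ 2)%R in P by ring.
  replace ((exp (- x) - exp x) ^ 2)%R with ((exp x - exp (- x)) ^ 2)%R in P by ring. auto.
Qed.

(** |Csh(x + i y)|^2 = (e^x - e^(-x))^2 + 4 sin(y)^2. The condition on the imaginary part keeps v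
    away from the zeros other than 0. *)
Lemma Csh_lower_bound (v : C) : (Rabs (Im v) <= PI / 2)%R -> (Cmod v / 2 <= Cmod (Csh v))%R.
Proof.
  intros Hy. apply Rsqr_incr_0; [|pose proof (Cmod_ge_0 v); lra | apply Cmod_ge_0].
  rewrite !Rsqr_pow2.
  replace ((Cmod v / 2) ^ 2)%R with (Cmod v ^ 2 / 4)%R by field.
  rewrite !Cmod2_alt. destruct v as [x y]. unfold Csh, Cexp, Re, Im in *. simpl fst in *. simpl snd in *.
  rewrite cos_neg, sin_neg.
  replace ((exp x * cos y + - (exp (- x) * cos y)) ^ 2 +
    (exp x * sin y + - (exp (- x) * - sin y)) ^ 2)%R
    with ((exp x - exp (- x)) ^ 2 * (sin y ^ 2 + cos y ^ 2) + 4 * (exp x * exp (- x)) * sin y ^ 2)%R by ring.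
  rewrite <- exp_plus, Rplus_opp_r, exp_0, <- !Rsqr_pow2, sin2_cos2, !Rsqr_pow2.
  pose proof (Rsqr_exp_sub_ge x) as H1.
  assert (H2 : ((y / 3) ^ 2 <= sin y ^ 2)%R).
  { destruct (Rle_dec 0 y) as [H0|H0].
    - rewrite Rabs_right in Hy by lra. apply pow_incr. split; [lra|].
      apply sin_lower_bound. lra.
    - rewrite Rabs_left in Hy by lra.
      replace ((y / 3) ^ 2)%R with ((- y / 3) ^ 2)%R by field.
      replace (sin y ^ 2)%R with (sin (- y) ^ 2)%R by (rewrite sin_neg; ring).
      apply pow_incr. split; [lra|]. apply sin_lower_bound. lra. }
  nra.
Qed.

(** The bound has to be uniform on the whole strip |Re a| <= 1/2, which contains exactly one period
    and is unbounded; an expansion at 0 alone does not suffice. *)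
Lemma csc2_near_0 : exists K : R, forall a : C, a <> 0 -> ~ is_int a ->
  (Rabs (Re a) <= / 2)%R -> (Cmod (csc2 a - / a ^ 2) <= K)%R.
Proof.
  pose proof PI_RGT_0 as Hpi.
  exists (4 * PI ^ 2 * 100)%R. intros a Ha0 Ha Hr.
  set (v := Ci * PI * a).
  assert (Hv0 : v <> 0).
  { repeat apply Cmult_neq_0; auto using Ci_nz, PI_C_neq_0. }
  assert (Hv : (0 < Cmod v)%R) by (apply Cmod_gt_0; auto).
  assert (HI : (Rabs (Im v) <= PI / 2)%R).
  { replace (Im v) with (PI * Re a)%R by (unfold v; destruct a; simpl; ring).
    rewrite Rabs_mult, Rabs_right by lra. nra. }
  pose proof (Csh_lower_bound v HI) as Hsh.
  assert (Hs0 : Csh v <> 0) by (apply Cmod_gt_0; lra).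
  rewrite csc2_Csh; auto. fold v.
  assert (E : - (4) * PI ^ 2 / Csh v ^ 2 - / a ^ 2 =
    - (4) * PI ^ 2 * ((2 * v - Csh v) * (2 * v + Csh v) / (4 * v ^ 2 * Csh v ^ 2))).
  { transitivity (- (4) * PI ^ 2 / Csh v ^ 2 + PI ^ 2 / v ^ 2).
    - unfold Cminus. f_equal. unfold v.
      replace ((Ci * PI * a) ^ 2) with (Ci ^ 2 * (PI ^ 2 * a ^ 2)) by ring.
      rewrite Ci_sqr. field. split; auto using PI_C_neq_0.
    - field. auto. }
  rewrite E, Cmod_mult.
  assert (Em : Cmod (- (4) * PI ^ 2) = (4 * PI ^ 2)%R).
  { rewrite <- RtoC_pow, <- RtoC_opp, <- RtoC_mult, Cmod_R, Rabs_left by nra. ring. }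
  rewrite Em. apply Rmult_le_compat_l; [nra|].
  assert (Hd : 4 * v ^ 2 * Csh v ^ 2 <> 0).
  { apply Cmult_neq_0; [apply Cmult_neq_0|]; auto using Cpow_nz.
    intros E0. apply RtoC_inj in E0. lra. }
  rewrite Cmod_div; auto. rewrite !Cmod_mult, !Cmod_pow, Cmod_R, Rabs_right by lra.
  set (s := Cmod (Csh v)) in *. set (n := Cmod v) in *.
  apply Rle_div_l.
  { repeat apply Rmult_lt_0_compat; try apply pow_lt; lra. }
  assert (H2v : Cmod (2 * v) = (2 * n)%R)
    by (rewrite Cmod_mult, Cmod_R, Rabs_right by lra; reflexivity).
  (* Near 0 the factor 2 v - Csh v is of third order; for |v| > 1 the lower bound of [Csh] makes the
     numerator at most 25 |Csh v|^2. *)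
  destruct (Rle_dec n 1) as [Hn|Hn].
  - pose proof (Csh_third_order v Hn) as H3. fold n in H3.
    assert (H4 : (Cmod (2 * v - Csh v) <= 6 * n ^ 3)%R) by (rewrite Cmod_sub_sym; auto).
    assert (H5 : (Cmod (2 * v + Csh v) <= 10 * n)%R).
    { replace (2 * v + Csh v) with (4 * v + (Csh v - 2 * v)) by ring.
      eapply Rle_trans; [apply Cmod_triangle|].
      rewrite Cmod_mult, Cmod_R, Rabs_right by lra. fold n.
      assert (n ^ 3 <= n)%R.
      { simpl. rewrite Rmult_1_r. assert (n * n <= 1)%R by nra. nra. } lra. }
    apply Rle_trans with (6 * n ^ 3 * (10 * n))%R.
    + apply Rmult_le_compat; auto using Cmod_ge_0.
    + assert ((n / 2) ^ 2 <= s ^ 2)%R by (apply pow_incr; lra).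
      assert (0 < n ^ 2)%R by nra.
      assert (n ^ 2 * (n / 2) ^ 2 <= n ^ 2 * s ^ 2)%R by (apply Rmult_le_compat_l; lra).
      replace (n ^ 2 * (n / 2) ^ 2)%R with (n ^ 4 / 4)%R in * by field.
      assert (0 < n ^ 4)%R by (apply pow_lt; lra). lra.
  - assert (H4 : (Cmod (2 * v - Csh v) <= 2 * n + s)%R).
    { eapply Rle_trans; [apply Cmod_triangle|]. rewrite Cmod_opp, H2v. unfold s. lra. }
    assert (H5 : (Cmod (2 * v + Csh v) <= 2 * n + s)%R).
    { eapply Rle_trans; [apply Cmod_triangle|]. rewrite H2v. unfold s. lra. }
    apply Rle_trans with ((2 * n + s) * (2 * n + s))%R.
    + apply Rmult_le_compat; auto using Cmod_ge_0.
    + assert (H6 : (2 * n + s <= 5 * s)%R) by lra.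
      assert ((2 * n + s) * (2 * n + s) <= 5 * s * (5 * s))%R by (apply Rmult_le_compat; lra).
      assert (1 <= n ^ 2)%R by nra. assert (0 < s ^ 2)%R by nra. nra.
Qed.

Lemma Z_nearest (x : R) : exists n : Z, (Rabs (x - IZR n) <= / 2)%R.
Proof.
  exists (up (x - / 2)). destruct (archimed (x - / 2)) as [H1 H2].
  apply Rabs_le. lra.
Qed.

Lemma psum_near_0 : exists K : R, forall a : C, (Rabs (Re a) <= / 2)%R ->
  (Cmod (psum 2 a - / a ^ 2) <= K)%R.
Proof.
  destruct (summable_scal 16 wt ltac:(lra) summable_wt) as [_ [M HM]].
  exists M. intros a Ha.
  assert (H : is_usum (fun m : Z => / (a + IZR m) ^ 2 -
    (if Z.eq_dec m 0 then / (a + IZR m) ^ 2 else 0)) (psum 2 a - / a ^ 2)).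
  { apply is_usum_minus; [apply is_usum_psum; lia|].
    apply (is_usum_eq _ ((fun m : Z => if Z.eq_dec m 0 then / (a + IZR m) ^ 2 else 0) 0%Z)).
    - apply (is_usum_single (fun m : Z => if Z.eq_dec m 0 then / (a + IZR m) ^ 2 else 0)).
      intros x Hx. destruct (Z.eq_dec x 0); congruence.
    - simpl. rewrite Cplus_0_r. reflexivity. }
  apply (is_usum_Cmod_le _ _ (fun m => 16 * wt m)%R M H); auto.
  intros m. destruct (Z.eq_dec m 0) as [->|Hm].
  - replace (/ (a + 0) ^ 2 - / (a + 0) ^ 2) with (RtoC 0) by ring. rewrite Cmod_0.
    pose proof (proj1 summable_wt 0%Z). lra.
  - assert (H1 : (1 <= IZR (Z.abs m))%R) by (apply IZR_le; lia).
    (* Only the real part of a is bounded, so the estimate goes through Re (a + m): |m| - 1/2 >= (1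
       + |m|) / 4 for |m| >= 1. *)
    assert (H2 : ((1 + IZR (Z.abs m)) / 4 <= Cmod (a + IZR m))%R).
    { eapply Rle_trans; [|apply re_le_Cmod].
      replace (Re (a + IZR m)) with (IZR m - - Re a)%R by (destruct a; simpl; ring).
      eapply Rle_trans; [|apply Rabs_triang_inv]. rewrite <- abs_IZR, Rabs_Ropp. lra. }
    unfold Cminus. rewrite Copp_0, Cplus_0_r.
    eapply Rle_trans; [apply (Cmod_pow_inv_le _ ((1 + IZR (Z.abs m)) / 4)); lra|].
    pose proof (wt_ge_sqr m).
    replace (/ ((1 + IZR (Z.abs m)) / 4) ^ 2)%R with (16 * / (1 + IZR (Z.abs m)) ^ 2)%R
      by (field; lra). lra.
Qed.

(* The difference [h] of the two sides is bounded and satisfies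
   [4 h(2a) = h(a) + h(a + 1/2)]: a bound for [h] can be halved. *)
Lemma csc2_psum (a : C) : ~ is_int a -> csc2 a = psum 2 a.
Proof.
  destruct csc2_near_0 as [K1 H1]. destruct psum_near_0 as [K2 H2].
  set (h := fun a => csc2 a - psum 2 a).
  assert (B0 : forall a, ~ is_int a -> (Cmod (h a) <= K1 + K2)%R).
  { intros b Hb. destruct (Z_nearest (Re b)) as [n Hn].
    replace (h b) with (h (b + IZR (- n))).
    - assert (Hb' : ~ is_int (b + IZR (- n))) by (rewrite is_int_plus; auto).
      set (c := b + IZR (- n)) in *.
      assert (Hc : (Rabs (Re c) <= / 2)%R).
      { unfold c. replace (Re (b + IZR (- n))) with (Re b - IZR n)%R; auto.
        rewrite opp_IZR. destruct b. simpl. ring. }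
      unfold h. replace (csc2 c - psum 2 c) with
        ((csc2 c - / c ^ 2) + - (psum 2 c - / c ^ 2)) by ring.
      eapply Rle_trans; [apply Cmod_triangle|]. rewrite Cmod_opp.
      apply Rplus_le_compat; auto. apply H1; auto.
      intros E. apply Hb'. exists 0%Z. auto.
    - unfold h. rewrite csc2_shift, psum_shift; auto. }
  assert (B : forall n a, ~ is_int a -> (Cmod (h a) <= (K1 + K2) / 2 ^ n)%R).
  { induction n as [|n IH]; intros b Hb.
    - simpl. rewrite Rdiv_1_r. auto.
    - assert (E2 : 2 * (b / 2) = b) by field.
      assert (Hb1 : ~ is_int (b / 2)).
      { intros [m Hm]. apply Hb. exists (2 * m)%Z. rewrite <- E2, Hm, mult_IZR, RtoC_mult. auto. }
      assert (Hb2 : ~ is_int (b / 2 + / 2)).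
      { intros [m Hm]. apply Hb. exists (2 * m - 1)%Z.
        rewrite minus_IZR, mult_IZR, RtoC_minus, RtoC_mult, <- Hm, <- E2. field. }
      pose proof (csc2_double _ Hb1 Hb2) as D1. pose proof (psum_double 2 (b / 2) (le_n _)) as D2.
      rewrite E2 in D1, D2.
      assert (Eh : h b = / 4 * (h (b / 2) + h (b / 2 + / 2))).
      { unfold h. replace (csc2 b) with (/ 4 * (4 * csc2 b)) by field.
        replace (psum 2 b) with (/ 4 * (2 ^ 2 * psum 2 b)) by field.
        rewrite D1, D2. ring. }
      rewrite Eh, Cmod_mult, <- RtoC_inv, Cmod_R, Rabs_right by lra.
      pose proof (Cmod_triangle (h (b / 2)) (h (b / 2 + / 2))).
      pose proof (IH _ Hb1). pose proof (IH _ Hb2).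
      replace ((K1 + K2) / 2 ^ S n)%R with ((K1 + K2) / 2 ^ n / 2)%R
        by (simpl; field; apply pow_nonzero; lra). lra. }
  intros Ha. apply Cmod_eq_of_small. intros eps. fold (h a).
  destruct (pow_lt_1_zero (/ 2) ltac:(rewrite Rabs_right; lra)
    (eps / (Rabs (K1 + K2) + 1))) as [N HN].
  { apply Rdiv_lt_0_compat; [apply cond_pos|]. pose proof (Rabs_pos (K1 + K2)). lra. }
  specialize (HN N (le_n _)). eapply Rle_lt_trans; [apply (B N a Ha)|].
  assert (Hp : (0 < (/ 2) ^ N)%R) by (apply pow_lt; lra).
  rewrite Rabs_right in HN by lra. pose proof (Rabs_pos (K1 + K2)).
  apply Rlt_div_r in HN; [|lra].
  unfold Rdiv. rewrite <- pow_inv. pose proof (Rle_abs (K1 + K2)).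
  assert ((K1 + K2) * (/ 2) ^ N <= Rabs (K1 + K2) * (/ 2) ^ N)%R
    by (apply Rmult_le_compat_r; lra). lra.
Qed.

Lemma Cmod_lt_of_close (x y : C) (r : R) : (Cmod (y - x) < r)%R -> (Cmod y < Cmod x + r)%R.
Proof.
  intros H. replace y with (x + (y - x)) by ring.
  eapply Rle_lt_trans; [apply Cmod_triangle|]. lra.
Qed.

Lemma ccont_neq (f : C -> C) (x c : C) : ccont f x -> f x <> c ->
  exists r : posreal, forall y, (Cmod (y - x) < r)%R -> f y <> c.
Proof.
  intros Hf Hc. apply Cminus_eq_contra, Cmod_gt_0 in Hc.
  destruct (Hf (mkposreal _ Hc)) as [r Hr]. exists r. intros y Hy E.
  specialize (Hr y Hy). simpl in Hr. rewrite E, Cmod_sub_sym in Hr. lra.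
Qed.

Lemma is_int_open (a : C) : ~ is_int a ->
  exists r : posreal, forall y, (Cmod (y - a) < r)%R -> ~ is_int y.
Proof.
  intros Ha. destruct (ccont_neq qexp a 1) as [r Hr].
  - apply (is_cder_ccont _ _ _ (is_cder_qexp a)).
  - intros E. apply Ha, qexp_eq_1, E.
  - exists r. intros y Hy [n Hn]. apply (Hr y Hy). rewrite Hn. apply qexp_int.
Qed.

Lemma is_cder_inv_pow (x : C) (k : nat) : x <> 0 ->
  is_cder (fun y => / y ^ k) x (- INR k * / x ^ S k).
Proof.
  intros Hx. induction k as [|k IH].
  - apply (is_cder_eq _ _ 0); [|simpl; ring]. exact (is_cder_const (/ 1) x).
  - apply (is_cder_eq _ _ (- / (x * x) * / x ^ k + / x * (- INR k * / x ^ S k))).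
    + apply (is_cder_ext (fun y => / y * / y ^ k)).
      { intros y. rewrite !Cinv_pow. reflexivity. }
      apply (is_cder_mult Cinv (fun y => / y ^ k)); auto. apply is_cder_inv. auto.
    + rewrite S_INR, RtoC_plus. simpl. pose proof (Cpow_nz x k Hx). field. auto.
Qed.

Lemma is_cder_shift (f : C -> C) (x c l : C) :
  is_cder f (x + c) l -> is_cder (fun y => f (y + c)) x l.
Proof.
  intros H. apply (is_cder_eq _ _ (l * (1 + 0))); [|ring].
  apply (is_cder_comp f (fun y => y + c)); auto.
  apply is_cder_plus; [apply is_cder_id | apply is_cder_const].
Qed.

Lemma add_int_neq_0 (a : C) (m : Z) : ~ is_int a -> a + IZR m <> 0.
Proof.
  intros H E. apply H. exists (- m)%Z. rewrite opp_IZR, RtoC_opp.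
  replace a with (a + IZR m - IZR m) by ring. rewrite E. ring.
Qed.

Lemma is_cder_psum (k : nat) (a : C) : (2 <= k)%nat -> ~ is_int a ->
  is_cder (psum k) a (- INR k * psum (S k) a).
Proof.
  intros Hk Ha. destruct (Z_bounded_list (2 * (Cmod a + 1) + 1)) as [A HA].
  apply (is_usum_is_cder (fun m y => / (y + IZR m) ^ k)
    (fun m y => - INR k * / (y + IZR m) ^ S k) _ _ _ (mkposreal 1 Rlt_0_1) A
    (fun m => INR k * (2 ^ S k * wt m))%R).
  - intros m. apply (is_cder_shift (fun y => / y ^ k)), is_cder_inv_pow, add_int_neq_0. auto.
  - intros m y Hm Hy. simpl in Hy. apply Cmod_lt_of_close in Hy.
    assert (Hge : ((1 + IZR (Z.abs m)) / 2 <= Cmod (y + IZR m))%R).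
    { apply Cmod_add_int_ge. specialize (HA m Hm). lra. }
    pose proof (wt_base m). split.
    + apply (is_cder_shift (fun y => / y ^ k)), is_cder_inv_pow, Cmod_neq_0. lra.
    + rewrite Cmod_mult, Cmod_opp, Cmod_R, Rabs_right by (apply Rle_ge, pos_INR).
      apply Rmult_le_compat_l; [apply pos_INR|].
      eapply Rle_trans; [|apply inv_pow_wt; lia]. apply Cmod_pow_inv_le; lra.
  - apply summable_scal; [apply pos_INR|]. apply summable_scal; [apply pow_le; lra|].
    apply summable_wt.
  - intros y _. apply is_usum_psum. auto.
  - apply is_usum_scal, is_usum_psum. lia.
Qed.

Lemma csc2'_psum (a : C) : ~ is_int a -> csc2' a = - (2) * psum 3 a.
Proof.
  intros Ha. destruct (is_int_open a Ha) as [r Hr].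
  apply (is_cder_unique csc2 a); [apply is_cder_csc2; auto|].
  apply (is_cder_ext_loc (psum 2) csc2 a _ r).
  - intros y Hy. symmetry. apply csc2_psum. auto.
  - apply (is_cder_psum 2); auto.
Qed.

Lemma csc2''_psum (a : C) : ~ is_int a -> csc2'' a = 6 * psum 4 a.
Proof.
  intros Ha. destruct (is_int_open a Ha) as [r Hr].
  apply (is_cder_unique csc2' a); [apply is_cder_csc2'; auto|].
  apply (is_cder_ext_loc (fun y => - (2) * psum 3 y) csc2' a _ r).
  - intros y Hy. symmetry. apply csc2'_psum. auto.
  - apply (is_cder_eq _ _ (- (2) * (- INR 3 * psum 4 a))).
    + apply is_cder_scal, is_cder_psum; auto.
    + replace (INR 3) with 3%R by (simpl; ring). ring.
Qed.

(** * Sums of inverse powers of the nonzero integers *)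

Lemma half_not_int : ~ is_int (/ 2).
Proof.
  intros [n Hn]. rewrite <- RtoC_inv in Hn by lra. apply RtoC_inj in Hn.
  assert (H : IZR (2 * n) = 1%R) by (rewrite mult_IZR, <- Hn; field).
  apply eq_IZR in H. lia.
Qed.

Lemma csc2_half : csc2 (/ 2) = PI ^ 2.
Proof.
  assert (E : qexp (/ 2) = - (1)).
  { unfold qexp. rewrite qexp_arg, <- RtoC_inv by lra. unfold Cexp, Re, Im. simpl fst. simpl snd.
    replace (- (2 * PI * 0))%R with 0%R by ring. replace (2 * PI * / 2)%R with PI by field.
    rewrite exp_0, cos_PI, sin_PI. apply injective_projections; simpl; ring. }
  unfold csc2. rewrite E. field.
Qed.

(* As [/ 0 = 0], these are sums over the nonzero integers. *)
Lemma psum_2_0 : psum 2 0 = PI ^ 2 / 3.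
Proof.
  pose proof (psum_double 2 0 (le_n _)) as D.
  replace (2 * 0) with (RtoC 0) in D by ring. replace (0 + / 2) with (/ 2) in D by ring.
  rewrite <- (csc2_psum _ half_not_int), csc2_half in D.
  replace (psum 2 0) with ((2 ^ 2 * psum 2 0 - psum 2 0) / 3) by field.
  rewrite D. field.
Qed.

Lemma psum_4_0 : psum 4 0 = PI ^ 4 / 45.
Proof.
  pose proof (psum_double 4 0 ltac:(lia)) as D.
  replace (2 * 0) with (RtoC 0) in D by ring. replace (0 + / 2) with (/ 2) in D by ring.
  pose proof (csc2''_psum _ half_not_int) as E. unfold csc2'' in E. rewrite csc2_half in E.
  replace (psum 4 (/ 2)) with ((6 * psum 4 (/ 2)) / 6) in D by field. rewrite <- E in D.
  replace (psum 4 0) with ((2 ^ 4 * psum 4 0 - psum 4 0) / 15) by field.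
  rewrite D. field.
Qed.

(** * Partial fractions of the cotangent *)

Lemma inv_sub_inv_int (a : C) (m : Z) : (2 * Cmod a + 1 <= IZR (Z.abs m))%R ->
  (Cmod (/ (a + IZR m) - / IZR m) <= Cmod a * (4 * wt m))%R.
Proof.
  intros Hm. pose proof (Cmod_add_int_ge a m Hm) as H1. pose proof (Cmod_ge_0 a) as H0.
  pose proof (wt_base m) as Hb.
  assert (H2 : ((1 + IZR (Z.abs m)) / 2 <= Cmod (IZR m))%R) by (rewrite Cmod_IZR; lra).
  assert (N1 : a + IZR m <> 0) by (apply Cmod_neq_0; lra).
  assert (N2 : RtoC (IZR m) <> 0) by (apply Cmod_neq_0; lra).
  replace (/ (a + IZR m) - / IZR m) with (- a * (/ (a + IZR m) * / IZR m)) by (field; auto).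
  rewrite !Cmod_mult, Cmod_opp. apply Rmult_le_compat_l; auto.
  apply Rle_trans with (/ ((1 + IZR (Z.abs m)) / 2) * / ((1 + IZR (Z.abs m)) / 2))%R.
  - apply Rmult_le_compat; try apply Cmod_ge_0; apply Cmod_inv_le; lra.
  - pose proof (inv_pow_wt m 2 (le_n _)) as Hw. rewrite <- Rinv_mult.
    simpl in Hw. rewrite !Rmult_1_r in Hw. lra.
Qed.

Lemma summable_inv_sub_inv_int (a : C) :
  summable (fun m : Z => Cmod (/ (a + IZR m) - / IZR m)).
Proof.
  destruct (Z_bounded_list (2 * Cmod a + 1)) as [A HA].
  apply (summable_le_except _ (fun m => Cmod a * (4 * wt m))%R A).
  - intros m. apply Cmod_ge_0.
  - intros m Hm. apply inv_sub_inv_int. auto.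
  - apply summable_scal; [apply Cmod_ge_0|]. apply summable_scal; [lra | apply summable_wt].
Qed.

(** The counterterm - 1/m makes the series absolutely convergent; at m = 0 it is 0, as [/ 0 = 0]. *)
Definition psum1 (a : C) : C := usum (fun m : Z => / (a + IZR m) - / IZR m).

Lemma is_usum_psum1 (a : C) : is_usum (fun m : Z => / (a + IZR m) - / IZR m) (psum1 a).
Proof. apply usum_correct, summable_inv_sub_inv_int. Qed.

Lemma Cinv_opp (x : C) : / (- x) = - / x.
Proof.
  destruct (classic (x = 0)) as [->|Hx].
  - replace (- (0)) with (RtoC 0) by ring. rewrite Cinv_0. ring.
  - field. auto.
Qed.

Lemma is_usum_Z_opp (F : Z -> C) (s : C) : is_usum (fun n => F (- n)%Z) s <-> is_usum F s.
Proof. apply (is_usum_bij Z.opp Z.opp); intros; lia. Qed.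

Lemma psum1_opp (a : C) : psum1 (- a) = - psum1 a.
Proof.
  apply usum_unique. apply (is_usum_Z_opp (fun m : Z => / (- a + IZR m) - / IZR m)).
  apply (is_usum_ext (fun m : Z => - (1) * (/ (a + IZR m) - / IZR m))).
  - intros m. rewrite opp_IZR, RtoC_opp.
    replace (- a + - IZR m) with (- (a + IZR m)) by ring. rewrite !Cinv_opp. ring.
  - apply (is_usum_eq _ (- (1) * psum1 a)); [|ring]. apply is_usum_scal, is_usum_psum1.
Qed.

Lemma is_cder_psum1 (a : C) : ~ is_int a -> is_cder psum1 a (- psum 2 a).
Proof.
  intros Ha. destruct (Z_bounded_list (2 * (Cmod a + 1) + 1)) as [A HA].
  assert (D : forall y m, y + IZR m <> 0 ->
    is_cder (fun y => / (y + IZR m) - / IZR m) y (- (1) * / (y + IZR m) ^ 2)).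
  { intros y m H. apply (is_cder_eq _ _ (- / ((y + IZR m) * (y + IZR m)) - 0)); [|field; auto].
    apply is_cder_minus; [|apply is_cder_const].
    apply (is_cder_shift Cinv), is_cder_inv. auto. }
  apply (is_usum_is_cder (fun m y => / (y + IZR m) - / IZR m)
    (fun m y => - (1) * / (y + IZR m) ^ 2) _ _ _ (mkposreal 1 Rlt_0_1) A
    (fun m => 2 ^ 2 * wt m)%R).
  - intros m. apply D, add_int_neq_0. auto.
  - intros m y Hm Hy. simpl in Hy. apply Cmod_lt_of_close in Hy.
    assert (Hge : ((1 + IZR (Z.abs m)) / 2 <= Cmod (y + IZR m))%R).
    { apply Cmod_add_int_ge. specialize (HA m Hm). lra. }
    pose proof (wt_base m). split.
    + apply D, Cmod_neq_0. lra.
    + rewrite Cmod_mult, Cmod_opp, Cmod_1, Rmult_1_l.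
      eapply Rle_trans; [|apply inv_pow_wt; lia]. apply Cmod_pow_inv_le; lra.
  - apply summable_scal; [lra | apply summable_wt].
  - intros y _. apply is_usum_psum1.
  - apply (is_usum_eq _ (- (1) * psum 2 a)); [|ring]. apply is_usum_scal, is_usum_psum. lia.
Qed.

(* The difference is odd and locally constant off the integers. *)
Lemma cotp_psum1 (a : C) : ~ is_int a -> cotp a = psum1 a.
Proof.
  set (g := fun a => cotp a - psum1 a).
  assert (Hseg : forall a b, (forall t : R, (0 <= t <= 1)%R -> ~ is_int (a + t * (b - a))) ->
    g b = g a).
  { intros b c H. apply Ceq_minus, Cmod_eq_0. apply Rle_antisym; [|apply Cmod_ge_0].
    replace 0%R with (0 * Cmod (c - b))%R by ring.
    apply (is_cder_mean_value g (fun _ => 0)). intros t Ht. specialize (H t Ht). split.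
    - apply (is_cder_eq _ _ (- csc2 (b + t * (c - b)) - - psum 2 (b + t * (c - b)))).
      + apply is_cder_minus; [apply is_cder_cotp | apply is_cder_psum1]; auto.
      + rewrite csc2_psum; auto. ring.
    - rewrite Cmod_0. lra. }
  assert (Him : forall x : C, Im x <> 0%R -> ~ is_int x).
  { intros x Hx [n Hn]. apply Hx. rewrite Hn. reflexivity. }
  assert (Hhalf : forall a, Im a <> 0%R -> g a = g (/ 2)).
  { intros b Hb. apply Hseg. intros t Ht.
    destruct (Req_dec t 0) as [->|Ht0].
    - replace (/ 2 + 0 * (b - / 2)) with (/ 2) by ring. apply half_not_int.
    - apply Him. rewrite <- RtoC_inv by lra. destruct b as [x y]. simpl in *.
      intros E. assert (t * y = 0)%R by lra. apply Rmult_integral in H. tauto. }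
  assert (Hg0 : forall a, Im a <> 0%R -> g a = 0).
  { intros b Hb. assert (Hb' : Im (- b) <> 0%R) by (destruct b; simpl in *; lra).
    assert (E1 : g (- b) = - g b) by (unfold g; rewrite cotp_opp, psum1_opp; ring).
    rewrite (Hhalf _ Hb'), <- (Hhalf _ Hb) in E1.
    replace (g b) with ((g b + g b) / 2) by field. rewrite E1 at 2. field. }
  intros Ha. apply Ceq_minus. fold (g a). destruct (Req_dec (Im a) 0) as [H0|H0]; auto.
  transitivity (g Ci); [|apply Hg0; simpl; lra]. apply Hseg. intros t Ht.
  destruct (Req_dec t 1) as [->|Ht1].
  - replace (Ci + 1 * (a - Ci)) with a by ring. auto.
  - apply Him. destruct a as [x y]. simpl in *. subst y. lra.
Qed.

(** * Sums over the multiples of tau *)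

(** The constant is 4^4: exp(-2 pi y) <= exp(-y) = exp(y/4)^(-4) <= (4/y)^4. The fourth power is
    what survives a factor n in the term and still leaves an inverse cube. *)
Lemma exp_decay (y : R) : (0 < y)%R -> (exp (- (2 * PI * y)) <= 256 / y ^ 4)%R.
Proof.
  intros Hy. pose proof PI2_3_2 as Hpi.
  assert (H1 : (y / 4 <= exp (y / 4))%R) by (pose proof (exp_ineq1_le (y / 4)); lra).
  assert (H2 : ((y / 4) ^ 4 <= exp y)%R).
  { replace (exp y) with (exp (y / 4) ^ 4)%R.
    - apply pow_incr. lra.
    - simpl. rewrite Rmult_1_r, <- !exp_plus. f_equal. field. }
  assert (H3 : (0 < (y / 4) ^ 4)%R) by (apply pow_lt; lra).
  apply Rle_trans with (exp (- y)).
  - destruct (Rle_lt_or_eq_dec (- (2 * PI * y)) (- y) ltac:(nra)) as [H|H].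
    + apply Rlt_le, exp_increasing. auto.
    + rewrite H. lra.
  - rewrite exp_Ropp. apply Rle_trans with (/ ((y / 4) ^ 4))%R.
    + apply Rinv_le_contravar; auto.
    + right. field. lra.
Qed.

Lemma exp_decay_half (y : R) : (1 <= y)%R -> (exp (- (2 * PI * y)) <= / 2)%R.
Proof.
  intros Hy. pose proof PI2_3_2 as Hpi. rewrite exp_Ropp. apply Rinv_le_contravar; [lra|].
  pose proof (exp_ineq1_le (2 * PI * y)). nra.
Qed.

Lemma Cmod_qexp_sub_1 (a : C) : (1 <= Im a)%R -> (/ 2 <= Cmod (qexp a - 1))%R.
Proof.
  intros Ha. pose proof (Cmod_triangle (1 - qexp a) (qexp a)) as H.
  replace (1 - qexp a + qexp a) with (RtoC 1) in H by ring.
  rewrite Cmod_1, Cmod_sub_sym, Cmod_qexp in H. pose proof (exp_decay_half _ Ha). lra.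
Qed.

Lemma Im_opp (a : C) : Im (- a) = (- Im a)%R.
Proof. destruct a. reflexivity. Qed.

(* Sufficient decay to be summed over the points [z + n * tau], even with an
   additional factor n. *)
Definition decays (f : C -> C) : Prop := exists K : R, forall a : C,
  (1 <= Rabs (Im a))%R -> (Cmod (f a) <= K / Rabs (Im a) ^ 4)%R.

Definition bounded_off (g : C -> C) : Prop := exists K : R, forall a : C,
  (1 <= Rabs (Im a))%R -> (Cmod (g a) <= K)%R.

Lemma decays_bounded_off (f : C -> C) : decays f -> bounded_off f.
Proof.
  intros [K HK]. exists K. intros a Ha. eapply Rle_trans; [apply HK; auto|].
  assert (H1 : (1 <= Rabs (Im a) ^ 4)%R) by (apply pow_R1_Rle; auto).
  assert (H0 : (0 <= K)%R).
  { pose proof (HK a Ha) as H. pose proof (Cmod_ge_0 (f a)).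
    apply Rnot_lt_le. intros Hn.
    assert (K / Rabs (Im a) ^ 4 < 0)%R by (apply Rdiv_neg_pos; lra). lra. }
  apply Rle_div_l; [lra|]. nra.
Qed.

Lemma decays_mult (g f : C -> C) : bounded_off g -> decays f -> decays (fun a => g a * f a).
Proof.
  intros [M HM] [K HK]. exists (M * K)%R. intros a Ha. rewrite Cmod_mult.
  unfold Rdiv. rewrite Rmult_assoc.
  apply Rmult_le_compat; auto using Cmod_ge_0.
Qed.

Lemma bounded_off_const (c : C) : bounded_off (fun _ => c).
Proof. exists (Cmod c). intros. lra. Qed.

Lemma bounded_off_plus (f g : C -> C) :
  bounded_off f -> bounded_off g -> bounded_off (fun a => f a + g a).
Proof.
  intros [K HK] [M HM]. exists (K + M)%R. intros a Ha.
  eapply Rle_trans; [apply Cmod_triangle|]. apply Rplus_le_compat; auto.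
Qed.

Lemma bounded_off_mult (f g : C -> C) :
  bounded_off f -> bounded_off g -> bounded_off (fun a => f a * g a).
Proof.
  intros [K HK] [M HM]. exists (K * M)%R. intros a Ha. rewrite Cmod_mult.
  apply Rmult_le_compat; auto using Cmod_ge_0.
Qed.

Lemma decays_csc2 : decays csc2.
Proof.
  exists (4 * PI ^ 2 * (256 * 4))%R. intros a Ha.
  assert (P : forall a, (1 <= Im a)%R -> (Cmod (csc2 a) <= 4 * PI ^ 2 * (256 * 4) / Im a ^ 4)%R).
  { clear a Ha. intros a Ha. pose proof (Cmod_qexp_sub_1 a Ha) as H1.
    unfold csc2, Cdiv. rewrite !Cmod_mult, Cmod_opp, Cmod_pow, !Cmod_R, Cmod_qexp.
    rewrite !Rabs_right by (pose proof PI_RGT_0; lra).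
    unfold Rdiv. rewrite !Rmult_assoc.
    apply Rmult_le_compat_l; [lra|]. apply Rmult_le_compat_l; [apply pow2_ge_0|].
    replace (256 * (4 * / Im a ^ 4))%R with (256 / Im a ^ 4 * 4)%R by (field; lra).
    apply Rmult_le_compat; [apply Rlt_le, exp_pos | apply Cmod_ge_0 | |].
    - rewrite <- Rmult_assoc. apply exp_decay. lra.
    - eapply Rle_trans; [apply (Cmod_pow_inv_le _ (/ 2)); auto; lra|]. lra. }
  destruct (Rle_dec 0 (Im a)) as [H|H].
  - rewrite Rabs_right in * by lra. auto.
  - rewrite Rabs_left in * by lra. rewrite <- csc2_opp, <- Im_opp. apply P.
    rewrite Im_opp. auto.
Qed.

(** When Im a grows, [qexp a] tends to 0 and [cotp a] to -pi i; the limit at the opposite end is pi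
    i. This fixes the sign of the counterterms in [cotr]. *)
Lemma cotp_near_infinity (a : C) : (1 <= Im a)%R ->
  (Cmod (cotp a + PI * Ci) <= 4 * PI * 256 / Im a ^ 4)%R.
Proof.
  intros Ha. pose proof (Cmod_qexp_sub_1 a Ha) as H1. pose proof PI_RGT_0.
  assert (H0 : qexp a - 1 <> 0) by (apply Cmod_neq_0; lra).
  replace (cotp a + PI * Ci) with (2 * PI * Ci * (qexp a * / (qexp a - 1)))
    by (unfold cotp; field; auto).
  rewrite !Cmod_mult, !Cmod_R, Cmod_Ci, Cmod_qexp, !Rabs_right by lra.
  replace (4 * PI * 256 / Im a ^ 4)%R with (2 * PI * 1 * (256 / Im a ^ 4 * / / 2))%R
    by (field; lra).
  apply Rmult_le_compat_l; [lra|].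
  apply Rmult_le_compat; [apply Rlt_le, exp_pos | apply Cmod_ge_0 | |].
  - apply exp_decay. lra.
  - apply Cmod_inv_le; lra.
Qed.

Lemma cotp_near_infinity_opp (a : C) : (Im a <= -1)%R ->
  (Cmod (cotp a - PI * Ci) <= 4 * PI * 256 / (- Im a) ^ 4)%R.
Proof.
  intros Ha. rewrite <- Im_opp.
  replace (cotp a - PI * Ci) with (- (cotp (- a) + PI * Ci)) by (rewrite cotp_opp; ring).
  rewrite Cmod_opp. apply cotp_near_infinity. rewrite Im_opp. lra.
Qed.

Lemma bounded_off_cotp : bounded_off cotp.
Proof.
  exists (4 * PI * 256 + PI)%R. intros a Ha. pose proof PI_RGT_0.
  assert (HC : Cmod (PI * Ci) = PI).
  { rewrite Cmod_mult, Cmod_R, Cmod_Ci, Rabs_right; lra. }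
  assert (P : forall y, (1 <= y)%R -> (4 * PI * 256 / y ^ 4 <= 4 * PI * 256)%R).
  { intros y Hy. assert (1 <= y ^ 4)%R by (apply pow_R1_Rle; auto).
    apply Rle_div_l; [lra|]. nra. }
  destruct (Rle_dec 0 (Im a)) as [Hi|Hi].
  - rewrite Rabs_right in Ha by lra. pose proof (cotp_near_infinity a Ha). pose proof (P _ Ha).
    replace (cotp a) with ((cotp a + PI * Ci) + - (PI * Ci)) by ring.
    eapply Rle_trans; [apply Cmod_triangle|]. rewrite Cmod_opp, HC. lra.
  - rewrite Rabs_left in Ha by lra. pose proof (P _ Ha).
    pose proof (cotp_near_infinity_opp a ltac:(lra)).
    replace (cotp a) with ((cotp a - PI * Ci) + (PI * Ci)) by ring.
    eapply Rle_trans; [apply Cmod_triangle|]. rewrite HC. lra.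
Qed.

Lemma decays_ext (f g : C -> C) : (forall a, f a = g a) -> decays f -> decays g.
Proof. intros H [K HK]. exists K. intros a Ha. rewrite <- H. auto. Qed.

Lemma decays_csc2' : decays csc2'.
Proof.
  apply (decays_ext (fun a => (- (2) * cotp a) * csc2 a)); [reflexivity|].
  apply decays_mult; [|apply decays_csc2].
  apply (bounded_off_mult (fun _ => - (2))); [apply bounded_off_const | apply bounded_off_cotp].
Qed.

Lemma decays_csc2'' : decays csc2''.
Proof.
  apply (decays_ext (fun a => (6 * csc2 a + - (4) * PI ^ 2) * csc2 a)).
  { intros a. unfold csc2''. ring. }
  apply decays_mult; [|apply decays_csc2].
  apply (bounded_off_plus (fun a => 6 * csc2 a) (fun _ => - (4) * PI ^ 2));
    [|apply bounded_off_const].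
  apply (bounded_off_mult (fun _ => 6)); [apply bounded_off_const|].
  apply decays_bounded_off, decays_csc2.
Qed.

Lemma decays_csc2''' : decays csc2'''.
Proof.
  apply (decays_ext (fun a => (12 * csc2 a + - (4) * PI ^ 2) * csc2' a)).
  { intros a. unfold csc2'''. ring. }
  apply decays_mult; [|apply decays_csc2'].
  apply (bounded_off_plus (fun a => 12 * csc2 a) (fun _ => - (4) * PI ^ 2));
    [|apply bounded_off_const].
  apply (bounded_off_mult (fun _ => 12)); [apply bounded_off_const|].
  apply decays_bounded_off, decays_csc2.
Qed.

(* The condition [0 < Im a * IZR n] holds for [a = z + n * tau] when n is
   large. *)
Definition fam_decays (f : Z -> C -> C) : Prop := exists K : R, (0 <= K)%R /\
  forall (n : Z) (a : C), (1 <= Rabs (Im a))%R -> (0 < Im a * IZR n)%R ->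
    (Cmod (f n a) <= K * (1 + IZR (Z.abs n)) / Rabs (Im a) ^ 4)%R.

Lemma fam_decays_const (f : C -> C) : decays f -> fam_decays (fun _ => f).
Proof.
  intros [K HK]. exists (Rabs K). split; [apply Rabs_pos|]. intros n a Ha _.
  eapply Rle_trans; [apply HK; auto|]. pose proof (wt_base n).
  assert (0 < Rabs (Im a) ^ 4)%R by (apply pow_lt; lra).
  apply Rmult_le_compat_r; [apply Rlt_le, Rinv_0_lt_compat; auto|].
  pose proof (Rle_abs K). pose proof (Rabs_pos K). nra.
Qed.

Lemma fam_decays_mult_n (f : C -> C) : decays f -> fam_decays (fun n a => IZR n * f a).
Proof.
  intros [K HK]. exists (Rabs K). split; [apply Rabs_pos|]. intros n a Ha _.
  rewrite Cmod_mult, Cmod_IZR. pose proof (wt_base n).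
  assert (0 < Rabs (Im a) ^ 4)%R by (apply pow_lt; lra).
  apply Rle_trans with (IZR (Z.abs n) * (Rabs K / Rabs (Im a) ^ 4))%R.
  - apply Rmult_le_compat_l; [lra|]. eapply Rle_trans; [apply HK; auto|].
    apply Rmult_le_compat_r; [apply Rlt_le, Rinv_0_lt_compat; auto | apply Rle_abs].
  - assert (0 <= Rabs K / Rabs (Im a) ^ 4)%R.
    { apply Rmult_le_pos; [apply Rabs_pos | apply Rlt_le, Rinv_0_lt_compat; auto]. }
    replace (Rabs K * (1 + IZR (Z.abs n)) / Rabs (Im a) ^ 4)%R
      with ((1 + IZR (Z.abs n)) * (Rabs K / Rabs (Im a) ^ 4))%R by (unfold Rdiv; ring).
    apply Rmult_le_compat_r; lra.
Qed.

Definition sgnC (n : Z) : C := IZR (Z.sgn n).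

(* With the counterterms the sum of the cotangents becomes unconditional. *)
Definition cotr (n : Z) (a : C) : C := cotp a + PI * Ci * sgnC n.

Lemma fam_decays_cotr : fam_decays cotr.
Proof.
  pose proof PI_RGT_0. exists (4 * PI * 256)%R. split; [lra|]. intros n a Ha Hn.
  pose proof (wt_base n).
  assert (Hpow : (0 < Rabs (Im a) ^ 4)%R) by (apply pow_lt; lra).
  apply Rle_trans with (4 * PI * 256 / Rabs (Im a) ^ 4)%R.
  - unfold cotr, sgnC. destruct (Rle_dec 0 (Im a)) as [Hi|Hi].
    + rewrite Rabs_right in * by lra.
      assert (Hn0 : (0 < n)%Z) by (apply lt_IZR; nra).
      rewrite Z.sgn_pos by auto. rewrite Cmult_1_r. apply cotp_near_infinity. auto.
    + rewrite Rabs_left in * by lra.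
      assert (Hn0 : (n < 0)%Z) by (apply lt_IZR; nra).
      rewrite Z.sgn_neg by auto.
      replace (cotp a + PI * Ci * (-1)) with (cotp a - PI * Ci)
        by (ring).
      apply cotp_near_infinity_opp. lra.
  - apply Rmult_le_compat_r; [apply Rlt_le, Rinv_0_lt_compat; auto|]. nra.
Qed.

(** The estimate is uniform for z' and tau' near z and tau, so that one majorant serves the
    differentiation in either variable. The last clause is the sign condition of [fam_decays]. *)
Lemma multiples_far (z tau : C) : (0 < Im tau)%R ->
  exists (kappa : R) (r : posreal) (A : list Z), (0 < kappa)%R /\
    forall (n : Z) (z' tau' : C), ~ In n A -> (Cmod (z' - z) < r)%R ->
      (Cmod (tau' - tau) < r)%R ->
      (kappa * (1 + IZR (Z.abs n)) <= Rabs (Im (z' + IZR n * tau')))%R /\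
      (1 <= Rabs (Im (z' + IZR n * tau')))%R /\ (0 < Im (z' + IZR n * tau') * IZR n)%R.
Proof.
  intros Hy. set (y := Im tau) in *. set (x := (Rabs (Im z) + 1)%R).
  assert (Hx : (1 <= x)%R) by (unfold x; pose proof (Rabs_pos (Im z)); lra).
  assert (Hr : (0 < Rmin 1 (y / 2))%R) by (apply Rmin_pos; lra).
  (* As |Im z'| <= x and Im tau' >= y/2, for such n half of |n| y / 2 absorbs Im z' and leaves at
     least |n| y / 4 + 2. *)
  destruct (Z_bounded_list (4 / y * (x + 2))) as [A HA].
  exists (Rmin 1 (y / 4)), (mkposreal _ Hr), A. split; [apply Rmin_pos; lra|].
  intros n z' tau' Hn Hz Ht. simpl pos in Hz, Ht. apply HA in Hn.
  pose proof (Rmin_l 1 (y / 2)). pose proof (Rmin_r 1 (y / 2)).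
  pose proof (Rmin_l 1 (y / 4)). pose proof (Rmin_r 1 (y / 4)).
  set (k := Rmin 1 (y / 4)) in *.
  assert (Hn4 : (x + 2 <= y / 4 * IZR (Z.abs n))%R).
  { apply (Rmult_le_compat_l (y / 4)) in Hn; [|lra].
    replace (y / 4 * (4 / y * (x + 2)))%R with (x + 2)%R in Hn by (field; lra). auto. }
  assert (Hz' : (Rabs (Im z') <= x)%R).
  { pose proof (im_le_Cmod (z' - z)) as Hi. destruct z as [z1 z2], z' as [w1 w2].
    unfold x. simpl in *. pose proof (Rabs_triang z2 (w2 + - z2)) as Htr.
    replace (z2 + (w2 + - z2))%R with w2 in Htr by ring. lra. }
  assert (Ht' : (y / 2 <= Im tau')%R).
  { pose proof (im_le_Cmod (tau' - tau)) as Hi. unfold y in *.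
    destruct tau as [z1 z2], tau' as [w1 w2]. simpl in *.
    apply Rabs_le_between in Hi. lra. }
  assert (E : Im (z' + IZR n * tau') = (Im z' + IZR n * Im tau')%R)
    by (destruct z', tau'; simpl; ring).
  rewrite E. apply Rabs_le_between in Hz'.
  rewrite abs_IZR in *.
  assert (HN : (0 < Rabs (IZR n))%R) by nra.
  destruct (Rle_dec 0 (IZR n)) as [Hs|Hs].
  - rewrite Rabs_right in Hn4, HN |- * by lra.
    assert (IZR n * (y / 2) <= IZR n * Im tau')%R by (apply Rmult_le_compat_l; lra).
    assert (k * IZR n <= y / 4 * IZR n)%R by (apply Rmult_le_compat_r; lra).
    rewrite Rabs_right by nra. split; [nra|]. split; [nra|].
    apply Rmult_lt_0_compat; nra.
  - rewrite (Rabs_left (IZR n)) in Hn4, HN |- * by lra.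
    assert (IZR n * Im tau' <= IZR n * (y / 2))%R by (apply Rmult_le_compat_neg_l; lra).
    assert (k * (- IZR n) <= y / 4 * (- IZR n))%R by (apply Rmult_le_compat_r; lra).
    rewrite Rabs_left by nra. split; [nra|]. split; [nra|].
    apply Rmult_neg_neg; nra.
Qed.

(** The factor 1 + |n| allowed in [fam_decays] is harmless: against the fourth power of kappa (1 +
    |n|) it leaves an inverse cube, which lies below [wt]. *)
Lemma fam_decays_far (f : Z -> C -> C) (z tau : C) : fam_decays f -> (0 < Im tau)%R ->
  exists (K : R) (r : posreal) (A : list Z), (0 <= K)%R /\
    forall (n : Z) (z' tau' : C), ~ In n A -> (Cmod (z' - z) < r)%R ->
      (Cmod (tau' - tau) < r)%R ->
      Im (z' + IZR n * tau') <> 0%R /\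
      (Cmod (f n (z' + IZR n * tau')%C) <= K * wt n)%R.
Proof.
  intros [K [HK0 HK]] Ht. destruct (multiples_far z tau Ht) as [k [r [A [Hk HA]]]].
  assert (Hk4 : (0 < k ^ 4)%R) by (apply pow_lt; auto).
  exists (K / k ^ 4)%R, r, A. split.
  { apply Rmult_le_pos; auto. apply Rlt_le, Rinv_0_lt_compat. auto. }
  intros n z' tau' Hn Hz Htau. destruct (HA n z' tau' Hn Hz Htau) as [H1 [H2 H3]].
  set (a := z' + IZR n * tau') in *. split.
  { intros E. rewrite E, Rabs_R0 in H2. lra. }
  eapply Rle_trans; [apply HK; auto|].
  pose proof (wt_base n) as Hb. pose proof (wt_ge_sqr n) as Hw.
  set (N := (1 + IZR (Z.abs n))%R) in *.
  assert (H4 : ((k * N) ^ 4 <= Rabs (Im a) ^ 4)%R).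
  { apply pow_incr. split; auto. apply Rmult_le_pos; lra. }
  assert (H5 : (0 < (k * N) ^ 4)%R) by (apply pow_lt, Rmult_lt_0_compat; lra).
  apply Rle_trans with (K * N / (k * N) ^ 4)%R.
  - apply Rmult_le_compat_l; [apply Rmult_le_pos; lra|]. apply Rinv_le_contravar; auto.
  - replace (K * N / (k * N) ^ 4)%R with (K / k ^ 4 * / N ^ 3)%R by (field; lra).
    apply Rmult_le_compat_l.
    + apply Rmult_le_pos; auto. apply Rlt_le, Rinv_0_lt_compat. auto.
    + eapply Rle_trans; [|exact Hw]. apply Rinv_le_contravar; [apply pow_lt; lra|].
      apply Rle_pow; auto.
Qed.

Lemma fam_decays_summable (f : Z -> C -> C) (z tau : C) : fam_decays f -> (0 < Im tau)%R ->
  summable (fun n => Cmod (f n (z + IZR n * tau))).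
Proof.
  intros Hf Ht. destruct (fam_decays_far f z tau Hf Ht) as [K [r [A [HK HA]]]].
  apply (summable_le_except _ (fun n => K * wt n)%R A).
  - intros n. apply Cmod_ge_0.
  - intros n Hn. apply HA; auto using Cmod_sub_self.
  - apply summable_scal; auto using summable_wt.
Qed.

Definition tsum (f : Z -> C -> C) (tau z : C) : C := usum (fun n => f n (z + IZR n * tau)).

Lemma is_usum_tsum (f : Z -> C -> C) (z tau : C) : fam_decays f -> (0 < Im tau)%R ->
  is_usum (fun n => f n (z + IZR n * tau)) (tsum f tau z).
Proof. intros Hf Ht. apply usum_correct, fam_decays_summable; auto. Qed.

Lemma not_int_of_Im (a : C) : Im a <> 0%R -> ~ is_int a.
Proof. intros Ha [n Hn]. apply Ha. rewrite Hn. reflexivity. Qed.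

Lemma is_cder_tsum_z (f f' : Z -> C -> C) (z tau : C) :
  fam_decays f -> fam_decays f' -> (0 < Im tau)%R ->
  (forall n a, ~ is_int a -> is_cder (f n) a (f' n a)) ->
  (forall n : Z, ~ is_int (z + IZR n * tau)) ->
  is_cder (tsum f tau) z (tsum f' tau z).
Proof.
  intros Hf Hf' Ht HD Hz.
  destruct (fam_decays_far f' z tau Hf' Ht) as [K [r [A [HK HA]]]].
  apply (is_usum_is_cder (fun n z => f n (z + IZR n * tau)) (fun n z => f' n (z + IZR n * tau))
    _ _ _ r A (fun n => K * wt n)%R).
  - intros n. apply (is_cder_shift (f n)). auto.
  - intros n y Hn Hy. destruct (HA n y tau Hn Hy (Cmod_sub_self tau r)) as [H1 H2]. split; auto.
    apply (is_cder_shift (f n)), HD, not_int_of_Im. auto.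
  - apply summable_scal; auto using summable_wt.
  - intros y _. apply is_usum_tsum; auto.
  - apply is_usum_tsum; auto.
Qed.

Lemma Im_pos_open (tau : C) : (0 < Im tau)%R ->
  exists r : posreal, forall t, (Cmod (t - tau) < r)%R -> (0 < Im t)%R.
Proof.
  intros H. exists (mkposreal _ H). simpl. intros t Ht.
  pose proof (im_le_Cmod (t - tau)) as Hi. destruct t as [a b], tau as [c d].
  simpl in *. apply Rabs_le_between in Hi. lra.
Qed.

(** The term n = 0 does not depend on tau, so that z itself may be a pole; this allows z = 0, as
    needed for e2. *)
Lemma is_cder_tsum_tau (f f' : Z -> C -> C) (z tau : C) :
  fam_decays f -> fam_decays (fun n a => IZR n * f' n a) -> (0 < Im tau)%R ->
  (forall n a, ~ is_int a -> is_cder (f n) a (f' n a)) ->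
  (forall n : Z, n <> 0%Z -> ~ is_int (z + IZR n * tau)) ->
  is_cder (fun t => tsum f t z) tau (tsum (fun n a => IZR n * f' n a) tau z).
Proof.
  intros Hf Hf' Ht HD Hz.
  destruct (fam_decays_far _ z tau Hf' Ht) as [K [r [A [HK HA]]]].
  destruct (Im_pos_open tau Ht) as [r' Hr'].
  destruct (common_radius r r') as [m [Hm1 Hm2]].
  assert (HD' : forall n t, ~ is_int (z + IZR n * t) ->
    is_cder (fun t => f n (z + IZR n * t)) t (IZR n * f' n (z + IZR n * t))).
  { intros n t H. apply (is_cder_eq _ _ (f' n (z + IZR n * t) * (0 + IZR n * 1))); [|ring].
    apply (is_cder_comp (f n) (fun t => z + IZR n * t)); auto.
    apply is_cder_plus; [apply is_cder_const | apply is_cder_scal, is_cder_id]. }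
  apply (is_usum_is_cder (fun n t => f n (z + IZR n * t))
    (fun n t => IZR n * f' n (z + IZR n * t)) _ _ _ m A (fun n => K * wt n)%R).
  - intros n. destruct (Z.eq_dec n 0) as [->|Hn]; auto.
    apply (is_cder_eq _ _ 0); [|ring].
    apply (is_cder_ext (fun _ => f 0%Z z)); [|apply is_cder_const].
    intros y. f_equal. ring.
  - intros n t Hn Hlt.
    destruct (HA n z t Hn (Cmod_sub_self z r)) as [H1 H2]; [lra|]. split; auto.
    apply HD', not_int_of_Im. auto.
  - apply summable_scal; auto using summable_wt.
  - intros t Hlt. apply is_usum_tsum; auto. apply Hr'. lra.
  - apply (is_usum_tsum (fun n a => IZR n * f' n a)); auto.
Qed.

(** * Quadratic relations *)

Lemma is_usum_0 {T : Type} : is_usum (fun _ : T => 0) 0.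
Proof.
  intros eps. exists nil. intros B _ _. rewrite csum_0; auto.
  apply Cmod_sub_self.
Qed.

(** For k = 1 only m = -1 and m = 0 contribute, 1 each; other shifts follow by induction in both
    directions. *)
Lemma is_usum_sgn_shift (k : Z) : is_usum (fun m => sgnC (m + k) - sgnC m) (2 * IZR k).
Proof.
  assert (H1 : is_usum (fun m => sgnC (m + 1) - sgnC m) 2).
  { apply (is_usum_eq _ (csum (fun m => sgnC (m + 1) - sgnC m) (-1 :: 0 :: nil)%Z)).
    - apply is_usum_finite.
      + repeat constructor; simpl; intuition discriminate.
      + intros m Hm. simpl in Hm. unfold sgnC.
        replace (Z.sgn (m + 1)) with (Z.sgn m) by lia. ring.
    - unfold csum, sgnC. simpl. ring. }
  assert (HS : forall k, is_usum (fun m => sgnC (m + k) - sgnC m) (2 * IZR k) <->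
    is_usum (fun m => sgnC (m + Z.succ k) - sgnC m) (2 * IZR (Z.succ k))).
  { intros j. pose proof (proj2 (is_usum_Z_shift _ j _) H1) as Hj. simpl in Hj.
    rewrite succ_IZR, RtoC_plus. split; intros H.
    - apply (is_usum_ext (fun m => (sgnC (m + j) - sgnC m) + (sgnC (m + j + 1) - sgnC (m + j)))).
      + intros m. unfold Z.succ. rewrite Z.add_assoc. ring.
      + apply (is_usum_eq _ (2 * IZR j + 2)); [|ring]. apply is_usum_plus; auto.
    - apply (is_usum_ext (fun m => (sgnC (m + Z.succ j) - sgnC m) - (sgnC (m + j + 1) - sgnC (m + j)))).
      + intros m. unfold Z.succ. rewrite Z.add_assoc. ring.
      + apply (is_usum_eq _ (2 * (IZR j + 1) - 2)); [|ring]. apply is_usum_minus; auto. }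
  revert k. apply Z.peano_ind.
  - apply (is_usum_ext (fun _ => 0)).
    + intros m. rewrite Z.add_0_r. ring.
    + apply (is_usum_eq _ 0); [apply is_usum_0 | ring].
  - intros k IH. apply (proj1 (HS k)). auto.
  - intros k IH. apply (proj2 (HS (Z.pred k))). rewrite Z.succ_pred. auto.
Qed.

Definition fam (f : C -> C) : Z -> C -> C := fun _ => f.
Definition nfam (f : C -> C) : Z -> C -> C := fun n a => IZR n * f a.

Lemma multiple_not_int (tau : C) (k : Z) : (0 < Im tau)%R -> k <> 0%Z -> ~ is_int (IZR k * tau).
Proof.
  intros Ht Hk. apply not_int_of_Im. destruct tau as [x y]. simpl in *.
  intros E. assert (H : (IZR k * y = 0)%R) by lra. apply Rmult_integral in H.
  destruct H as [H|H]; [|lra]. apply eq_IZR in H. auto.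
Qed.

Section Quadratic.

Variable tau : C.
Hypothesis Ht : (0 < Im tau)%R.

(** The values of s, s' and c at k tau. All of them are 0 at k = 0, which encodes the omission of
    the pole. *)
Let S (k : Z) : C := csc2 (IZR k * tau).
Let S' (k : Z) : C := csc2' (IZR k * tau).
Let K (k : Z) : C := cotp (IZR k * tau).
Let G : C := tsum (fam csc2) tau 0.
Let DG : C := tsum (nfam csc2') tau 0.

Lemma is_usum_tsum_0 (f : Z -> C -> C) : fam_decays f ->
  is_usum (fun k => f k (IZR k * tau)) (tsum f tau 0).
Proof.
  intros H. apply (is_usum_ext (fun k => f k (0 + IZR k * tau))).
  - intros k. rewrite Cplus_0_l. reflexivity.
  - apply is_usum_tsum; auto.
Qed.

Lemma fam_decays_summable_0 (f : Z -> C -> C) : fam_decays f ->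
  summable (fun k => Cmod (f k (IZR k * tau))).
Proof.
  intros H. pose proof (fam_decays_summable f 0 tau H Ht) as Hs.
  apply (summable_le _ (fun k => Cmod (f k (0 + IZR k * tau)))); auto.
  intros k. rewrite Cplus_0_l. split; [apply Cmod_ge_0 | lra].
Qed.

(** The corrected cotangent sum is invariant under the shift by k, so that only the shifted
    counterterms remain: k times the total jump 2 pi i of the cotangent between its two ends. *)
Lemma is_usum_cot_telescope (z : C) (k : Z) :
  is_usum (fun m => cotp (z + IZR m * tau) - cotp (z + IZR (m + k) * tau)) (2 * PI * Ci * IZR k).
Proof.
  pose proof (is_usum_tsum cotr z tau fam_decays_cotr Ht) as H.
  pose proof (proj2 (is_usum_Z_shift _ k _) H) as Hk. simpl in Hk.
  apply (is_usum_ext (fun m => (cotr m (z + IZR m * tau) - cotr (m + k) (z + IZR (m + k) * tau))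
    + PI * Ci * (sgnC (m + k) - sgnC m))).
  - intros m. unfold cotr. ring.
  - apply (is_usum_eq _ ((tsum cotr tau z - tsum cotr tau z) + PI * Ci * (2 * IZR k))); [|ring].
    apply is_usum_plus; [apply is_usum_minus; auto|]. apply is_usum_scal, is_usum_sgn_shift.
Qed.

Lemma csc2_at_0 : S 0 = 0.
Proof. unfold S. apply csc2_int. exists 0%Z. ring. Qed.

Lemma csc2'_at_0 : S' 0 = 0.
Proof. unfold S'. apply csc2'_int. exists 0%Z. ring. Qed.

Lemma cotp_at_0 : K 0 = 0.
Proof. unfold K. apply cotp_int. exists 0%Z. ring. Qed.

Lemma is_usum_csc2_0 : is_usum S G.
Proof. apply (is_usum_tsum_0 (fam csc2)), fam_decays_const, decays_csc2. Qed.

Lemma summable_csc2_0 : summable (fun k => Cmod (S k)).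
Proof. apply (fam_decays_summable_0 (fam csc2)), fam_decays_const, decays_csc2. Qed.

Lemma is_usum_nfam_csc2'_0 : is_usum (fun k => IZR k * S' k) DG.
Proof. apply (is_usum_tsum_0 (nfam csc2')), fam_decays_mult_n, decays_csc2'. Qed.

Lemma is_usum_pair_shift (F : Z * Z -> C) (s : C) :
  is_usum F s -> is_usum (fun p => F (fst p, fst p + snd p)%Z) s.
Proof.
  intros H. apply (is_usum_bij (fun p : Z * Z => (fst p, fst p + snd p)%Z)
    (fun p => (fst p, snd p - fst p)%Z) F); auto; intros [m k]; simpl; f_equal; lia.
Qed.

Lemma is_usum_pair_swap (F : Z * Z -> C) (s : C) :
  is_usum F s -> is_usum (fun p => F (snd p, fst p)) s.
Proof.
  intros H. apply (is_usum_bij (fun p : Z * Z => (snd p, fst p)) (fun p => (snd p, fst p)) F);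
    auto; intros []; auto.
Qed.

Lemma is_usum_conv (f g : Z -> C) (s t : C) :
  summable (fun k => Cmod (f k)) -> summable (fun k => Cmod (g k)) ->
  is_usum f s -> is_usum g t ->
  is_usum (fun p => f (snd p) * g (fst p)) (s * t) /\
  is_usum (fun p => f (snd p) * g (fst p + snd p)%Z) (s * t).
Proof.
  intros Hf Hg Hs Hgt. pose proof (is_usum_prod f g s t Hf Hg Hs Hgt) as H. split.
  - apply (is_usum_pair_swap (fun p => f (fst p) * g (snd p))). auto.
  - apply is_usum_pair_shift, is_usum_pair_swap in H. simpl in H.
    apply (is_usum_ext (fun p => f (snd p) * g (snd p + fst p)%Z)); auto.
    intros p. rewrite Z.add_comm. reflexivity.
Qed.

Lemma is_usum_diag (f : Z -> C) (s : C) :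
  is_usum f s -> is_usum (fun p : Z * Z => if Z.eq_dec (snd p) 0 then f (fst p) else 0) s.
Proof.
  intros H. apply (is_usum_inj (fun m : Z => (m, 0%Z))).
  - intros u v E. congruence.
  - intros [m k] E. simpl. destruct (Z.eq_dec k 0) as [->|]; auto. exfalso. apply (E m). auto.
  - simpl. auto.
Qed.

Section Point.

Variable z : C.

Let s (m : Z) : C := csc2 (z + IZR m * tau).
Let s' (m : Z) : C := csc2' (z + IZR m * tau).
Let c (m : Z) : C := cotp (z + IZR m * tau).
Let E : C := tsum (fam csc2) tau z.

Lemma is_usum_csc2_z : is_usum s E.
Proof. apply (is_usum_tsum (fam csc2)); auto. apply fam_decays_const, decays_csc2. Qed.

Lemma summable_csc2_z : summable (fun k => Cmod (s k)).
Proof. apply (fam_decays_summable (fam csc2)); auto. apply fam_decays_const, decays_csc2. Qed.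

Lemma is_usum_csc2'_z : is_usum s' (tsum (fam csc2') tau z).
Proof. apply (is_usum_tsum (fam csc2')); auto. apply fam_decays_const, decays_csc2'. Qed.

Lemma summable_csc2'_z : summable (fun k => Cmod (s' k)).
Proof. apply (fam_decays_summable (fam csc2')); auto. apply fam_decays_const, decays_csc2'. Qed.

(** The right-hand side of [csc2_mult] at a = z + (m + k) tau and b = z + m tau, for p = (m, k). *)
Definition quad_term (p : Z * Z) : C :=
  S' (snd p) * (c (fst p) - c (fst p + snd p)%Z)
  + S (snd p) * (s (fst p) + s (fst p + snd p)%Z).

(** Summing over m for fixed k, the cotangents telescope and give 2 pi i k S'(k) + 2 E S(k).
    Convergence of the double sum is a hypothesis, and z is arbitrary, so that the evaluation also
    applies at z = 0. *)
Lemma is_usum_quad_term (r : C) : is_usum quad_term r -> r = 2 * PI * Ci * DG + 2 * G * E.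
Proof.
  intros H.
  assert (H1 : is_usum (fun k => 2 * PI * Ci * (IZR k * S' k) + 2 * E * S k) r).
  { apply (is_usum_Fubini_swap quad_term); auto. intros k. unfold quad_term. simpl.
    apply (is_usum_eq _ (S' k * (2 * PI * Ci * IZR k) + S k * (E + E))); [|ring].
    apply is_usum_plus; apply is_usum_scal.
    - apply is_usum_cot_telescope.
    - pose proof is_usum_csc2_z as Hs. apply is_usum_plus; auto.
      apply (is_usum_Z_shift s). auto. }
  apply (is_usum_unique _ _ _ H1).
  apply (is_usum_eq _ (2 * PI * Ci * DG + 2 * E * G)); [|ring].
  apply is_usum_plus; apply is_usum_scal; [apply is_usum_nfam_csc2'_0 | apply is_usum_csc2_0].
Qed.

Lemma is_usum_csc2_sqr :
  is_usum (fun m => s m ^ 2) ((tsum (fam csc2'') tau z + 4 * PI ^ 2 * E) / 6).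
Proof.
  apply (is_usum_ext (fun m => / 6 * (csc2'' (z + IZR m * tau) + 4 * PI ^ 2 * s m))).
  - intros m. unfold s, csc2''. field.
  - apply (is_usum_eq _ (/ 6 * (tsum (fam csc2'') tau z + 4 * PI ^ 2 * E))); [|field].
    apply is_usum_scal, is_usum_plus; [|apply is_usum_scal, is_usum_csc2_z].
    apply (is_usum_tsum (fam csc2'')); auto. apply fam_decays_const, decays_csc2''.
Qed.

Let Q : C := (tsum (fam csc2'') tau z + 4 * PI ^ 2 * E) / 6.

Hypothesis Hz : forall n : Z, ~ is_int (z + IZR n * tau).

Lemma sub_multiple (m k : Z) :
  (z + IZR (m + k) * tau) - (z + IZR m * tau) = IZR k * tau.
Proof. rewrite plus_IZR, RtoC_plus. ring. Qed.

(** Convergence is read off the other side of [csc2_mult]: away from k = 0 the terms are those of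
    the product E * E; at k = 0 they vanish, while the product contains the squares summing to Q. *)
Lemma is_usum_quad_term_z : is_usum quad_term (E ^ 2 - Q).
Proof.
  apply (is_usum_ext (fun p => s (fst p) * s (fst p + snd p)%Z -
    (if Z.eq_dec (snd p) 0 then s (fst p) ^ 2 else 0))).
  - intros [m k]. unfold quad_term. simpl fst. simpl snd.
    destruct (Z.eq_dec k 0) as [->|Hk].
    + rewrite csc2_at_0, csc2'_at_0, Z.add_0_r. ring.
    + assert (Hk' : ~ is_int (z + IZR (m + k) * tau - (z + IZR m * tau)))
        by (rewrite sub_multiple; apply multiple_not_int; auto).
      pose proof (csc2_mult _ _ (Hz (m + k)) (Hz m) Hk') as HM.
      rewrite sub_multiple in HM. unfold S, S', s, c.
      transitivity (csc2 (z + IZR (m + k) * tau) * csc2 (z + IZR m * tau)); [ring|].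
      rewrite HM. ring.
  - apply is_usum_minus.
    + replace (E ^ 2) with (E * E) by ring.
      apply (is_usum_pair_shift (fun p => s (fst p) * s (snd p))).
      apply is_usum_prod; auto using summable_csc2_z, is_usum_csc2_z.
    + apply (is_usum_diag (fun m => s m ^ 2)). apply is_usum_csc2_sqr.
Qed.

Lemma tsum_csc2_sqr : E ^ 2 - Q = 2 * PI * Ci * DG + 2 * G * E.
Proof. apply is_usum_quad_term, is_usum_quad_term_z. Qed.

(** Summability of the cotangent part alone comes by difference: the whole [quad_term] and the
    products S(k) s(m) are both summable. *)
Lemma is_usum_cot_diff :
  is_usum (fun p => S' (snd p) * (c (fst p) - c (fst p + snd p)%Z)) (2 * PI * Ci * DG).
Proof.
  destruct (is_usum_conv S s G E summable_csc2_0 summable_csc2_z is_usum_csc2_0 is_usum_csc2_z) as [H1 H2].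
  apply (is_usum_ext (fun p => quad_term p - (S (snd p) * s (fst p)
    + S (snd p) * s (fst p + snd p)%Z))).
  - intros p. unfold quad_term. ring.
  - apply (is_usum_eq _ ((E ^ 2 - Q) - (G * E + G * E))).
    + apply is_usum_minus; [apply is_usum_quad_term_z | apply is_usum_plus; auto].
    + rewrite tsum_csc2_sqr. ring.
Qed.

(** At z = 0 the corrected cotangent sum is 0 by oddness, so that only the shift of the counterterms
    by m contributes. *)
Lemma is_usum_cot_row (m : Z) :
  is_usum (fun k => K k + PI * Ci * sgnC (m + k)) (2 * PI * Ci * IZR m).
Proof.
  pose proof (is_usum_tsum_0 cotr fam_decays_cotr) as H.
  assert (H0 : tsum cotr tau 0 = 0).
  { assert (E0 : tsum cotr tau 0 = - (1) * tsum cotr tau 0).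
    { apply (is_usum_unique _ _ _ H).
      apply (is_usum_Z_opp (fun k => cotr k (IZR k * tau))).
      apply (is_usum_ext (fun k => - (1) * cotr k (IZR k * tau))); [|apply is_usum_scal; auto].
      intros k. unfold cotr, sgnC. rewrite opp_IZR, Z.sgn_opp, opp_IZR, !RtoC_opp.
      replace (- IZR k * tau) with (- (IZR k * tau)) by ring. rewrite cotp_opp. ring. }
    replace (tsum cotr tau 0) with ((tsum cotr tau 0 + tsum cotr tau 0) / 2) by field.
    rewrite E0 at 2. field. }
  apply (is_usum_ext (fun k => cotr k (IZR k * tau) + PI * Ci * (sgnC (k + m) - sgnC k))).
  - intros k. unfold cotr, K. rewrite (Z.add_comm m k). ring.
  - apply (is_usum_eq _ (tsum cotr tau 0 + PI * Ci * (2 * IZR m))); [|rewrite H0; ring].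
    apply is_usum_plus; auto. apply is_usum_scal, is_usum_sgn_shift.
Qed.

(** [cotp_mult_csc2'] summed over pairs (m, k). Its three terms give 2 pi i DG, 2 G E and, with the
    sum over k taken first, 2 pi i times the sum of m s'(z + m tau), which is a tau-derivative. The
    diagonal k = 0 gives the terms in Q and E. *)
Lemma tsum_cot_csc2' :
  tsum cotr tau z * tsum (fam csc2') tau z =
  - (2) * Q + 2 * PI ^ 2 * E + 2 * PI * Ci * DG + 2 * G * E
    + 2 * PI * Ci * tsum (nfam csc2') tau z.
Proof.
  pose proof (is_usum_tsum cotr z tau fam_decays_cotr Ht) as HC.
  pose proof (fam_decays_summable cotr z tau fam_decays_cotr Ht) as HCs.
  destruct (is_usum_conv S s G E summable_csc2_0 summable_csc2_z is_usum_csc2_0 is_usum_csc2_z) as [H1 _].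
  assert (HL : is_usum (fun p => s' (fst p) * cotr (fst p + snd p)%Z (z + IZR (fst p + snd p) * tau))
    (tsum (fam csc2') tau z * tsum cotr tau z)).
  { apply (is_usum_pair_shift (fun p => s' (fst p) * cotr (snd p) (z + IZR (snd p) * tau))).
    apply (is_usum_prod s' (fun n => cotr n (z + IZR n * tau)));
      auto using is_usum_csc2'_z, summable_csc2'_z. }
  assert (HD : is_usum (fun m => c m * s' m) (- (2) * Q + 2 * PI ^ 2 * E)).
  { apply (is_usum_ext (fun m => - (2) * s m ^ 2 + 2 * PI ^ 2 * s m)).
    - intros m. unfold s', csc2'. fold (c m) (s m).
      transitivity (- (2) * c m ^ 2 * s m); [|ring].
      unfold c. rewrite cotp_sqr by auto. fold (s m). ring.
    - apply is_usum_plus; apply is_usum_scal; [apply is_usum_csc2_sqr | apply is_usum_csc2_z]. }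
  set (D := - (2) * Q + 2 * PI ^ 2 * E) in *.
  set (L := tsum (fam csc2') tau z * tsum cotr tau z) in *.
  (* The counterterms of [cotr] are kept with the last term of the addition formula, whose sum over
     k would not converge without them. *)
  set (X := fun p : Z * Z => s' (fst p) * (K (snd p) + PI * Ci * sgnC (fst p + snd p)%Z)).
  assert (HX : is_usum X (L - D - 2 * PI * Ci * DG - 2 * (G * E))).
  { apply (is_usum_ext (fun p =>
      s' (fst p) * cotr (fst p + snd p)%Z (z + IZR (fst p + snd p) * tau)
      - (if Z.eq_dec (snd p) 0 then c (fst p) * s' (fst p) else 0)
      - S' (snd p) * (c (fst p) - c (fst p + snd p)%Z)
      - 2 * (S (snd p) * s (fst p)))).
    - intros [m k]. unfold X, cotr. simpl fst. simpl snd.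
      destruct (Z.eq_dec k 0) as [->|Hk].
      + rewrite csc2_at_0, csc2'_at_0, cotp_at_0, Z.add_0_r. fold (c m). ring.
      + assert (Hk' : ~ is_int (z + IZR (m + k) * tau - (z + IZR m * tau)))
          by (rewrite sub_multiple; apply multiple_not_int; auto).
        pose proof (cotp_mult_csc2' _ _ (Hz (m + k)) (Hz m) Hk') as HM.
        rewrite sub_multiple in HM. fold (s' m) (s m) (c m) (c (m + k)%Z) (S k) (S' k) (K k) in HM.
        fold (c (m + k)%Z).
        transitivity (c (m + k)%Z * s' m + s' m * (PI * Ci * sgnC (m + k)%Z)
          - S' k * (c m - c (m + k)%Z) - 2 * (S k * s m)); [ring|].
        rewrite HM. ring.
    - apply is_usum_minus; [apply is_usum_minus; [apply is_usum_minus|]|]; auto.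
      + apply (is_usum_diag (fun m => c m * s' m)). auto.
      + apply is_usum_cot_diff.
      + apply is_usum_scal. auto. }
  assert (HX2 : is_usum (fun m => 2 * PI * Ci * (IZR m * s' m)) (L - D - 2 * PI * Ci * DG - 2 * (G * E))).
  { apply (is_usum_Fubini X); auto. intros m. unfold X. simpl.
    apply (is_usum_eq _ (s' m * (2 * PI * Ci * IZR m))); [|ring].
    apply is_usum_scal, is_usum_cot_row. }
  assert (HX3 : L - D - 2 * PI * Ci * DG - 2 * (G * E) = 2 * PI * Ci * tsum (nfam csc2') tau z).
  { apply (is_usum_unique _ _ _ HX2), is_usum_scal.
    apply (is_usum_tsum (nfam csc2')); auto. apply fam_decays_mult_n, decays_csc2'. }
  transitivity (L - D - 2 * PI * Ci * DG - 2 * (G * E) + D + 2 * PI * Ci * DG + 2 * G * E);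
    [unfold L; ring|].
  rewrite HX3. unfold D. ring.
Qed.

End Point.

(* The relation at [z = 0], where the terms with [m = 0] or [m + k = 0] need
   a correction. *)
Lemma tsum_csc2_sqr_0 :
  G ^ 2 = 5 * ((tsum (fam csc2'') tau 0 + 4 * PI ^ 2 * G) / 6) - 4 * PI ^ 2 * G - 2 * PI * Ci * DG.
Proof.
  set (Q := (tsum (fam csc2'') tau 0 + 4 * PI ^ 2 * G) / 6).
  assert (HQ : is_usum (fun m => S m ^ 2) Q).
  { apply (is_usum_ext (fun m => csc2 (0 + IZR m * tau) ^ 2)); [|apply is_usum_csc2_sqr].
    intros m. unfold S. rewrite Cplus_0_l. reflexivity. }
  set (W := fun k => 3 * S k ^ 2 - 2 * PI ^ 2 * S k).
  assert (HW : is_usum W (3 * Q - 2 * PI ^ 2 * G)).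
  { apply is_usum_minus; apply is_usum_scal; auto. apply is_usum_csc2_0. }
  assert (HW0 : W 0%Z = 0) by (unfold W; rewrite csc2_at_0; ring).
  assert (EW : forall k, k <> 0%Z -> W k = S k ^ 2 - S' k * K k).
  { intros k Hk. unfold W, S', csc2'. fold (K k) (S k).
    transitivity (S k ^ 2 + 2 * K k ^ 2 * S k); [|ring].
    unfold K. rewrite cotp_sqr by (apply multiple_not_int; auto). fold (S k). ring. }
  assert (Hop : forall k, S (- k) = S k /\ K (- k) = - K k).
  { intros k. unfold S, K. rewrite opp_IZR, RtoC_opp.
    replace (- IZR k * tau) with (- (IZR k * tau)) by ring.
    rewrite csc2_opp, cotp_opp. auto. }
  assert (HF : is_usum (quad_term 0) (G * G - Q + (3 * Q - 2 * PI ^ 2 * G)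
    + (3 * Q - 2 * PI ^ 2 * G))).
  { apply (is_usum_ext (fun p => S (fst p) * S (fst p + snd p)%Z
      - (if Z.eq_dec (snd p) 0 then S (fst p) ^ 2 else 0)
      + (if Z.eq_dec (fst p) 0 then W (snd p) else 0)
      + (if Z.eq_dec (fst p + snd p)%Z 0 then W (snd p) else 0))).
    - intros [m k]. unfold quad_term. rewrite !Cplus_0_l. simpl fst. simpl snd.
      fold (S m) (K m) (S (m + k)%Z) (K (m + k)%Z).
      destruct (Z.eq_dec k 0) as [->|Hk].
      { rewrite Z.add_0_r, csc2_at_0, csc2'_at_0, HW0. destruct (Z.eq_dec m 0); ring. }
      destruct (Z.eq_dec m 0) as [->|Hm].
      { rewrite Z.add_0_l. destruct (Z.eq_dec k 0); [tauto|].
        rewrite EW, csc2_at_0, cotp_at_0 by auto. ring. }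
      destruct (Z.eq_dec (m + k) 0) as [E|Hmk].
      { rewrite E, csc2_at_0, cotp_at_0. replace m with (- k)%Z by lia.
        destruct (Hop k) as [-> ->]. rewrite EW by auto. ring. }
      assert (Ek : IZR (m + k) * tau - IZR m * tau = IZR k * tau)
        by (rewrite plus_IZR, RtoC_plus; ring).
      assert (Hk' : ~ is_int (IZR (m + k) * tau - IZR m * tau))
        by (rewrite Ek; apply multiple_not_int; auto).
      pose proof (csc2_mult _ _ (multiple_not_int tau (m + k) Ht Hmk)
        (multiple_not_int tau m Ht Hm) Hk') as HM.
      rewrite Ek in HM. fold (S m) (K m) (S (m + k)%Z) (K (m + k)%Z) (S k) (S' k) in HM.
      transitivity (S (m + k)%Z * S m); [ring|]. rewrite HM. ring.
    - apply is_usum_plus; [apply is_usum_plus; [apply is_usum_minus|]|].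
      + apply (is_usum_pair_shift (fun p => S (fst p) * S (snd p))).
        apply is_usum_prod; auto using summable_csc2_0, is_usum_csc2_0.
      + apply (is_usum_diag (fun m => S m ^ 2)). auto.
      + apply (is_usum_pair_swap (fun p => if Z.eq_dec (snd p) 0 then W (fst p) else 0)).
        apply is_usum_diag. auto.
      + apply (is_usum_bij (fun p : Z * Z => (fst p + snd p, snd p)%Z)
          (fun p => (fst p - snd p, snd p)%Z)
          (fun p : Z * Z => if Z.eq_dec (fst p) 0 then W (snd p) else 0)).
        * intros [a b]; simpl; f_equal; lia.
        * intros [a b]; simpl; f_equal; lia.
        * apply (is_usum_pair_swap (fun p => if Z.eq_dec (snd p) 0 then W (fst p) else 0)).
          apply is_usum_diag. auto. }
  apply is_usum_quad_term in HF. fold G in HF.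
  replace (G ^ 2) with (- (G * G - Q + (3 * Q - 2 * PI ^ 2 * G) + (3 * Q - 2 * PI ^ 2 * G))
    + 2 * (G * G) + 5 * Q - 4 * PI ^ 2 * G) by ring.
  rewrite HF. ring.
Qed.

End Quadratic.

(** * Lattice sums *)

Definition lpt (tau : C) (p : Z * Z) : C := IZR (fst p) + IZR (snd p) * tau.

(** For w = m + n tau the imaginary part controls n, by |n| Im tau <= |w|, and then |m| <= |w| + |n|
    |tau| controls m. *)
Lemma lpt_lower_bound (tau : C) : (0 < Im tau)%R -> exists kappa : R, (0 < kappa)%R /\
  forall p, (kappa * (IZR (Z.abs (fst p)) + IZR (Z.abs (snd p))) <= Cmod (lpt tau p))%R.
Proof.
  intros Hy. set (y := Im tau) in *. set (B := (1 + (Cmod tau + 1) / y)%R).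
  assert (Ht : (0 <= Cmod tau)%R) by apply Cmod_ge_0.
  assert (HB : (0 < B)%R).
  { unfold B. assert (0 < (Cmod tau + 1) / y)%R by (apply Rdiv_lt_0_compat; lra). lra. }
  exists (/ B)%R. split; [apply Rinv_0_lt_compat; auto|]. intros [m n]. simpl fst. simpl snd.
  set (w := lpt tau (m, n)). set (N := IZR (Z.abs n)).
  assert (H1 : (N * y <= Cmod w)%R).
  { eapply Rle_trans; [|apply im_le_Cmod]. unfold N, y, w, lpt. rewrite abs_IZR.
    replace (Im (IZR (fst (m, n)) + IZR (snd (m, n)) * tau)) with (IZR n * Im tau)%R
      by (destruct tau; simpl; ring).
    rewrite Rabs_mult, (Rabs_right (Im tau)); [lra|]. fold y. lra. }
  assert (H2 : (IZR (Z.abs m) <= Cmod w + N * Cmod tau)%R).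
  { unfold N. rewrite <- !Cmod_IZR, <- Cmod_mult.
    replace (RtoC (IZR m)) with (w + - (IZR n * tau)) by (unfold w, lpt; simpl; ring).
    eapply Rle_trans; [apply Cmod_triangle|]. rewrite Cmod_opp. lra. }
  apply Rmult_le_reg_l with B; auto. rewrite <- Rmult_assoc, Rinv_r, Rmult_1_l by lra.
  assert (H3 : (N * (Cmod tau + 1) <= (Cmod tau + 1) / y * Cmod w)%R).
  { replace (N * (Cmod tau + 1))%R with ((Cmod tau + 1) / y * (N * y))%R by (field; lra).
    apply Rmult_le_compat_l; auto. apply Rmult_le_pos; [lra|].
    apply Rlt_le, Rinv_0_lt_compat. auto. }
  unfold B. lra.
Qed.

Lemma lpt_far (z tau : C) : (0 < Im tau)%R ->
  exists (kappa : R) (A : list (Z * Z)), (0 < kappa)%R /\ forall p z', ~ In p A ->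
    (Cmod z' <= Cmod z)%R ->
    (kappa * (1 + IZR (Z.abs (fst p)) + IZR (Z.abs (snd p))) <= Cmod (z' + lpt tau p))%R.
Proof.
  intros Hy. destruct (lpt_lower_bound tau Hy) as [k [Hk HL]].
  destruct (Z_bounded_list (2 * Cmod z / k + 1)) as [A HA].
  exists (k / 2)%R, (list_prod A A). split; [lra|]. intros p z' Hp Hz'. specialize (HL p).
  set (N := (IZR (Z.abs (fst p)) + IZR (Z.abs (snd p)))%R) in *.
  assert (HN : (2 * Cmod z / k + 1 <= N)%R).
  { assert (H0 : (0 <= IZR (Z.abs (fst p)))%R) by (apply IZR_le; lia).
    assert (H1 : (0 <= IZR (Z.abs (snd p)))%R) by (apply IZR_le; lia).
    destruct (classic (In (fst p) A)) as [Hi|Hi].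
    - destruct (classic (In (snd p) A)) as [Hj|Hj].
      + exfalso. apply Hp. destruct p. apply in_prod; auto.
      + apply HA in Hj. unfold N. lra.
    - apply HA in Hi. unfold N. lra. }
  apply (Rmult_le_compat_l k) in HN; [|lra].
  replace (k * (2 * Cmod z / k + 1))%R with (2 * Cmod z + k)%R in HN by (field; lra).
  pose proof (Cmod_triangle (z' + lpt tau p) (- z')) as Htr.
  replace (z' + lpt tau p + - z') with (lpt tau p) in Htr by ring. rewrite Cmod_opp in Htr.
  rewrite Rplus_assoc. fold N. lra.
Qed.

Lemma summable_wt_prod : summable (fun p : Z * Z => wt (fst p) * wt (snd p))%R.
Proof. apply (summable_prod wt wt); apply summable_wt. Qed.

Lemma inv_cube_wt (k : R) (m n : Z) : (0 < k)%R ->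
  (/ (k * (1 + IZR (Z.abs m) + IZR (Z.abs n))) ^ 3 <= / k ^ 3 * (wt m * wt n))%R.
Proof.
  intros Hk. pose proof (wt_prod m n). pose proof (wt_base m). pose proof (wt_base n).
  rewrite Rpow_mult_distr, Rinv_mult. apply Rmult_le_compat_l; auto.
  apply Rlt_le, Rinv_0_lt_compat, pow_lt. auto.
Qed.

Lemma lpt_inj (tau : C) : (0 < Im tau)%R -> forall p q, lpt tau p = lpt tau q -> p = q.
Proof.
  intros Hy [m n] [m' n'] E. unfold lpt in E. simpl in E. destruct tau as [x y]. simpl in Hy.
  pose proof (f_equal fst E) as E1. pose proof (f_equal snd E) as E2. simpl in E1, E2.
  assert (En : IZR n = IZR n').
  { apply (Rmult_eq_reg_r y); lra. }
  rewrite En in E1. f_equal; apply eq_IZR; lra.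
Qed.

Lemma lattice'_lpt (tau w : C) : (0 < Im tau)%R ->
  (lattice' tau w <-> exists p, p <> (0, 0)%Z /\ w = lpt tau p).
Proof.
  intros Hy. assert (E0 : lpt tau (0, 0)%Z = 0) by (unfold lpt; simpl; ring). split.
  - intros [[m [n E]] Hw]. exists (m, n). split; [|exact E].
    intros Hmn. apply Hw. rewrite <- E0, <- Hmn. exact E.
  - intros [[m n] [Hp E]]. split; [exists m, n; exact E|].
    intros Hw. apply Hp, (lpt_inj tau Hy). rewrite E0, <- E. exact Hw.
Qed.

Lemma pair_Z_eq_dec (p q : Z * Z) : {p = q} + {p <> q}.
Proof. apply excluded_middle_informative. Qed.

Lemma is_usum_delta (c : C) : is_usum (fun n : Z => if Z.eq_dec n 0 then c else 0) c.
Proof.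
  apply (is_usum_eq _ ((fun n : Z => if Z.eq_dec n 0 then c else 0) 0%Z)); [|reflexivity].
  apply (is_usum_single (fun n : Z => if Z.eq_dec n 0 then c else 0)).
  intros n Hn. destruct (Z.eq_dec n 0); congruence.
Qed.

(** At n = 0 [csc2] is 0 by convention, while the sum over the nonzero integers is pi^2/3: this is
    the constant that separates e2 from the sum of s(n tau). *)
Lemma psum_2_multiple (tau : C) (n : Z) : (0 < Im tau)%R ->
  psum 2 (IZR n * tau) = csc2 (IZR n * tau) + (if Z.eq_dec n 0 then PI ^ 2 / 3 else 0).
Proof.
  intros Hy. destruct (Z.eq_dec n 0) as [->|Hn].
  - rewrite Cmult_0_l, psum_2_0, csc2_int; [ring|]. exists 0%Z. reflexivity.
  - rewrite csc2_psum; [ring|]. apply multiple_not_int; auto.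
Qed.

Lemma psum_4_multiple (tau : C) (n : Z) : (0 < Im tau)%R ->
  psum 4 (IZR n * tau) = / 6 * csc2'' (IZR n * tau) + (if Z.eq_dec n 0 then PI ^ 4 / 45 else 0).
Proof.
  intros Hy. destruct (Z.eq_dec n 0) as [->|Hn].
  - rewrite Cmult_0_l, psum_4_0. unfold csc2''. rewrite csc2_int; [field|].
    exists 0%Z. reflexivity.
  - rewrite csc2''_psum; [field|]. apply multiple_not_int; auto.
Qed.

(** The lattice sum is absolutely convergent, so it may be taken along the rows n = const, each of
    which is a partial fraction series of s''; the row n = 0 gives the constant. *)
Lemma e4_tsum (tau z : C) : (0 < Im tau)%R ->
  e4 tau z = PI ^ 4 / 45 + tsum (fam csc2'') tau 0 / 6.
Proof.
  intros Hy. unfold e4.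
  assert (Hs : summable (fun p => Cmod (/ lpt tau p ^ 4))).
  { destruct (lpt_far 0 tau Hy) as [k [A [Hk HA]]].
    apply (summable_le_except _ (fun p => / k * / k ^ 3 * (wt (fst p) * wt (snd p)))%R A).
    - intros p. apply Cmod_ge_0.
    - intros p Hp. specialize (HA p 0 Hp ltac:(lra)). rewrite Cplus_0_l in HA.
      pose proof (wt_base (fst p)). pose proof (wt_base (snd p)).
      set (b := (k * (1 + IZR (Z.abs (fst p)) + IZR (Z.abs (snd p))))%R) in *.
      assert (Hb : (k <= b)%R) by (unfold b; nra).
      eapply Rle_trans; [apply (Cmod_pow_inv_le _ b); auto; lra|].
      replace (/ b ^ 4)%R with (/ b * / b ^ 3)%R by (field; lra).
      rewrite Rmult_assoc. apply Rmult_le_compat.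
      + apply Rlt_le, Rinv_0_lt_compat. lra.
      + apply Rlt_le, Rinv_0_lt_compat, pow_lt. lra.
      + apply Rinv_le_contravar; lra.
      + apply inv_cube_wt. auto.
    - apply summable_scal; [|apply summable_wt_prod].
      apply Rlt_le, Rmult_lt_0_compat; apply Rinv_0_lt_compat; auto. apply pow_lt. auto. }
  destruct (is_usum_exists _ Hs) as [s Hsum].
  apply (sum_over_usum (lpt tau) (fun p => p <> (0, 0)%Z) _ _ (fun p => / lpt tau p ^ 4)).
  - apply lpt_inj. auto.
  - intros w. apply lattice'_lpt. auto.
  - intros p Hp. apply NNPP in Hp. subst p. unfold lpt. simpl.
    replace (0 + 0 * tau) with (RtoC 0) by ring. rewrite Cmult_0_l. apply Cinv_0.
  - intros p _. unfold Cdiv. ring.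
  - apply (is_usum_eq _ s); auto.
    assert (H1 : is_usum (fun n : Z => / 6 * csc2'' (IZR n * tau)
      + (if Z.eq_dec n 0 then PI ^ 4 / 45 else 0)) s).
    { apply (is_usum_Fubini_swap (fun p => / lpt tau p ^ 4)); auto. intros n.
      rewrite <- psum_4_multiple by auto.
      apply (is_usum_ext (fun m => / (IZR n * tau + IZR m) ^ 4)).
      - intros m. unfold lpt. simpl fst. simpl snd. rewrite Cplus_comm. reflexivity.
      - apply is_usum_psum. lia. }
    apply (is_usum_unique _ _ _ H1).
    apply (is_usum_eq _ (/ 6 * tsum (fam csc2'') tau 0 + PI ^ 4 / 45)); [|field].
    apply is_usum_plus; [|apply is_usum_delta]. apply is_usum_scal.
    apply (is_usum_tsum_0 tau Hy (fam csc2'')), fam_decays_const, decays_csc2''.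
Qed.

Lemma dom_not_int (tau z : C) : dom tau z -> forall n : Z, ~ is_int (z + IZR n * tau).
Proof.
  intros [Hy Hz] n [m Hm]. apply Hz. exists m, (- n)%Z.
  rewrite opp_IZR, RtoC_opp, <- Hm. ring.
Qed.

Lemma wp_tsum (tau z : C) : dom tau z ->
  wp tau z = tsum (fam csc2) tau z - tsum (fam csc2) tau 0 - PI ^ 2 / 3.
Proof.
  intros Hd. pose proof (dom_not_int tau z Hd) as Hz. destruct Hd as [Hy Hl]. unfold wp.
  set (H := fun p => / (z + lpt tau p) ^ 2 - / lpt tau p ^ 2).
  assert (Hs : summable (fun p => Cmod (H p))).
  { destruct (lpt_far z tau Hy) as [k [A [Hk HA]]].
    apply (summable_le_except _ (fun p => Cmod z * 2 * / k ^ 3 * (wt (fst p) * wt (snd p)))%R A).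
    - intros p. apply Cmod_ge_0.
    - intros p Hp.
      assert (H1 := HA p z Hp ltac:(lra)).
      assert (H2 := HA p 0 Hp ltac:(rewrite Cmod_0; apply Cmod_ge_0)). rewrite Cplus_0_l in H2.
      pose proof (wt_base (fst p)). pose proof (wt_base (snd p)).
      pose proof (inv_cube_wt k (fst p) (snd p) Hk) as Hcube.
      set (b := (k * (1 + IZR (Z.abs (fst p)) + IZR (Z.abs (snd p))))%R) in *.
      assert (Hb : (0 < b)%R) by (unfold b; nra).
      assert (N1 : z + lpt tau p <> 0) by (apply Cmod_neq_0; lra).
      assert (N2 : lpt tau p <> 0) by (apply Cmod_neq_0; lra).
      set (w := lpt tau p) in *. set (v := z + w) in *.
      (* Each of the two inverse squares is too large to be summed over the lattice; their
         difference gains one order and is bounded by inverse cubes. *)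
      assert (EH : H p = - z * (/ w * / v ^ 2 + / w ^ 2 * / v)).
      { unfold H. fold w v. replace z with (v - w) by (unfold v; ring). field. auto. }
      rewrite EH, Cmod_mult, Cmod_opp, !Rmult_assoc.
      apply Rmult_le_compat_l; [apply Cmod_ge_0|].
      assert (B1 : forall x : C, (b <= Cmod x)%R -> (Cmod (/ x) <= / b)%R)
        by (intros; apply Cmod_inv_le; auto).
      assert (B2 : forall x : C, (b <= Cmod x)%R -> (Cmod (/ x ^ 2) <= / b ^ 2)%R)
        by (intros; apply Cmod_pow_inv_le; auto).
      eapply Rle_trans; [apply Cmod_triangle|]. rewrite !Cmod_mult.
      apply Rle_trans with (/ b * / b ^ 2 + / b ^ 2 * / b)%R.
      + apply Rplus_le_compat; apply Rmult_le_compat; auto using Cmod_ge_0.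
      + replace (/ b * / b ^ 2 + / b ^ 2 * / b)%R with (2 * / b ^ 3)%R by (field; lra). lra.
    - apply summable_scal; [|apply summable_wt_prod].
      apply Rmult_le_pos; [|apply Rlt_le, Rinv_0_lt_compat, pow_lt; auto].
      pose proof (Cmod_ge_0 z). lra. }
  destruct (is_usum_exists _ Hs) as [s Hsum].
  assert (H1 : is_usum (fun n : Z => csc2 (z + IZR n * tau) - (csc2 (IZR n * tau)
      + (if Z.eq_dec n 0 then PI ^ 2 / 3 else 0))) s).
  { apply (is_usum_Fubini_swap H); auto. intros n.
    rewrite <- psum_2_multiple, csc2_psum by auto.
    apply (is_usum_ext (fun m => / (z + IZR n * tau + IZR m) ^ 2 - / (IZR n * tau + IZR m) ^ 2)).
    - intros m. unfold H, lpt. simpl fst. simpl snd.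
      rewrite <- Cplus_assoc, (Cplus_comm (IZR n * tau)). reflexivity.
    - apply is_usum_minus; apply is_usum_psum; lia. }
  assert (Es : s = tsum (fam csc2) tau z - (tsum (fam csc2) tau 0 + PI ^ 2 / 3)).
  { apply (is_usum_unique _ _ _ H1). apply is_usum_minus.
    - apply (is_usum_tsum (fam csc2)); auto. apply fam_decays_const, decays_csc2.
    - apply is_usum_plus; [|apply is_usum_delta].
      apply (is_usum_tsum_0 tau Hy (fam csc2)), fam_decays_const, decays_csc2. }
  (* The minus sign matches the z - w of [wp] with the z + w of H. At the origin H equals 1/z^2,
     since [/ 0 = 0]; it is taken out here and restored by the leading term of [wp]. *)
  rewrite (sum_over_usum (fun p => - lpt tau p) (fun p => p <> (0, 0)%Z) _ _
    (fun p => H p - (if pair_Z_eq_dec p (0, 0)%Z then / z ^ 2 else 0)) (s - / z ^ 2)).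
  - rewrite Es. unfold Cdiv. ring.
  - intros p q E. apply (lpt_inj tau Hy).
    replace (lpt tau p) with (- - lpt tau p) by ring. rewrite E. ring.
  - intros w. rewrite lattice'_lpt by auto. split; intros [p [Hp E]].
    + exists (- fst p, - snd p)%Z. split.
      * intros E0. inversion E0. apply Hp. destruct p. simpl in *. f_equal; lia.
      * rewrite E. unfold lpt. simpl. rewrite !opp_IZR, !RtoC_opp. ring.
    + exists (- fst p, - snd p)%Z. split.
      * intros E0. inversion E0. apply Hp. destruct p. simpl in *. f_equal; lia.
      * rewrite E. unfold lpt. simpl. rewrite !opp_IZR, !RtoC_opp. ring.
  - intros p Hp. apply NNPP in Hp. subst p. destruct (pair_Z_eq_dec (0, 0)%Z (0, 0)%Z); [|congruence].
    unfold H, lpt. simpl fst. simpl snd. replace (IZR 0 + IZR 0 * tau) with (RtoC 0) by ring.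
    rewrite (Cinv_pow 0), Cinv_0, Cplus_0_r. ring.
  - intros p Hp. destruct (pair_Z_eq_dec p (0, 0)%Z); [congruence|].
    unfold H, Cdiv. replace (z - - lpt tau p) with (z + lpt tau p) by ring.
    replace ((- lpt tau p) ^ 2) with (lpt tau p ^ 2) by ring. ring.
  - apply is_usum_minus; auto.
    apply (is_usum_eq _ ((fun p => if pair_Z_eq_dec p (0, 0)%Z then / z ^ 2 else 0) (0, 0)%Z)).
    + apply (is_usum_single (fun p => if pair_Z_eq_dec p (0, 0)%Z then / z ^ 2 else 0)).
      intros p Hp. destruct (pair_Z_eq_dec p (0, 0)%Z); congruence.
    + simpl. destruct (pair_Z_eq_dec (0, 0)%Z (0, 0)%Z); congruence.
Qed.

Lemma Eis1_tsum (tau z : C) : dom tau z -> Eis1 tau z = tsum cotr tau z.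
Proof.
  intros Hd. pose proof (dom_not_int tau z Hd) as Hz. destruct Hd as [Hy Hl]. unfold Eis1.
  assert (Hin : forall n : Z, sym_lim (fun m => 1 / (z + IZR m + IZR n * tau)) = cotp (z + IZR n * tau)).
  { intros n. apply (sym_lim_usum _ (fun m => - / IZR m)).
    - intros m. rewrite opp_IZR, RtoC_opp, Cinv_opp. reflexivity.
    - rewrite cotp_psum1 by auto.
      apply (is_usum_ext (fun m => / (z + IZR n * tau + IZR m) - / IZR m)); [|apply is_usum_psum1].
      intros m. unfold Cdiv, Cminus. rewrite Cmult_1_l. f_equal. f_equal. ring. }
  apply (sym_lim_usum _ (fun n => PI * Ci * sgnC n)).
  - intros n. unfold sgnC. rewrite Z.sgn_opp, opp_IZR, RtoC_opp. ring.
  - apply (is_usum_ext (fun n => cotr n (z + IZR n * tau))).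
    + intros n. rewrite Hin. reflexivity.
    + apply is_usum_tsum; auto using fam_decays_cotr.
Qed.

(** * The q-expansion of e2 *)

Lemma is_usum_nat_shift (f : nat -> C) (s : C) :
  is_usum f s -> is_usum (fun n => f (S n)) (s - f 0%nat).
Proof.
  intros H. apply (is_usum_ext (fun n => f (S n) - (if Nat.eq_dec (S n) 0 then f 0%nat else 0))).
  { intros n. simpl. ring. }
  apply (is_usum_inj S (fun n => f n - (if Nat.eq_dec n 0 then f 0%nat else 0)) (s - f 0%nat)).
  - intros u v E. congruence.
  - intros [|t] Ht.
    + simpl. ring.
    + exfalso. apply (Ht t). auto.
  - apply is_usum_minus; auto.
    apply (is_usum_eq _ ((fun n => if Nat.eq_dec n 0 then f 0%nat else 0) 0%nat)); [|reflexivity].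
    apply (is_usum_single (fun n => if Nat.eq_dec n 0 then f 0%nat else 0)).
    intros n Hn. destruct (Nat.eq_dec n 0); congruence.
Qed.

(** A shift of the index multiplies the series by u up to its first term: the sums y of u^d and x of
    d u^d satisfy y - u = u y and x - u = u x + u y. *)
Lemma is_usum_arith_geom (u x : C) : u <> 1 ->
  summable (fun d => Cmod (INR (S d) * u ^ S d)) ->
  is_usum (fun d => INR (S d) * u ^ S d) x -> x = u / (u - 1) ^ 2.
Proof.
  intros Hu Hs Hx.
  assert (Hg : summable (fun d => Cmod (u ^ S d))).
  { apply (summable_le _ (fun d => Cmod (INR (S d) * u ^ S d))); auto.
    intros d. split; [apply Cmod_ge_0|]. rewrite Cmod_mult, Cmod_R.
    rewrite S_INR. pose proof (pos_INR d). rewrite Rabs_right by lra.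
    pose proof (Cmod_ge_0 (u ^ S d)). nra. }
  destruct (is_usum_exists _ Hg) as [y Hy].
  assert (Hu1 : u - 1 <> 0) by (apply Cminus_eq_contra; auto).
  assert (Ey : y - u ^ 1 = u * y).
  { apply (is_usum_unique (fun d => u ^ S (S d))).
    - apply (is_usum_nat_shift (fun d => u ^ S d)). auto.
    - apply (is_usum_ext (fun d => u * u ^ S d)); [intros; reflexivity|].
      apply is_usum_scal. auto. }
  assert (Ex : x - INR 1 * u ^ 1 = u * x + u * y).
  { apply (is_usum_unique (fun d => INR (S (S d)) * u ^ S (S d))).
    - apply (is_usum_nat_shift (fun d => INR (S d) * u ^ S d)). auto.
    - apply (is_usum_ext (fun d => u * (INR (S d) * u ^ S d) + u * u ^ S d)).
      + intros d. rewrite (S_INR (S d)), RtoC_plus. simpl. ring.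
      + apply is_usum_plus; apply is_usum_scal; auto. }
  simpl in Ey, Ex.
  assert (Ey2 : y = - u / (u - 1)).
  { replace y with (- (y - u * y) / (u - 1)) by (field; auto).
    rewrite <- Ey at 1. field. auto. }
  replace x with (- (x - u * x) / (u - 1)) by (field; auto).
  replace (x - u * x) with (u + u * y).
  - rewrite Ey2. field. auto.
  - replace (u + u * y) with (u * x + u * y + u - u * x) by ring. rewrite <- Ex. ring.
Qed.

Lemma qexp_mult_nat (a : C) (n : nat) : qexp (INR n * a) = qexp a ^ n.
Proof.
  induction n as [|n IH].
  - simpl. rewrite Cmult_0_l. apply (qexp_int 0).
  - rewrite S_INR, RtoC_plus. simpl. rewrite <- IH, <- qexp_plus. f_equal. ring.
Qed.

Lemma mem_In (s : list nat) (x : nat) : (seq.mem_seq s x = true) <-> In x s.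
Proof.
  induction s as [|y s IH]; simpl.
  - split; [discriminate | tauto].
  - rewrite Bool.orb_true_iff, IH. split; intros [H|H]; auto; left.
    + apply (ssrbool.elimT eqtype.eqP) in H. auto.
    + subst. apply eqtype.eq_refl.
Qed.

Lemma uniq_NoDup (s : list nat) : seq.uniq s = true -> NoDup s.
Proof.
  induction s as [|y s IH]; simpl; intros H; constructor.
  - apply andb_prop in H. destruct H as [H _]. rewrite <- mem_In. intros H1.
    change (negb (seq.mem_seq s y) = true) in H. rewrite H1 in H. discriminate.
  - apply andb_prop in H. tauto.
Qed.

Lemma In_divisors (n d : nat) : In d (prime.divisors (S n)) <-> exists k, S n = (k * d)%nat.
Proof.
  assert (E : div.dvdn d (S n) = seq.mem_seq (prime.divisors (S n)) d)
    by exact (@prime.dvdn_divisors d (S n) eq_refl).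
  rewrite <- mem_In, <- E.
  split.
  - intros H. apply (ssrbool.elimT div.dvdnP) in H. exact H.
  - intros H. apply (ssrbool.introT div.dvdnP). exact H.
Qed.

Lemma sumn_csum (s : list nat) : RtoC (INR (seq.sumn s)) = csum (fun d => RtoC (INR d)) s.
Proof.
  induction s as [|x s IH]; [reflexivity|].
  change (seq.sumn (x :: s)) with (x + seq.sumn s)%nat.
  rewrite plus_INR, RtoC_plus, IH. reflexivity.
Qed.

Section Lambert.

Variable tau : C.
Hypothesis Hy : (0 < Im tau)%R.

Let q : C := qexp tau.

(** The Lambert double series with both indices shifted by 1: the term is d q^N if d divides N.
    Summed over d it gives sigma1(N) q^N; summed along the multiples N = k d for fixed k it gives
    q^k / (q^k - 1)^2, which is s(k tau) up to a constant. *)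
Definition lambert_term (p : nat * nat) : C :=
  if excluded_middle_informative (exists k, S (fst p) = S k * S (snd p))%nat
  then INR (S (snd p)) * q ^ S (fst p) else 0.

Lemma lambert_summable : summable (fun p => Cmod (lambert_term p)).
Proof.
  set (y := Im tau) in *.
  (* Since d <= N, the term is at most N |q|^N, hence of order N^(-3) by [exp_decay]; the factor 8
     comes from replacing N by half of N + d. *)
  apply (summable_le _ (fun p => (8 * (256 / y ^ 4)) *
    (wt (Z.of_nat (fst p)) * wt (Z.of_nat (snd p))))%R).
  - intros [N d]. simpl fst. simpl snd. split; [apply Cmod_ge_0|].
    assert (Hy4 : (0 < y ^ 4)%R) by (apply pow_lt; auto).
    assert (H0 : (0 <= 256 / y ^ 4)%R).
    { apply Rmult_le_pos; [lra|]. apply Rlt_le, Rinv_0_lt_compat. auto. }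
    pose proof (proj1 summable_wt (Z.of_nat N)). pose proof (proj1 summable_wt (Z.of_nat d)).
    unfold lambert_term. simpl fst. simpl snd.
    destruct (excluded_middle_informative (exists k, S N = (S k * S d)%nat)) as [[k Hk]|Hn].
    + assert (Hd : (d <= N)%nat) by nia.
      pose proof (wt_prod (Z.of_nat N) (Z.of_nat d)) as Hw.
      rewrite !Z.abs_eq in Hw by lia.
      rewrite <- !INR_IZR_INZ in Hw.
      rewrite Cmod_mult, Cmod_R. unfold q. rewrite <- qexp_mult_nat, Cmod_qexp.
      rewrite im_scal_l. fold y. apply le_INR in Hd.
      pose proof (pos_INR N) as HN. pose proof (pos_INR d) as Hd0.
      rewrite Rabs_right by (apply Rle_ge, pos_INR).
      assert (Hdec := exp_decay (INR (S N) * y)). rewrite !S_INR in *.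
      specialize (Hdec ltac:(nra)).
      set (n := (INR N + 1)%R) in *.
      apply Rle_trans with (n * (256 / (n * y) ^ 4))%R.
      { apply Rmult_le_compat; auto; [lra | apply Rlt_le, exp_pos | unfold n; lra]. }
      replace (n * (256 / (n * y) ^ 4))%R with (256 / y ^ 4 * / n ^ 3)%R
        by (field; unfold n; lra).
      rewrite (Rmult_comm 8), Rmult_assoc. apply Rmult_le_compat_l; auto.
      apply Rle_trans with (8 * / (1 + INR N + INR d) ^ 3)%R; [|lra].
      replace (8 * / (1 + INR N + INR d) ^ 3)%R with (/ ((1 + INR N + INR d) / 2) ^ 3)%R
        by (field; lra).
      apply Rinv_le_contravar; [apply pow_lt; lra|].
      apply pow_incr. unfold n. lra.
    + rewrite Cmod_0. apply Rmult_le_pos; [lra|]. apply Rmult_le_pos; auto.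
  - apply summable_scal.
    + apply Rmult_le_pos; [lra|]. apply Rmult_le_pos; [lra|].
      apply Rlt_le, Rinv_0_lt_compat, pow_lt. auto.
    + apply (summable_prod (fun n => wt (Z.of_nat n)) (fun n => wt (Z.of_nat n)));
        apply (summable_comp_inj Z.of_nat wt); auto using summable_wt; intros; lia.
Qed.

Lemma lambert_row (N : nat) :
  is_usum (fun d => lambert_term (N, d)) (INR (sigma1 (S N)) * q ^ S N).
Proof.
  set (A := map pred (prime.divisors (S N))).
  assert (Hpos : forall d, In d (prime.divisors (S N)) -> (0 < d)%nat).
  { intros d Hd. apply In_divisors in Hd. destruct Hd as [k Hk]. nia. }
  apply (is_usum_eq _ (csum (fun d => lambert_term (N, d)) A)).
  - apply is_usum_finite.
    + assert (HND : NoDup (prime.divisors (S N))) by (apply uniq_NoDup, prime.divisors_uniq).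
      revert HND Hpos. unfold A. generalize (prime.divisors (S N)). intros l Hl Hp.
      induction Hl as [|x l Hx Hl IH]; simpl; constructor.
      * intros Hi. apply in_map_iff in Hi. destruct Hi as [x' [E Hx']].
        pose proof (Hp x (or_introl eq_refl)). pose proof (Hp x' (or_intror Hx')).
        apply Hx. replace x with x' by lia. auto.
      * apply IH. intros d Hd. apply Hp. right. auto.
    + intros d Hd. unfold lambert_term. simpl fst. simpl snd.
      destruct (excluded_middle_informative (exists k, S N = (S k * S d)%nat)) as [[k Hk]|Hn]; auto.
      exfalso. apply Hd. unfold A. apply in_map_iff. exists (S d). split; auto.
      apply In_divisors. exists (S k). auto.
  - unfold A. rewrite csum_map. unfold sigma1. rewrite sumn_csum, Cmult_comm, <- csum_scal.
    apply csum_ext. intros d Hd. pose proof (Hpos d Hd). apply In_divisors in Hd.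
    destruct Hd as [k Hk]. unfold lambert_term. simpl fst. simpl snd.
    replace (S (pred d)) with d by lia.
    destruct (excluded_middle_informative (exists k, S N = (S k * d)%nat)) as [|Hn]; [ring|].
    exfalso. apply Hn. exists (pred k). rewrite Hk. f_equal. destruct k; lia.
Qed.

(** The map (k, d) -> (k d, d) is injective and its image is the set of pairs with d dividing N,
    outside which the terms are 0. *)
Lemma lambert_column (r : C) : is_usum lambert_term r ->
  is_usum (fun k => csc2 (INR (S k) * tau)) (- (4) * PI ^ 2 * r).
Proof.
  intros Hr.
  set (phi := fun p : nat * nat => (pred (S (fst p) * S (snd p)), snd p)%nat).
  assert (Hinj : forall u v, phi u = phi v -> u = v).
  { intros [a b] [c d] E. unfold phi in E. simpl in E. inversion E. subst. f_equal. nia. }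
  assert (E : forall k d, lambert_term (phi (k, d)) = INR (S d) * (q ^ S k) ^ S d).
  { intros k d. unfold lambert_term. change (snd (phi (k, d))) with d.
    assert (EM : S (fst (phi (k, d))) = (S k * S d)%nat) by (unfold phi; simpl; lia).
    rewrite EM. destruct excluded_middle_informative as [|Hn].
    - rewrite Cpow_mult_r. reflexivity.
    - exfalso. apply Hn. eauto. }
  assert (Hp : is_usum (fun p => lambert_term (phi p)) r).
  { apply is_usum_inj; auto. intros [N d] H. unfold lambert_term. simpl fst. simpl snd.
    destruct (excluded_middle_informative (exists k, S N = (S k * S d)%nat)) as [[k Hk]|]; auto.
    exfalso. apply (H (k, d)). unfold phi. simpl fst. simpl snd. rewrite <- Hk. reflexivity. }
  assert (Hs : summable (fun p => Cmod (lambert_term (phi p)))).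
  { apply (summable_comp_inj phi (fun p => Cmod (lambert_term p))); auto using lambert_summable. }
  apply (is_usum_Fubini _ _ (fun k => csc2 (INR (S k) * tau) / (- (4) * PI ^ 2))) in Hp.
  - apply (is_usum_ext (fun k => - (4) * PI ^ 2 * (csc2 (INR (S k) * tau) / (- (4) * PI ^ 2)))).
    + intros k. field. apply PI_C_neq_0.
    + apply is_usum_scal. auto.
  - intros k. destruct (is_usum_slices _ Hs k) as [x Hx].
    apply (is_usum_eq _ x); auto.
    assert (Hu : q ^ S k <> 1).
    { unfold q. rewrite <- qexp_mult_nat. intros Eq. apply qexp_eq_1 in Eq.
      revert Eq. rewrite INR_IZR_INZ. apply multiple_not_int; auto. lia. }
    rewrite (is_usum_arith_geom (q ^ S k) x Hu).
    + unfold csc2. rewrite qexp_mult_nat. fold q. field.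
      split; [apply Cminus_eq_contra; auto | apply PI_C_neq_0].
    + apply (summable_le _ (fun d => Cmod (lambert_term (phi (k, d))))).
      * intros d. rewrite E. split; [apply Cmod_ge_0 | lra].
      * apply (summable_comp_inj (fun d => (k, d)) (fun p => Cmod (lambert_term (phi p)))); auto.
        congruence.
    + apply (is_usum_ext (fun d => lambert_term (phi (k, d)))); auto.
Qed.

Lemma tsum_csc2_even (t : C) : is_usum (fun k => csc2 (INR (S k) * tau)) t ->
  tsum (fam csc2) tau 0 = 2 * t.
Proof.
  intros H.
  assert (HG : is_usum (fun k : Z => csc2 (IZR k * tau)) (tsum (fam csc2) tau 0)).
  { apply (is_usum_tsum_0 tau Hy (fam csc2)), fam_decays_const, decays_csc2. }
  set (phi := fun p : bool * nat => if fst p then Z.of_nat (S (snd p)) else (- Z.of_nat (S (snd p)))%Z).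
  apply (is_usum_inj phi) in HG.
  - apply (is_usum_Fubini _ _ (fun _ => t)) in HG.
    + apply is_usum_bool in HG. rewrite HG. ring.
    + intros [|]; unfold phi; simpl fst; simpl snd.
      * apply (is_usum_ext (fun k => csc2 (INR (S k) * tau))); auto.
        intros k. rewrite INR_IZR_INZ. reflexivity.
      * apply (is_usum_ext (fun k => csc2 (INR (S k) * tau))); auto.
        intros k. rewrite opp_IZR, RtoC_opp, INR_IZR_INZ, <- csc2_opp. f_equal. ring.
  - intros [[|] a] [[|] b] E; unfold phi in E; cbn [fst snd] in E;
      first [exfalso; lia | f_equal; lia].
  - intros k Hk. destruct (Z.eq_dec k 0) as [->|Hk0].
    + apply csc2_int. exists 0%Z. ring.
    + exfalso. apply (Hk (Z.ltb 0 k, pred (Z.abs_nat k))). unfold phi. simpl fst. simpl snd.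
      destruct (Z.ltb_spec 0 k); lia.
Qed.

Lemma e2_tsum (z : C) : e2 tau z = PI ^ 2 / 3 + tsum (fam csc2) tau 0.
Proof.
  destruct (is_usum_exists _ lambert_summable) as [r Hr].
  rewrite (tsum_csc2_even (- (4) * PI ^ 2 * r)); [|apply lambert_column; auto].
  unfold e2. rewrite (C_Series_usum _ r).
  - field.
  - apply (is_usum_ext (fun N => INR (sigma1 (S N)) * q ^ S N)).
    + intros N. f_equal. unfold q. rewrite <- qexp_mult_nat. unfold qexp. f_equal. ring.
    + apply (is_usum_Fubini lambert_term); auto using lambert_row.
Qed.

End Lambert.

(** * The action of d on the generators *)

Lemma finite_radius {T : Type} (P : T -> C -> Prop) (x : C) (A : list T) :
  (forall t, exists r : posreal, forall y, (Cmod (y - x) < r)%R -> P t y) ->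
  exists r : posreal, forall t y, In t A -> (Cmod (y - x) < r)%R -> P t y.
Proof.
  intros H. induction A as [|a A [r1 H1]].
  - exists (mkposreal 1 Rlt_0_1). intros t y [].
  - destruct (H a) as [r2 H2].
    destruct (common_radius r1 r2) as [m [Hm1 Hm2]]. exists m. intros t y Ht Hy.
    destruct Ht as [<-|Ht]; [apply H2 | apply H1]; auto; lra.
Qed.

Lemma dom_iff (tau z : C) :
  dom tau z <-> (0 < Im tau)%R /\ forall n : Z, ~ is_int (z + IZR n * tau).
Proof.
  split.
  - intros H. split; [apply H | apply dom_not_int; auto].
  - intros [Hy H]. split; auto. intros [m [n E]]. apply (H (- n)%Z). exists m.
    rewrite E, opp_IZR, RtoC_opp. ring.
Qed.

(** Multiples n tau with n large stay uniformly away from the integers by their imaginary parts; the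
    remaining finitely many n are treated one by one. *)
Lemma dom_open_z (tau z : C) : dom tau z ->
  exists r : posreal, forall y, (Cmod (y - z) < r)%R -> dom tau y.
Proof.
  intros H. apply dom_iff in H. destruct H as [Hy Hz].
  destruct (multiples_far z tau Hy) as [k [r [A [Hk HA]]]].
  destruct (finite_radius (fun (n : Z) y => ~ is_int (y + IZR n * tau)) z A) as [r' Hr'].
  { intros n. destruct (is_int_open _ (Hz n)) as [r0 H0]. exists r0. intros y Hyz.
    apply H0. replace (y + IZR n * tau - (z + IZR n * tau)) with (y - z) by ring. auto. }
  destruct (common_radius r r') as [m [Hm1 Hm2]]. exists m. intros y Hyz.
  apply dom_iff. split; auto. intros n. destruct (classic (In n A)) as [Hi|Hi].
  - apply Hr'; auto. lra.
  - destruct (HA n y tau Hi ltac:(lra) (Cmod_sub_self tau r)) as [_ [H1 _]].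
    apply not_int_of_Im. intros E. rewrite E, Rabs_R0 in H1. lra.
Qed.

Lemma dom_open_tau (tau z : C) : dom tau z ->
  exists r : posreal, forall t, (Cmod (t - tau) < r)%R -> dom t z.
Proof.
  intros H. apply dom_iff in H. destruct H as [Hy Hz].
  destruct (multiples_far z tau Hy) as [k [r [A [Hk HA]]]].
  destruct (Im_pos_open tau Hy) as [r1 Hr1].
  destruct (finite_radius (fun (n : Z) t => ~ is_int (z + IZR n * t)) tau A) as [r' Hr'].
  { intros n. destruct (is_int_open _ (Hz n)) as [r0 H0].
    assert (Hc : ccont (fun t => z + IZR n * t) tau).
    { apply ccont_plus; [apply ccont_const|]. apply ccont_mult; [apply ccont_const | apply ccont_id]. }
    destruct (Hc r0) as [d Hd]. exists d. auto. }
  destruct (common_radius r' r1) as [m' [Hm1 Hm2]].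
  destruct (common_radius r m') as [m [Hm3 Hm4]]. exists m. intros t Htt.
  apply dom_iff. split; [apply Hr1; lra|]. intros n. destruct (classic (In n A)) as [Hi|Hi].
  - apply Hr'; auto. lra.
  - destruct (HA n z t Hi (Cmod_sub_self z r) ltac:(lra)) as [_ [Hge _]].
    apply not_int_of_Im. intros E. rewrite E, Rabs_R0 in Hge. lra.
Qed.

Lemma is_cder_dom_z (f g : jfun) (tau z l : C) : feq f g -> dom tau z ->
  is_cder (g tau) z l -> is_cder (f tau) z l.
Proof.
  intros Hfg Hd Hg. destruct (dom_open_z tau z Hd) as [r Hr].
  apply (is_cder_ext_loc (g tau) _ _ _ r); auto. intros y Hy. symmetry. apply Hfg. auto.
Qed.

Lemma is_cder_dom_tau (f g : jfun) (tau z l : C) : feq f g -> dom tau z ->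
  is_cder (fun t => g t z) tau l -> is_cder (fun t => f t z) tau l.
Proof.
  intros Hfg Hd Hg. destruct (dom_open_tau tau z Hd) as [r Hr].
  apply (is_cder_ext_loc (fun t => g t z) _ _ _ r); auto. intros y Hy. symmetry. apply Hfg. auto.
Qed.

Lemma fam_decays_opp_csc2 : fam_decays (fam (fun a => - csc2 a)).
Proof.
  apply fam_decays_const, (decays_ext (fun a => - (1) * csc2 a)); [intros; ring|].
  apply decays_mult; [apply bounded_off_const | apply decays_csc2].
Qed.

Lemma wp_feq : feq wp (fun tau z => tsum (fam csc2) tau z - (PI ^ 2 / 3 + tsum (fam csc2) tau 0)).
Proof. intros tau z H. rewrite wp_tsum by auto. ring. Qed.

Lemma e2_feq : feq e2 (fun tau _ => PI ^ 2 / 3 + tsum (fam csc2) tau 0).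
Proof. intros tau z H. apply e2_tsum. apply H. Qed.

Lemma is_cder_wp_z_tsum (tau z : C) : dom tau z -> is_cder (wp tau) z (tsum (fam csc2') tau z).
Proof.
  intros H. apply (is_cder_dom_z _ _ _ _ _ wp_feq H). pose proof H as H0.
  apply dom_iff in H0. destruct H0 as [Hy Hz].
  apply (is_cder_eq _ _ (tsum (fam csc2') tau z - 0)); [|ring].
  apply is_cder_minus; [|apply is_cder_const].
  apply (is_cder_tsum_z (fam csc2)); auto.
  - apply fam_decays_const, decays_csc2.
  - apply fam_decays_const, decays_csc2'.
  - intros n a Ha. apply is_cder_csc2. auto.
Qed.

Lemma dz_wp_feq : feq (dz wp) (tsum (fam csc2')).
Proof. intros tau z H. apply is_cder_C_derive, is_cder_wp_z_tsum. auto. Qed.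

Lemma is_cder_dwp_z_tsum (tau z : C) : dom tau z -> is_cder (dz wp tau) z (tsum (fam csc2'') tau z).
Proof.
  intros H. apply (is_cder_dom_z _ _ _ _ _ dz_wp_feq H). pose proof H as H0.
  apply dom_iff in H0. destruct H0 as [Hy Hz].
  apply (is_cder_tsum_z (fam csc2')); auto.
  - apply fam_decays_const, decays_csc2'.
  - apply fam_decays_const, decays_csc2''.
  - intros n a Ha. apply is_cder_csc2'. auto.
Qed.

Lemma is_cder_e2_tau (tau z : C) : dom tau z ->
  is_cder (fun t => e2 t z) tau (tsum (nfam csc2') tau 0).
Proof.
  intros H. apply (is_cder_dom_tau _ _ _ _ _ e2_feq H).
  apply (is_cder_eq _ _ (0 + tsum (nfam csc2') tau 0)); [|ring].
  apply is_cder_plus; [apply is_cder_const|].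
  apply (is_cder_tsum_tau (fam csc2) (fam csc2')).
  - apply fam_decays_const, decays_csc2.
  - apply (fam_decays_mult_n csc2'), decays_csc2'.
  - apply H.
  - intros n a Ha. apply is_cder_csc2. auto.
  - intros n Hn. rewrite Cplus_0_l. apply multiple_not_int; auto. apply H.
Qed.

Lemma is_cder_wp_tau (tau z : C) : dom tau z ->
  is_cder (fun t => wp t z) tau (tsum (nfam csc2') tau z - tsum (nfam csc2') tau 0).
Proof.
  intros H.
  apply (is_cder_dom_tau wp (fun tau z => tsum (fam csc2) tau z - e2 tau z)); auto.
  { intros t y Hd. rewrite wp_feq, e2_feq; auto. }
  apply is_cder_minus; [|apply is_cder_e2_tau; auto].
  apply dom_iff in H. destruct H as [Hy Hz].
  apply (is_cder_tsum_tau (fam csc2) (fam csc2')); auto.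
  - apply fam_decays_const, decays_csc2.
  - apply (fam_decays_mult_n csc2'), decays_csc2'.
  - intros n a Ha. apply is_cder_csc2. auto.
Qed.

Lemma is_cder_dwp_tau (tau z : C) : dom tau z ->
  is_cder (fun t => dz wp t z) tau (tsum (nfam csc2'') tau z).
Proof.
  intros H. apply (is_cder_dom_tau _ _ _ _ _ dz_wp_feq H).
  apply dom_iff in H. destruct H as [Hy Hz].
  apply (is_cder_tsum_tau (fam csc2') (fam csc2'')); auto.
  - apply fam_decays_const, decays_csc2'.
  - apply (fam_decays_mult_n csc2''), decays_csc2''.
  - intros n a Ha. apply is_cder_csc2'. auto.
Qed.

Lemma is_cder_Eis1_z (tau z : C) : dom tau z ->
  is_cder (Eis1 tau) z (- (wp tau z + e2 tau z)).
Proof.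
  intros H. apply (is_cder_dom_z Eis1 (tsum cotr)); auto.
  { intros t y Hd. apply Eis1_tsum. auto. }
  rewrite wp_feq, e2_feq by auto.
  apply dom_iff in H. destruct H as [Hy Hz].
  apply (is_cder_eq _ _ (tsum (fam (fun a => - csc2 a)) tau z)).
  - apply is_cder_tsum_z; auto using fam_decays_cotr, fam_decays_opp_csc2.
    intros n a Ha. unfold fam. apply (is_cder_eq _ _ (- csc2 a + 0)); [|ring].
    apply is_cder_plus; [apply is_cder_cotp; auto | apply is_cder_const].
  - apply usum_unique.
    apply (is_usum_ext (fun n => - (1) * csc2 (z + IZR n * tau))); [intros; unfold fam; ring|].
    apply (is_usum_eq _ (- (1) * tsum (fam csc2) tau z)); [|cbv beta; ring].
    apply is_usum_scal, (is_usum_tsum (fam csc2)); auto.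
    apply fam_decays_const, decays_csc2.
Qed.

(* Up to the factor -4, multiplication by [2 * PI * Ci] is the normalization
   of [dtau]; the sums over [nfam] are the derivatives in tau. *)
Lemma dtau_e2 (tau z : C) : dom tau z ->
  2 * PI * Ci * tsum (nfam csc2') tau 0 = 5 * e4 tau z - e2 tau z ^ 2.
Proof.
  intros H. pose proof (tsum_csc2_sqr_0 tau (proj1 H)) as R0.
  rewrite (e4_tsum tau z (proj1 H)), e2_feq by auto.
  set (G := tsum (fam csc2) tau 0) in *. set (G2 := tsum (fam csc2'') tau 0) in *.
  replace (2 * PI * Ci * tsum (nfam csc2') tau 0) with
    (5 * ((G2 + 4 * PI ^ 2 * G) / 6) - 4 * PI ^ 2 * G -
     (5 * ((G2 + 4 * PI ^ 2 * G) / 6) - 4 * PI ^ 2 * G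
      - 2 * PI * Ci * tsum (nfam csc2') tau 0)) by ring.
  rewrite <- R0. field.
Qed.

(** The derivative of the Weierstrass equation, with g2 = 60 e4; it results from [tsum_csc2_sqr]
    when the tau-derivative of e2 is eliminated by [dtau_e2]. *)
Lemma dz_dz_wp (tau z : C) : dom tau z ->
  tsum (fam csc2'') tau z = 6 * wp tau z ^ 2 - 30 * e4 tau z.
Proof.
  intros H. pose proof (dtau_e2 tau z H) as R0. pose proof H as H'.
  apply dom_iff in H. destruct H as [Hy Hz].
  pose proof (tsum_csc2_sqr tau Hy z Hz) as R1.
  rewrite R0, (e2_feq tau z H') in R1. rewrite (wp_feq tau z H').
  set (E := tsum (fam csc2) tau z) in *. set (G := tsum (fam csc2) tau 0) in *.
  set (E2 := tsum (fam csc2'') tau z) in *.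
  replace E2 with (6 * (E ^ 2 - (E ^ 2 - (E2 + 4 * PI ^ 2 * E) / 6)) - 4 * PI ^ 2 * E) by field.
  rewrite R1. field.
Qed.

Lemma dtau_tsum_csc2 (tau z : C) : dom tau z ->
  2 * PI * Ci * tsum (nfam csc2') tau z =
  Eis1 tau z * dz wp tau z + 2 * (wp tau z + e2 tau z) ^ 2
  - 6 * e2 tau z * (wp tau z + e2 tau z) - 3 * (5 * e4 tau z - e2 tau z ^ 2).
Proof.
  intros H. pose proof (dtau_e2 tau z H) as R0. pose proof (dz_dz_wp tau z H) as R3. pose proof H as H'.
  apply dom_iff in H. destruct H as [Hy Hz].
  pose proof (tsum_cot_csc2' tau Hy z Hz) as R2.
  rewrite <- Eis1_tsum, <- (dz_wp_feq tau z H'), R0, R3 in R2 by auto.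
  assert (EE : tsum (fam csc2) tau z = wp tau z + e2 tau z).
  { rewrite wp_feq, e2_feq by auto. ring. }
  assert (EG : tsum (fam csc2) tau 0 = e2 tau z - PI ^ 2 / 3).
  { rewrite e2_feq by auto. ring. }
  rewrite EE, EG in R2. rewrite R2. field.
Qed.

Lemma is_cder_scal_unique (f : C -> C) (c x l k : C) :
  is_cder f x l -> is_cder (fun y => c * f y) x k -> c * l = k.
Proof.
  intros H1 H2. apply (is_cder_unique (fun y => c * f y) x); auto. apply is_cder_scal. auto.
Qed.

Lemma is_cder_nfam_z (f f' : C -> C) (tau z : C) : decays f -> decays f' ->
  (forall a, ~ is_int a -> is_cder f a (f' a)) -> dom tau z ->
  is_cder (tsum (nfam f) tau) z (tsum (nfam f') tau z).
Proof.
  intros Hf Hf' HD H. apply dom_iff in H. destruct H as [Hy Hz].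
  apply is_cder_tsum_z; auto.
  - apply fam_decays_mult_n. auto.
  - apply fam_decays_mult_n. auto.
  - intros n a Ha. apply is_cder_scal. auto.
Qed.

Lemma is_cder_e2_z (tau z : C) : is_cder (e2 tau) z 0.
Proof. apply (is_cder_ext (fun _ => e2 tau 0)); [reflexivity | apply is_cder_const]. Qed.

Lemma is_cder_e4_z (tau z : C) : is_cder (e4 tau) z 0.
Proof. apply (is_cder_ext (fun _ => e4 tau 0)); [reflexivity | apply is_cder_const]. Qed.

Lemma is_cder_sqr (f : C -> C) (x l : C) : is_cder f x l -> is_cder (fun y => f y ^ 2) x (2 * f x * l).
Proof.
  intros H. apply (is_cder_eq _ _ (l * f x + f x * l)); [|ring].
  apply (is_cder_ext (fun y => f y * f y)); [intros; ring|]. apply is_cder_mult; auto.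
Qed.

Lemma is_cder_dwp_z (tau z : C) : dom tau z ->
  is_cder (dz wp tau) z (6 * wp tau z ^ 2 - 30 * e4 tau z).
Proof. intros H. rewrite <- dz_dz_wp by auto. apply is_cder_dwp_z_tsum. auto. Qed.

Lemma is_cder_wp_z (tau z : C) : dom tau z -> is_cder (wp tau) z (dz wp tau z).
Proof. intros H. rewrite (dz_wp_feq tau z H). apply is_cder_wp_z_tsum. auto. Qed.

(** The z-derivative of [dtau_tsum_csc2]: on the left it may be taken under the sum, on the right it
    uses E1' = -(wp + e2) and the formula for wp''. *)
Lemma dtau_dz_wp (tau z : C) : dom tau z ->
  2 * PI * Ci * tsum (nfam csc2'') tau z =
  Eis1 tau z * (6 * wp tau z ^ 2 - 30 * e4 tau z) + 3 * (wp tau z + e2 tau z) * dz wp tau z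
  - 6 * e2 tau z * dz wp tau z.
Proof.
  intros H. apply (is_cder_scal_unique (tsum (nfam csc2') tau) _ z).
  - apply is_cder_nfam_z; auto using decays_csc2', decays_csc2'', is_cder_csc2'.
  - destruct (dom_open_z tau z H) as [r Hr].
    apply (is_cder_ext_loc (fun y => Eis1 tau y * dz wp tau y + 2 * (wp tau y + e2 tau y) ^ 2
      - 6 * e2 tau y * (wp tau y + e2 tau y) - 3 * (5 * e4 tau y - e2 tau y ^ 2)) _ _ _ r).
    { intros y Hy. symmetry. apply dtau_tsum_csc2. auto. }
    pose proof (is_cder_wp_z tau z H) as D1. pose proof (is_cder_e2_z tau z) as D2.
    pose proof (is_cder_plus _ _ _ _ _ D1 D2) as D3. simpl in D3.
    eapply is_cder_eq.
    + apply is_cder_minus; [apply is_cder_minus; [apply is_cder_plus|]|].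
      * apply is_cder_mult; [apply is_cder_Eis1_z; auto | apply is_cder_dwp_z; auto].
      * apply is_cder_scal, is_cder_sqr, D3.
      * apply (is_cder_mult (fun y => 6 * e2 tau y)); [apply is_cder_scal, D2 | apply D3].
      * apply is_cder_scal, is_cder_minus; [apply is_cder_scal, is_cder_e4_z | apply is_cder_sqr, D2].
    + cbv beta. ring.
Qed.

Lemma dtau_dz_dz_wp (tau z : C) : dom tau z ->
  2 * PI * Ci * tsum (nfam csc2''') tau z =
  12 * Eis1 tau z * wp tau z * dz wp tau z
  + 2 * (wp tau z + e2 tau z) * (6 * wp tau z ^ 2 - 30 * e4 tau z) + 3 * dz wp tau z ^ 2
  - 6 * e2 tau z * (6 * wp tau z ^ 2 - 30 * e4 tau z).
Proof.
  intros H. apply (is_cder_scal_unique (tsum (nfam csc2'') tau) _ z).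
  - apply is_cder_nfam_z; auto using decays_csc2''', decays_csc2'', is_cder_csc2''.
  - destruct (dom_open_z tau z H) as [r Hr].
    apply (is_cder_ext_loc (fun y => Eis1 tau y * (6 * wp tau y ^ 2 - 30 * e4 tau y)
      + 3 * (wp tau y + e2 tau y) * dz wp tau y - 6 * e2 tau y * dz wp tau y) _ _ _ r).
    { intros y Hy. symmetry. apply dtau_dz_wp. auto. }
    pose proof (is_cder_wp_z tau z H) as D1. pose proof (is_cder_e2_z tau z) as D2.
    pose proof (is_cder_plus _ _ _ _ _ D1 D2) as D3. simpl in D3.
    pose proof (is_cder_dwp_z tau z H) as D4.
    eapply is_cder_eq.
    + apply is_cder_minus; [apply is_cder_plus|].
      * apply (is_cder_mult (Eis1 tau) (fun y => 6 * wp tau y ^ 2 - 30 * e4 tau y));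
          [apply is_cder_Eis1_z; auto|].
        apply is_cder_minus; apply is_cder_scal; [apply is_cder_sqr, D1 | apply is_cder_e4_z].
      * apply (is_cder_mult (fun y => 3 * (wp tau y + e2 tau y))); [apply is_cder_scal, D3 | apply D4].
      * apply (is_cder_mult (fun y => 6 * e2 tau y)); [apply is_cder_scal, D2 | apply D4].
    + ring.
Qed.

(** The two derivatives are carried as witnesses, so that differentiability is known along with the
    value of d, as the product rule requires. *)
Definition has_dJ (f : jfun) (tau z v : C) : Prop := exists lz lt : C,
  is_cder (f tau) z lz /\ is_cder (fun t => f t z) tau lt /\
  PI / (2 * Ci) * lt + 1 / 4 * (Eis1 tau z * lz) = v.

Lemma dJ_factor (l : C) : PI / (2 * Ci) * l = - (2 * PI * Ci * l) / 4.
Proof.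
  assert (E : / Ci = - Ci) by apply Ci_inv. unfold Cdiv.
  replace (/ (2 * Ci)) with (/ 2 * / Ci) by (field; apply Ci_nz). rewrite E. field.
Qed.

Lemma has_dJ_wp (tau z : C) : dom tau z ->
  has_dJ wp tau z (/ 2 * (e2 tau z * wp tau z) + (- / 2 * (wp tau z * wp tau z) + 5 * e4 tau z)).
Proof.
  intros H. eexists. eexists. split; [apply is_cder_wp_z; auto|].
  split; [apply is_cder_wp_tau; auto|]. rewrite dJ_factor.
  replace (2 * PI * Ci * (tsum (nfam csc2') tau z - tsum (nfam csc2') tau 0))
    with (2 * PI * Ci * tsum (nfam csc2') tau z - 2 * PI * Ci * tsum (nfam csc2') tau 0) by ring.
  rewrite (dtau_tsum_csc2 tau z H), (dtau_e2 tau z H). field.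
Qed.

Lemma has_dJ_dwp (tau z : C) : dom tau z ->
  has_dJ (dz wp) tau z (3 / 4 * (e2 tau z * dz wp tau z) + - (3) / 4 * (wp tau z * dz wp tau z)).
Proof.
  intros H. eexists. eexists. split; [apply is_cder_dwp_z; auto|].
  split; [apply is_cder_dwp_tau; auto|]. rewrite dJ_factor, (dtau_dz_wp tau z H). field.
Qed.

Lemma has_dJ_e2 (tau z : C) : dom tau z ->
  has_dJ e2 tau z (/ 4 * (e2 tau z * e2 tau z) + - (5) / 4 * e4 tau z).
Proof.
  intros H. eexists. eexists. split; [apply is_cder_e2_z; auto|].
  split; [apply is_cder_e2_tau; auto|]. rewrite dJ_factor, (dtau_e2 tau z H). field.
Qed.

(** Obtained from e4 = (6 wp^2 - wp'')/30, so that the sum of inverse sixth powers never has to be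
    introduced. With wp'^2 = 4 wp^3 - 60 e4 wp - 140 e6 the result is the formula e2 e4 - 7/2 e6 of
    Ramanujan. *)
Lemma has_dJ_e4 (tau z : C) : dom tau z ->
  has_dJ e4 tau z (e2 tau z * e4 tau z + (- (1) / 10 * (wp tau z * (wp tau z * wp tau z))
    + (3 / 2 * (wp tau z * e4 tau z) + / 40 * (dz wp tau z * dz wp tau z)))).
Proof.
  intros H. eexists. exists (/ 30 * (6 * (2 * wp tau z *
    (tsum (nfam csc2') tau z - tsum (nfam csc2') tau 0)) - tsum (nfam csc2''') tau z)).
  split; [apply is_cder_e4_z; auto|]. split.
  - apply (is_cder_dom_tau e4 (fun t y => / 30 * (6 * wp t y ^ 2 - tsum (fam csc2'') t y))); auto.
    { intros t y Hd. rewrite dz_dz_wp by auto. field. }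
    apply is_cder_scal, is_cder_minus.
    + apply is_cder_scal, (is_cder_sqr (fun t => wp t z)), is_cder_wp_tau. auto.
    + apply dom_iff in H. destruct H as [Hy Hz].
      apply (is_cder_tsum_tau (fam csc2'') (fam csc2''')); auto.
      * apply fam_decays_const, decays_csc2''.
      * apply (fam_decays_mult_n csc2'''), decays_csc2'''.
      * intros n a Ha. apply is_cder_csc2''. auto.
  - rewrite dJ_factor.
    replace (2 * PI * Ci * (/ 30 * (6 * (2 * wp tau z *
      (tsum (nfam csc2') tau z - tsum (nfam csc2') tau 0)) - tsum (nfam csc2''') tau z)))
      with (/ 30 * (12 * wp tau z * (2 * PI * Ci * tsum (nfam csc2') tau z
        - 2 * PI * Ci * tsum (nfam csc2') tau 0) - 2 * PI * Ci * tsum (nfam csc2''') tau z)) by ring.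
    rewrite (dtau_tsum_csc2 tau z H), (dtau_e2 tau z H), (dtau_dz_dz_wp tau z H). field.
Qed.

(** * Formal polynomials *)

(* Polynomials in wp, its derivative, e4 and e2 (in this order). The last
   variable is the only one that does not belong to JS; the derivation [jD]
   is d and [jT] is the partial derivative with respect to that variable. *)
Inductive jexp : Type :=
| jX | jY | jZ | jE
| jC (c : C)
| jA (a b : jexp)
| jM (a b : jexp).

Fixpoint jev (x y z t : C) (e : jexp) : C :=
  match e with
  | jX => x | jY => y | jZ => z | jE => t
  | jC c => c
  | jA a b => jev x y z t a + jev x y z t b
  | jM a b => jev x y z t a * jev x y z t b
  end.

Fixpoint jD (e : jexp) : jexp :=
  match e with
  | jX => jA (jM (jC (/ 2)) (jM jE jX)) (jA (jM (jC (- / 2)) (jM jX jX)) (jM (jC 5) jZ))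
  | jY => jA (jM (jC (3 / 4)) (jM jE jY)) (jM (jC (- (3) / 4)) (jM jX jY))
  | jZ => jA (jM jE jZ) (jA (jM (jC (- (1) / 10)) (jM jX (jM jX jX)))
      (jA (jM (jC (3 / 2)) (jM jX jZ)) (jM (jC (/ 40)) (jM jY jY))))
  | jE => jA (jM (jC (/ 4)) (jM jE jE)) (jM (jC (- (5) / 4)) jZ)
  | jC _ => jC 0
  | jA a b => jA (jD a) (jD b)
  | jM a b => jA (jM (jD a) b) (jM a (jD b))
  end.

Fixpoint jT (e : jexp) : jexp :=
  match e with
  | jE => jC 1
  | jA a b => jA (jT a) (jT b)
  | jM a b => jA (jM (jT a) b) (jM a (jT b))
  | _ => jC 0
  end.

Fixpoint jpure (e : jexp) : Prop :=
  match e with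
  | jE => False
  | jA a b | jM a b => jpure a /\ jpure b
  | _ => True
  end.

(** Zero is given every weight because [jD] sends a constant to [jC 0] and must raise weights by
    2. *)
Inductive jwt : nat -> jexp -> Prop :=
| jwt_X : jwt 2 jX
| jwt_Y : jwt 3 jY
| jwt_Z : jwt 4 jZ
| jwt_E : jwt 2 jE
| jwt_C c : jwt 0 (jC c)
| jwt_0 k : jwt k (jC 0)
| jwt_A k a b : jwt k a -> jwt k b -> jwt k (jA a b)
| jwt_M k l m a b : jwt k a -> jwt l b -> m = (k + l)%nat -> jwt m (jM a b).

Lemma jwt_jD (k : nat) (e : jexp) : jwt k e -> jwt (k + 2) (jD e).
Proof.
  intros H. induction H; simpl.
  - repeat eapply jwt_A; repeat (eapply jwt_M; try constructor); reflexivity.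
  - repeat eapply jwt_A; repeat (eapply jwt_M; try constructor); reflexivity.
  - repeat eapply jwt_A; repeat (eapply jwt_M; try constructor); reflexivity.
  - repeat eapply jwt_A; repeat (eapply jwt_M; try constructor); reflexivity.
  - apply jwt_0.
  - apply jwt_0.
  - apply jwt_A; auto.
  - apply jwt_A; eapply jwt_M; eauto; lia.
Qed.

Definition jeq (a b : jexp) : Prop := forall x y z t, jev x y z t a = jev x y z t b.

(** [jD] is the derivative along a vector field: its value at a point is the derivative of e along
    the line whose velocity is given by [jD] of the generators. Hence it respects [jeq], although it
    is defined by recursion on the syntax. *)
Lemma jD_curve (x y z t : C) (e : jexp) :
  is_cder (fun s => jev (x + s * jev x y z t (jD jX)) (y + s * jev x y z t (jD jY))
    (z + s * jev x y z t (jD jZ)) (t + s * jev x y z t (jD jE)) e) 0 (jev x y z t (jD e)).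
Proof.
  assert (L : forall u v, is_cder (fun s => u + s * v) 0 v).
  { intros u v. apply (is_cder_eq _ _ (0 + (1 * v + 0 * 0))); [|ring].
    apply is_cder_plus; [apply is_cder_const|].
    apply (is_cder_mult (fun s => s) (fun _ => v)); [apply is_cder_id | apply is_cder_const]. }
  induction e as [| | | |c|a IHa b IHb|a IHa b IHb].
  - apply L.
  - apply L.
  - apply L.
  - apply L.
  - exact (is_cder_const c 0).
  - apply (is_cder_plus _ _ _ _ _ IHa IHb).
  - eapply is_cder_eq; [apply (is_cder_mult _ _ _ _ _ IHa IHb)|].
    cbv beta. rewrite !Cmult_0_l, !Cplus_0_r. reflexivity.
Qed.

Lemma jD_jeq (a b : jexp) : jeq a b -> jeq (jD a) (jD b).
Proof.
  intros H x y z t. eapply is_cder_unique; [apply jD_curve|].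
  eapply is_cder_ext; [|apply jD_curve]. intros s. symmetry. apply H.
Qed.

Lemma jT_is_cder (x y z t : C) (e : jexp) :
  is_cder (fun t => jev x y z t e) t (jev x y z t (jT e)).
Proof.
  induction e as [| | | |c|a IHa b IHb|a IHa b IHb].
  - exact (is_cder_const x t).
  - exact (is_cder_const y t).
  - exact (is_cder_const z t).
  - exact (is_cder_id t).
  - exact (is_cder_const c t).
  - apply (is_cder_plus _ _ _ _ _ IHa IHb).
  - apply (is_cder_mult _ _ _ _ _ IHa IHb).
Qed.

(** The commutator of d/dT and d is a derivation, so it is enough to know it on generators. On wp,
    wp' and e4, d is a quarter of the weight times e2, up to terms free of e2; on e2 it is e2^2/4 up
    to such terms, with T-derivative e2/2. *)
Lemma jT_jD (k : nat) (e : jexp) : jwt k e ->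
  jeq (jT (jD e)) (jA (jD (jT e)) (jM (jC (INR k / 4)) e)).
Proof.
  intros H x y z t. induction H; simpl jev; simpl INR; rewrite ?RtoC_plus.
  - field.
  - field.
  - field.
  - field.
  - field.
  - field.
  - simpl jev in *. rewrite IHjwt1, IHjwt2. field.
  - simpl jev in *. rewrite IHjwt1, IHjwt2. subst m. rewrite plus_INR, RtoC_plus. field.
Qed.

Lemma jT_pure (e : jexp) : jpure e -> jeq (jT e) (jC 0).
Proof.
  intros H x y z t. induction e as [| | | |c|a IHa b IHb|a IHa b IHb]; simpl in *; try tauto.
  - rewrite IHa, IHb by tauto. ring.
  - rewrite IHa, IHb by tauto. ring.
Qed.

Lemma jwt_iter (k r : nat) (e : jexp) : jwt k e -> jwt (k + 2 * r) (Nat.iter r jD e).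
Proof.
  intros H. induction r as [|r IH].
  - rewrite Nat.mul_0_r, Nat.add_0_r. auto.
  - simpl Nat.iter. replace (k + 2 * S r)%nat with (k + 2 * r + 2)%nat by lia.
    apply jwt_jD. auto.
Qed.

(* The lowering rule of the sl(2)-action. *)
Lemma jT_iter (k : nat) (e : jexp) : jwt k e -> jpure e -> forall r,
  jeq (jT (Nat.iter (S r) jD e)) (jM (jC (INR (S r) * INR (k + r) / 4)) (Nat.iter r jD e)).
Proof.
  intros Hk Hp r x y z t.
  change (Nat.iter (S r) jD e) with (jD (Nat.iter r jD e)).
  rewrite (jT_jD _ _ (jwt_iter k r e Hk)). cbn [jev]. revert x y z t.
  induction r as [|r IH]; intros x y z t.
  - rewrite (jD_jeq _ _ (jT_pure e Hp)). simpl. rewrite !Nat.add_0_r. field.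
  - assert (IH' : jeq (jT (Nat.iter (S r) jD e))
      (jM (jC (INR (S r) * INR (k + r) / 4)) (Nat.iter r jD e))).
    { intros x' y' z' t'. change (Nat.iter (S r) jD e) with (jD (Nat.iter r jD e)).
      rewrite (jT_jD _ _ (jwt_iter k r e Hk)). apply IH. }
    rewrite (jD_jeq _ _ IH'). cbn [jD jev].
    change (jD (Nat.iter r jD e)) with (Nat.iter (S r) jD e).
    set (v := jev x y z t (Nat.iter (S r) jD e)).
    repeat (rewrite ?plus_INR, ?mult_INR, ?S_INR). change (INR 0) with 0%R.
    repeat (rewrite ?RtoC_plus, ?RtoC_mult). field.
Qed.

(** * The brackets *)

Definition rc_coef (n k l r : nat) : C :=
  (- (1)) ^ r * INR (binomial.binomial (k + n - 1) (n - r)) *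
  INR (binomial.binomial (l + n - 1) r).

Lemma binomial_succ (m i : nat) :
  (S i * binomial.binomial m (S i) = (m - i) * binomial.binomial m i)%nat.
Proof. exact (binomial.mul_bin_left m i). Qed.

(** The cancellation between neighbouring terms of the T-derivative of the bracket: both products
    contain d^r of the first argument and d^(n-r-1) of the second. This is what fixes the ratios of
    the coefficients. *)
Lemma rc_coef_succ (n k l r : nat) : (S r <= n)%nat ->
  rc_coef n k l (S r) * (INR (S r) * INR (k + r) / 4) +
  rc_coef n k l r * (INR (n - r) * INR (l + (n - S r)) / 4) = 0.
Proof.
  intros Hr. unfold rc_coef.
  assert (E1 : (INR (S r) * INR (binomial.binomial (l + n - 1) (S r)) =
    INR (l + (n - S r)) * INR (binomial.binomial (l + n - 1) r))%R).
  { rewrite <- !mult_INR, binomial_succ. f_equal. f_equal. lia. }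
  assert (E2 : (INR (n - r) * INR (binomial.binomial (k + n - 1) (n - r)) =
    INR (k + r) * INR (binomial.binomial (k + n - 1) (n - S r)))%R).
  { replace (n - r)%nat with (S (n - S r)) by lia.
    rewrite <- !mult_INR, binomial_succ. f_equal. f_equal. lia. }
  apply (f_equal RtoC) in E1. apply (f_equal RtoC) in E2. rewrite !RtoC_mult in E1, E2.
  change ((- (1)) ^ S r) with (- (1) * (- (1)) ^ r).
  set (B1 := RtoC (INR (binomial.binomial (l + n - 1) (S r)))) in *.
  set (B2 := RtoC (INR (binomial.binomial (l + n - 1) r))) in *.
  set (A1 := RtoC (INR (binomial.binomial (k + n - 1) (n - S r)))) in *.
  set (A2 := RtoC (INR (binomial.binomial (k + n - 1) (n - r)))) in *.
  transitivity ((- (1)) ^ r / 4 * ((INR (n - r) * A2) * B2 * INR (l + (n - S r))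
    - A1 * INR (k + r) * (INR (S r) * B1))); [field|].
  rewrite E1, E2. field.
Qed.

Lemma is_cder_sum_n (f : nat -> C -> C) (d : nat -> C) (x : C) (n : nat) :
  (forall r, is_cder (f r) x (d r)) -> is_cder (fun y => sum_n (fun r => f r y) n) x (sum_n d n).
Proof.
  intros H. induction n as [|n IH].
  - apply (is_cder_ext (f 0%nat)); [intros; rewrite sum_O; reflexivity|].
    rewrite sum_O. auto.
  - apply (is_cder_ext (fun y => sum_n (fun r => f r y) n + f (S n) y)).
    { intros y. rewrite sum_Sn. reflexivity. }
    rewrite sum_Sn. apply (is_cder_plus (fun y => sum_n (fun r => f r y) n)); auto.
Qed.

Section Bracket.

Variables (n k l : nat) (e e' : jexp).
Hypotheses (Hk : jwt k e) (Hl : jwt l e') (Hp : jpure e) (Hp' : jpure e').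

(** The bracket with e2 replaced by a free variable t. *)
Definition rc_poly (x y z t : C) : C :=
  sum_n (fun r => rc_coef n k l r *
    (jev x y z t (Nat.iter r jD e) * jev x y z t (Nat.iter (n - r) jD e'))) n.

Lemma rc_poly_is_cder (x y z t : C) : is_cder (rc_poly x y z) t 0.
Proof.
  set (F := fun r => jev x y z t (Nat.iter r jD e)).
  set (G := fun r => jev x y z t (Nat.iter r jD e')).
  set (d := fun r => rc_coef n k l r *
    (jev x y z t (jT (Nat.iter r jD e)) * G (n - r)%nat +
     F r * jev x y z t (jT (Nat.iter (n - r) jD e')))).
  apply (is_cder_eq _ _ (sum_n d n)).
  { apply is_cder_sum_n. intros r. apply is_cder_scal.
    apply (is_cder_mult (fun t => jev x y z t (Nat.iter r jD e)));
      apply jT_is_cder. }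
  (* At r = n both sides are 0: the left because e' is free of e2, the right because of the factor n
     - r, so that the truncation of [n - S r] does no harm. *)
  assert (HG : forall r, (r <= n)%nat -> F r * jev x y z t (jT (Nat.iter (n - r) jD e')) =
    INR (n - r) * INR (l + (n - S r)) / 4 * (F r * G (n - S r)%nat)).
  { intros r Hr. destruct (Nat.eq_dec r n) as [->|Hn].
    - rewrite Nat.sub_diag. simpl Nat.iter. rewrite jT_pure by auto. simpl. field.
    - replace (n - r)%nat with (S (n - S r)) by lia. rewrite (jT_iter l) by auto.
      cbn [jev]. fold (G (n - S r)%nat). field. }
  (* Each summand of d has two halves, by the product rule. The first half at r = 0 vanishes, as e
     is free of e2, and each later one cancels the second half before it. What is left is the second
     half at m, whose factor n - m vanishes at m = n. *)
  assert (T : forall m, (m <= n)%nat -> @eq C (sum_n d m)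
    (rc_coef n k l m * (INR (n - m) * INR (l + (n - S m)) / 4) * (F m * G (n - S m)%nat))).
  { induction m as [|m IH]; intros Hm.
    - rewrite sum_O. unfold d. rewrite HG by lia. simpl Nat.iter at 1.
      rewrite jT_pure by auto. simpl jev. ring.
    - rewrite sum_Sn, IH by lia. unfold d. rewrite HG by lia. rewrite (jT_iter k) by auto.
      cbn [jev]. fold (F m). change plus with Cplus.
      transitivity ((rc_coef n k l (S m) * (INR (S m) * INR (k + m) / 4) +
        rc_coef n k l m * (INR (n - m) * INR (l + (n - S m)) / 4)) * (F m * G (n - S m)%nat)
        + rc_coef n k l (S m) * (INR (n - S m) * INR (l + (n - S (S m))) / 4)
          * (F (S m) * G (n - S (S m))%nat)).
      + ring.
      + rewrite rc_coef_succ by auto. ring. }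
  rewrite T by auto. rewrite Nat.sub_diag. simpl INR. field.
Qed.

Lemma rc_poly_indep (x y z t : C) : rc_poly x y z t = rc_poly x y z 0.
Proof.
  apply Ceq_minus, Cmod_eq_0. apply Rle_antisym; [|apply Cmod_ge_0].
  apply Rle_trans with (0 * Cmod (t - 0))%R; [|lra].
  apply (is_cder_mean_value (rc_poly x y z) (fun _ => 0)). intros u Hu. split.
  - apply rc_poly_is_cder.
  - rewrite Cmod_0. lra.
Qed.

End Bracket.

Definition jfunc (e : jexp) : jfun := fun tau z =>
  jev (wp tau z) (dz wp tau z) (e4 tau z) (e2 tau z) e.

Lemma has_dJ_jfunc (e : jexp) (tau z : C) : dom tau z ->
  has_dJ (jfunc e) tau z (jfunc (jD e) tau z).
Proof.
  intros H. induction e as [| | | |c|a IHa b IHb|a IHa b IHb].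
  - apply has_dJ_wp. auto.
  - apply has_dJ_dwp. auto.
  - apply has_dJ_e4. auto.
  - apply has_dJ_e2. auto.
  - exists 0, 0. split; [exact (is_cder_const c z)|]. split; [exact (is_cder_const c tau)|].
    unfold jfunc. simpl. ring.
  - destruct IHa as [a1 [a2 [A1 [A2 A3]]]]. destruct IHb as [b1 [b2 [B1 [B2 B3]]]].
    exists (a1 + b1), (a2 + b2). split; [apply (is_cder_plus _ _ _ _ _ A1 B1)|].
    split; [apply (is_cder_plus _ _ _ _ _ A2 B2)|].
    change (jfunc (jD (jA a b)) tau z) with (jfunc (jD a) tau z + jfunc (jD b) tau z).
    rewrite <- A3, <- B3. ring.
  - destruct IHa as [a1 [a2 [A1 [A2 A3]]]]. destruct IHb as [b1 [b2 [B1 [B2 B3]]]].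
    eexists. eexists. split; [apply (is_cder_mult _ _ _ _ _ A1 B1)|].
    split; [apply (is_cder_mult _ _ _ _ _ A2 B2)|].
    change (jfunc (jD (jM a b)) tau z) with
      (jfunc (jD a) tau z * jfunc b tau z + jfunc a tau z * jfunc (jD b) tau z).
    rewrite <- A3, <- B3. ring.
Qed.

(** Equality on [dom] is enough to compare derivatives, because [dom] is open in each variable. *)
Lemma dJ_feq_jfunc (f : jfun) (e : jexp) : feq f (jfunc e) -> feq (dJ f) (jfunc (jD e)).
Proof.
  intros Hf tau z H. destruct (has_dJ_jfunc e tau z H) as [lz [lt [H1 [H2 H3]]]].
  rewrite <- H3. unfold dJ, fadd, fscal, fmul, dtau, dz.
  rewrite (is_cder_C_derive (f tau) z lz) by (apply (is_cder_dom_z f (jfunc e)); auto).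
  rewrite (is_cder_C_derive (fun t => f t z) tau lt)
    by (apply (is_cder_dom_tau f (jfunc e)); auto).
  reflexivity.
Qed.

Lemma iter_dJ_jfunc (r : nat) (e : jexp) :
  feq (Nat.iter r dJ (jfunc e)) (jfunc (Nat.iter r jD e)).
Proof.
  induction r as [|r IH]; [intros tau z _; reflexivity|]. apply dJ_feq_jfunc, IH.
Qed.

Lemma feq_sym (f g : jfun) : feq f g -> feq g f.
Proof. intros H tau z Hd. symmetry. auto. Qed.

Lemma JS_jev_0 (e : jexp) : JS (fun tau z => jev (wp tau z) (dz wp tau z) (e4 tau z) 0 e).
Proof.
  induction e as [| | | |c|a IHa b IHb|a IHa b IHb].
  - apply subalg_gen, JS_gen_wp.
  - apply subalg_gen, JS_gen_dwp.
  - apply subalg_gen, JS_gen_e4.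
  - apply (subalg_const _ 0).
  - apply (subalg_const _ c).
  - apply (subalg_add _ _ _ IHa IHb).
  - apply (subalg_mul _ _ _ IHa IHb).
Qed.

Lemma JS_sum_n (f : nat -> jfun) (n : nat) : (forall r, JS (f r)) ->
  JS (fun tau z => sum_n (fun r => f r tau z) n).
Proof.
  intros H. induction n as [|n IH].
  - apply (subalg_feq _ (f 0%nat)); [|apply H]. intros tau z _. rewrite sum_O. reflexivity.
  - apply (subalg_feq _ (fadd (fun tau z => sum_n (fun r => f r tau z) n) (f (S n)))).
    + intros tau z _. rewrite sum_Sn. reflexivity.
    + apply subalg_add; [apply IH | apply H].
Qed.

Lemma JS_RC (n k l : nat) (e e' : jexp) :
  jwt k e -> jwt l e' -> jpure e -> jpure e' -> JS (RC n k l (jfunc e) (jfunc e')).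
Proof.
  intros Hk Hl Hp Hp'.
  apply (subalg_feq _ (fun tau z =>
    rc_poly n k l e e' (wp tau z) (dz wp tau z) (e4 tau z) 0)).
  - intros tau z H. rewrite <- (rc_poly_indep n k l e e' Hk Hl Hp Hp' _ _ _ (e2 tau z)).
    unfold rc_poly, RC. apply sum_n_ext_loc. intros r Hr.
    rewrite (iter_dJ_jfunc r e tau z H), (iter_dJ_jfunc (n - r) e' tau z H). reflexivity.
  - unfold rc_poly. apply (JS_sum_n (fun r tau z => rc_coef n k l r *
      (jev (wp tau z) (dz wp tau z) (e4 tau z) 0 (Nat.iter r jD e) *
       jev (wp tau z) (dz wp tau z) (e4 tau z) 0 (Nat.iter (n - r) jD e')))).
    intros r. apply (subalg_mul _ (fconst (rc_coef n k l r))); [apply subalg_const|].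
    apply (subalg_mul _ _ _ (JS_jev_0 (Nat.iter r jD e)) (JS_jev_0 (Nat.iter (n - r) jD e'))).
Qed.

(** * Decomposition into weight components *)

(** [JSinf_wt] has constants only in weight 0; the zero function reaches every weight as a multiple
    of [Eis1], the generator of weight 1. *)
Lemma JSinf_wt_0 (k : nat) : JSinf_wt k (fconst 0).
Proof.
  induction k as [|k IH]; [apply wt_const|].
  apply (wt_feq _ (fmul Eis1 (fconst 0))).
  - intros tau z _. unfold fmul, fconst. ring.
  - apply (wt_mul 1 k); auto. apply wt_gen, JSinf_gen_Eis1.
Qed.

Lemma JSinf_wt_jfunc (k : nat) (e : jexp) : jwt k e -> JSinf_wt k (jfunc e).
Proof.
  intros H. induction H.
  - apply wt_gen, JSinf_gen_wp.
  - apply wt_gen, JSinf_gen_dwp.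
  - apply wt_gen, JSinf_gen_e4.
  - apply wt_gen, JSinf_gen_e2.
  - apply (wt_const c).
  - apply (JSinf_wt_0 k).
  - apply (wt_add _ _ _ IHjwt1 IHjwt2).
  - subst m. apply (wt_mul _ _ _ _ IHjwt1 IHjwt2).
Qed.

Lemma JSinf_jfunc (e : jexp) : JSinf (jfunc e).
Proof.
  induction e as [| | | |c|a IHa b IHb|a IHa b IHb].
  - apply subalg_gen. exists 2%nat. apply JSinf_gen_wp.
  - apply subalg_gen. exists 3%nat. apply JSinf_gen_dwp.
  - apply subalg_gen. exists 4%nat. apply JSinf_gen_e4.
  - apply subalg_gen. exists 2%nat. apply JSinf_gen_e2.
  - apply (subalg_const _ c).
  - apply (subalg_add _ _ _ IHa IHb).
  - apply (subalg_mul _ _ _ IHa IHb).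
Qed.

(** The formula for the brackets is given on homogeneous elements only. This predicate writes an
    element of JS as a sum of such elements, each represented by an expression free of e2, and its
    induction principle is the shape in which bilinearity is applied. *)
Inductive JSsum : jfun -> Prop :=
| JSsum_hom k e : jpure e -> jwt k e -> JSsum (jfunc e)
| JSsum_add f g : JSsum f -> JSsum g -> JSsum (fadd f g)
| JSsum_feq f g : feq f g -> JSsum f -> JSsum g.

Lemma JSsum_mul (f g : jfun) : JSsum f -> JSsum g -> JSsum (fmul f g).
Proof.
  intros Hf Hg. revert f Hf. induction Hg as [l e' Hp' Hl|g g' _ IH1 _ IH2|g g' E _ IH]; intros f Hf.
  - induction Hf as [k e Hp Hk|f f' _ IH1 _ IH2|f f' E _ IH].
    + apply (JSsum_hom (k + l) (jM e e')); [split; auto|]. apply (jwt_M k l); auto.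
    + apply (JSsum_feq (fadd (fmul f (jfunc e')) (fmul f' (jfunc e')))).
      * intros tau z _. unfold fadd, fmul. ring.
      * apply JSsum_add; auto.
    + apply (JSsum_feq (fmul f (jfunc e'))); auto.
      intros tau z H. unfold fmul. rewrite E; auto.
  - apply (JSsum_feq (fadd (fmul f g) (fmul f g'))).
    + intros tau z _. unfold fadd, fmul. ring.
    + apply JSsum_add; auto.
  - apply (JSsum_feq (fmul f g)); auto. intros tau z H. unfold fmul. rewrite E; auto.
Qed.

Lemma JS_JSsum (f : jfun) : JS f -> JSsum f.
Proof.
  intros H. induction H as [f H|c|f g _ IH1 _ IH2|f g _ IH1 _ IH2|f g E _ IH].
  - destruct H.
    + apply (JSsum_hom 2 jX); [exact I | constructor].
    + apply (JSsum_hom 3 jY); [exact I | constructor].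
    + apply (JSsum_hom 4 jZ); [exact I | constructor].
  - apply (JSsum_hom 0 (jC c)); [exact I | constructor].
  - apply JSsum_add; auto.
  - apply JSsum_mul; auto.
  - apply (JSsum_feq f); auto.
Qed.

Lemma JSsum_JSinf (f : jfun) : JSsum f -> JSinf f.
Proof.
  intros H. induction H as [k e _ _|f g _ IH1 _ IH2|f g E _ IH].
  - apply JSinf_jfunc.
  - apply subalg_add; auto.
  - apply (subalg_feq _ f); auto.
Qed.

Lemma feq_refl (f : jfun) : feq f f.
Proof. intros tau z _. reflexivity. Qed.

Theorem theorem35 (br : nat -> jfun -> jfun -> jfun)
    (hbr : is_bilinear_extension br) (n : nat) (f g : jfun)
    (hf : JS f) (hg : JS g) :
  JS (br n f g).
Proof.
  apply JS_JSsum in hf. apply JS_JSsum in hg.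
  induction hf as [k e Hp Hk|f f' Hf IH1 Hf' IH2|f f' E Hf IH].
  - induction hg as [l e' Hp' Hl|g g' Hg IH1 Hg' IH2|g g' E Hg IH].
    + apply (subalg_feq _ (RC n k l (jfunc e) (jfunc e'))).
      * apply feq_sym, (br_homog br hbr); apply JSinf_wt_jfunc; auto.
      * apply JS_RC; auto.
    + apply (subalg_feq _ (fadd (br n (jfunc e) g) (br n (jfunc e) g'))).
      * apply feq_sym, (br_addr br hbr); auto using JSinf_jfunc, JSsum_JSinf.
      * apply subalg_add; auto.
    + apply (subalg_feq _ (br n (jfunc e) g)); auto.
      apply (br_feq br hbr); auto using JSinf_jfunc, JSsum_JSinf, feq_refl.
  - apply (subalg_feq _ (fadd (br n f g) (br n f' g))).
    + apply feq_sym, (br_addl br hbr); auto using JSsum_JSinf.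
    + apply subalg_add; auto.
  - apply (subalg_feq _ (br n f g)); auto.
    apply (br_feq br hbr); auto using JSsum_JSinf, feq_refl.
Qed.
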